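(* Let $X$ be a smooth toric variety over $k$ and let $F\in A\text{-}\mathrm{GrMod}_{\theta}$ be finitely generated over $A$. Then the characteristic variety $\mathrm{Ch}(F)\subseteq\mathbb{A}^d\times\mathbb{A}^d$ is $T$-invariant and $$\pi\big(\mathrm{Ch}(F)\setminus(\mathrm{Var}(\mathfrak{b})\times\mathbb{A}^d)\big)=\mathrm{Ch}(\widetilde{F}),$$ where $\mathrm{Ch}(\widetilde F)\subseteq T^*X$ and $T^*X$ is canonically identified with $\pi(Z\cap V)$.
   Context: $k$ is an algebraically closed field of characteristic zero. $X$ is a smooth toric variety over $k$ determined by a fan $\Delta$ in a lattice $N\cong\mathbb{Z}^n$; $\mathbf{v}_1,\dots,\mathbf{v}_d$ are the primitive lattice vectors generating the one-dimensional cones of $\Delta$, assumed to span $N\otimes_{\mathbb{Z}}\mathbb{R}$. With $N^{\vee}=\mathrm{Hom}_{\mathbb Z}(N,\mathbb{Z})$ there is an exact sequence $0\to N^{\vee}\xrightarrow{\iota}\mathbb{Z}^d\to \mathrm{Cl}(X)\to 0$, where $\iota(\mathbf{p})=\sum_i\langle\mathbf{p},\mathbf{v}_i\rangle\mathbf{e}_i$ and the second map is $\mathbf{a}\mapsto\bar{\mathbf{a}}$. $\mathrm{Cl}(X)^{\vee}=\mathrm{Hom}_{\mathbb{Z}}(\mathrm{Cl}(X),\mathbb{Z})$. $S=k[x_1,\dots,x_d]$ is $\mathrm{Cl}(X)$-graded via $\deg(x^{\mathbf{a}})=\bar{\mathbf{a}}$. For $\sigma\in\Delta$, $x^{\hat\sigma}=\prod_{\mathbf{v}_i\notin\sigma}x_i$,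 $U_\sigma\cong\mathrm{Spec}\,(S_{x^{\hat\sigma}})_{\bar{\mathbf 0}}$ is the corresponding affine open of $X$, and $\mathfrak{b}=(x^{\hat\sigma}:\sigma\in\Delta)$. $A$ is the $d$-th Weyl algebra over $k$ on $x_i,\partial_i$, $\mathrm{Cl}(X)$-graded via $\deg(x^{\mathbf{a}}\partial^{\mathbf{b}})=\bar{\mathbf{a}}-\bar{\mathbf{b}}$. For $\bar{\mathbf{u}}\in\mathrm{Cl}(X)^{\vee}$, $\theta_{\bar{\mathbf{u}}}=\sum_{i}\langle\bar{\mathbf{u}},\bar{\mathbf{e}}_i\rangle x_i\partial_i$. $A\text{-}\mathrm{GrMod}_{\theta}$ is the category of graded left $A$-modules $F$ with $(\theta_{\bar{\mathbf{u}}}-\langle\bar{\mathbf{u}},\bar{\mathbf{a}}\rangle)F_{\bar{\mathbf{a}}}=0$ for all $\bar{\mathbf{a}}\in\mathrm{Cl}(X)$, $\bar{\mathbf{u}}\in\mathrm{Cl}(X)^{\vee}$. $\mathcal{D}$ is the sheaf of differential operators on $X$. The action of $(A_{x^{\hat\sigma}})_{\bar{\mathbf 0}}$ on $(S_{x^{\hat\sigma}})_{\bar{\mathbf 0}}$ induces a ring isomorphism $\bar\varphi_\sigma:(A_{x^{\hat\sigma}})_{\bar{\mathbf 0}}/(A_{x^{\hat\sigma}})_{\bar{\mathbf 0}}\cdot(\theta_{\bar{\mathbf{u}}}:\bar{\mathbf{u}}\in\mathrm{Cl}(X)^{\vee})\to H^0(U_\sigma,\mathcal{D})$, which preserves the order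 filtrations. $\widetilde{F}$ is the left $\mathcal{D}$-module with $H^0(U_\sigma,\widetilde F)=(F_{x^{\hat\sigma}})_{\bar{\mathbf 0}}$, on which $H^0(U_\sigma,\mathcal{D})$ acts through $\bar\varphi_\sigma^{-1}$. $S'=\mathrm{gr}(A)=k[x_1,\dots,x_d,\xi_1,\dots,\xi_d]$ (order filtration), the coordinate ring of $\mathbb{A}^d\times\mathbb{A}^d$, graded by $\deg x_i=-\deg\xi_i=\bar{\mathbf e}_i$. For a finitely generated $A$-module $F$ with a good filtration ($\mathrm{gr}(F)$ finitely generated over $S'$), $\mathrm{Ch}(F)$ is the variety of $\sqrt{\mathrm{Ann}_{S'}(\mathrm{gr}(F))}$. For a coherent $\mathcal{D}$-module $\mathcal{F}$ with a good filtration, $\mathrm{Ch}(\mathcal{F})\subseteq T^*X$ is the support of $\mathrm{gr}(\mathcal{F})$. $T=\mathrm{Hom}(\mathrm{Cl}(X),k^* )$ acts on $\mathbb{A}^d$ by $t\cdot(z_1,\dots,z_d)=(t(\bar{\mathbf e}_1)z_1,\dots,t(\bar{\mathbf e}_d)z_d)$ and on $\mathbb{A}^d\times\mathbb{A}^d$ by $t\cdot(z,w)=(t\cdot z,t^{-1}\cdot w)$. Let $U=\mathbb{A}^d\setminus\mathrm{Var}(\mathfrak{b})$ and $V=U\times\mathbb{A}^d$, and let $\pi:V\to X'$ be the geometric quotient of $V$ by $T$; locally it is given by $\{x^{\hat\sigma}\neq0\}\to\mathrm{Spec}\,(S'_{x^{\hat\sigma}})_{\bar{\mathbf 0}}$.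 Let $p_{\bar{\mathbf u}}=\sum_i\langle\bar{\mathbf u},\bar{\mathbf e}_i\rangle x_i\xi_i$ and $Z=\mathrm{Var}(p_{\bar{\mathbf u}}:\bar{\mathbf u}\in\mathrm{Cl}(X)^\vee)\subseteq\mathbb{A}^d\times\mathbb{A}^d$. For $F$ as in the claim one has $\mathrm{Ch}(F)\subseteq Z$. The canonical identification of $\pi(Z\cap V)$ with the cotangent bundle $T^*X$ over $X$ is the one which over $U_\sigma$ is given by the isomorphism $(S'_{x^{\hat\sigma}})_{\bar{\mathbf 0}}/(p_{\bar{\mathbf u}}:\bar{\mathbf u}\in\mathrm{Cl}(X)^\vee)\cong\mathrm{gr}\,H^0(U_\sigma,\mathcal{D})$ obtained from $\bar\varphi_\sigma$ by passing to associated graded rings. *)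

(* Defs.v *)
From HB Require Import structures.
From mathcomp Require Import all_boot all_order all_algebra.
From mathcomp Require Import fraction ring_quotient.
From mathcomp Require Import ring zify.
From mathcomp Require Import mpoly boolp classical_sets functions reals.
From Stdlib Require Import Relation_Operators.

Set Implicit Arguments.
Unset Strict Implicit.
Unset Printing Implicit Defensive.

Import Order.TTheory GRing.Theory Num.Theory.

Local Open Scope classical_set_scope.
Local Open Scope quotient_scope.
Local Open Scope ring_scope.

(* N = Z^n is 'rV[int]_n and N^vee is 'cV[int]_n.  The primitive generators of
   the rays are the rows of V : 'M[int]_(d, n).  A cone of the fan is encoded by
   the set of indices of its rays, hence a fan is a set of subsets of 'I_d. *)

Section Fan.
Variables (R : realType) (n d : nat) (V : 'M[int]_(d, n)).

Definition real_ray (i : 'I_d) : 'rV[R]_n := row i (map_mx intr V).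

Definition cone (sigma : {set 'I_d}) : set 'rV[R]_n :=
  [set x | exists2 c : 'I_d -> R, (forall i, 0 <= c i) &
                                  x = \sum_(i in sigma) c i *: real_ray i].

Definition is_face (tau sigma : {set 'I_d}) : Prop :=
  exists2 u : 'cV[R]_n, (forall i, i \in sigma -> 0 <= (real_ray i *m u) 0 0) &
    tau = [set i in sigma | (real_ray i *m u) 0 0 == 0]%SET.

Definition primitive (v : 'rV[int]_n) : Prop :=
  v != 0 /\ forall (c : int) (w : 'rV[int]_n), v = c *: w -> c = 1 \/ c = -1.

Definition part_of_basis (sigma : {set 'I_d}) : Prop :=
  exists (B : 'M[int]_n) (f : 'I_d -> 'I_n),
    [/\ B \in unitmx, {in sigma &, injective f} &
        forall i, i \in sigma -> row i V = row (f i) B].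

Record smooth_fan (Delta : {set {set 'I_d}}) : Prop := SmoothFan {
  fan_neq0 : Delta != finset.set0;
  fan_ray_inj : injective (fun i => row i V);
  fan_ray_primitive : forall i, primitive (row i V);
  fan_ray : forall i, [set i]%SET \in Delta;
  fan_face : forall sigma tau, sigma \in Delta -> is_face tau sigma ->
    tau \in Delta;
  fan_meet : forall sigma tau, sigma \in Delta -> tau \in Delta ->
    [/\ cone sigma `&` cone tau = cone (sigma :&: tau)%SET,
        is_face (sigma :&: tau)%SET sigma & is_face (sigma :&: tau)%SET tau];
  fan_smooth : forall sigma, sigma \in Delta -> part_of_basis sigma;
  fan_span : row_full (map_mx intr V : 'M[R]_(d, n)) }.

End Fan.

Section ClassGroup.
Variables (n d : nat) (V : 'M[int]_(d, n)).

Definition principal : {pred 'rV[int]_d} :=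
  [pred a | `[< exists p : 'cV[int]_n, a = \row_i (row i V *m p) 0 0 >]].

Lemma principal_zmod_closed : zmod_closed principal.
Proof.
split=> [|a b /asboolP[p ->] /asboolP[q ->]]; apply/asboolP.
  by exists 0; apply/rowP => i; rewrite [RHS]mxE mulmx0 !mxE.
by exists (p - q); apply/rowP => i; rewrite [RHS]mxE mulmxBr !mxE.
Qed.
HB.instance Definition _ :=
  GRing.isZmodClosed.Build 'rV[int]_d principal principal_zmod_closed.

Definition class_group : zmodType := Quotient.quot principal.

Definition class_of (a : 'rV[int]_d) : class_group := \pi_(Quotient.quot principal) a.

Definition class_var (i : 'I_d) : class_group := class_of (delta_mx 0 i).

Definition class_mnm (a : 'X_{1..d}) : class_group :=
  class_of (\row_i (a i)%:Z).

End ClassGroup.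

Section Weyl.
Variables (k : fieldType) (d : nat).

Notation S := {mpoly k[d]}.
Notation K := {fraction {mpoly k[d]}}.
Notation "f %:F" := (@FracField.tofrac {mpoly k[d]} f).

Definition xprod (J : {set 'I_d}) : S := \prod_(i in J) 'X_i.

(* The localization of k[x] at \prod_(i in J) x_i, inside k(x). *)
Definition Sloc (J : {set 'I_d}) : set K :=
  [set y | exists (f : S) (m : nat), y = f%:F / (xprod J ^+ m)%:F].

(* d/dx_i on k(x), by the quotient rule. *)
Definition der (i : 'I_d) (y : K) : K :=
  let r := repr y in
  ((\n_r)^`M(i) * \d_r - \n_r * (\d_r)^`M(i))%:F / (\d_r ^+ 2)%:F.

Definition der_mnm (b : 'X_{1..d}) (y : K) : K :=
  foldr (fun i => iter (b i) (der i)) y (enum 'I_d).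

(* The localization A_{x^J} of the Weyl algebra at x^J = \prod_(i in J) x_i is
   realized as the algebra of operators on k(x) generated by the multiplications
   by elements of k[x]_{x^J} and by the partial derivatives (in characteristic
   zero this action is faithful); A itself is the case where J is empty. *)
Inductive weyl_op (J : {set 'I_d}) : (K -> K) -> Prop :=
| weyl_mul a of Sloc J a : weyl_op J (fun y => a * y)
| weyl_der i : weyl_op J (der i)
| weyl_add P Q of weyl_op J P & weyl_op J Q : weyl_op J (fun y => P y + Q y)
| weyl_comp P Q of weyl_op J P & weyl_op J Q : weyl_op J (fun y => P (Q y)).

Lemma xprod_neq0 J : xprod J != 0.
Proof.
apply/prodf_neq0 => i _; apply/eqP => /(congr1 (mcoeff U_(i)%MM)).
by rewrite mcoeffX eqxx mcoeff0 => /eqP; rewrite oner_eq0.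
Qed.

Lemma xprodF_neq0 J m : (xprod J ^+ m)%:F != 0.
Proof. by rewrite tofrac_eq0 expf_neq0 ?xprod_neq0. Qed.

Lemma Sloc_poly J f : Sloc J f%:F.
Proof. by exists f, 0%N; rewrite expr0 tofrac1 divr1. Qed.

Fact fracP (L : fieldType) (a b c e : L) :
  b != 0 -> e != 0 -> a / b = c / e -> c * b = a * e.
Proof. by move=> b0 e0 /eqP; rewrite eqr_div // => /eqP->. Qed.

Fact fracP' (L : fieldType) (a b c e : L) :
  b != 0 -> e != 0 -> a * e = c * b -> a / b = c / e.
Proof. by move=> b0 e0 h; apply/eqP; rewrite eqr_div // h. Qed.

Fact derE_aux (L : idomainType) (n n' e e' f f' g g' : L) :
  n * g = f * e -> n' * g + n * g' = f' * e + f * e' ->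
  (n' * e - n * e') * g ^+ 2 = (f' * g - f * g') * e ^+ 2.
Proof.
move=> h h'; transitivity (e * g * (n' * g + n * g') - n * g * (e * g' + e' * g)).
  by ring.
by rewrite h h'; ring.
Qed.

Fact repr_frac (y : K) : y = (\n_(repr y))%:F / (\d_(repr y))%:F.
Proof.
have d0 : \d_(repr y) != 0 by exact: denom_ratioP.
apply: (mulIf (_ : (\d_(repr y))%:F != 0)); rewrite ?tofrac_eq0 //.
rewrite divfK ?tofrac_eq0 // -{1}[y]reprK; unlock FracField.tofrac.
rewrite -[LHS]FracField.pi_mul; apply/eqmodP.
by rewrite /= FracField.equivfE /FracField.mulf !numden_Ratio
  ?mulr1 ?oner_eq0 // mulrC.
Qed.

Lemma derE i (f g : S) : g != 0 ->
  der i (f%:F / g%:F) = (f^`M(i) * g - f * g^`M(i))%:F / (g ^+ 2)%:F.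
Proof.
move=> g0; rewrite /der; set y := f%:F / g%:F; set r := repr y.
have d0 : \d_r != 0 by exact: denom_ratioP.
have yE : y = (\n_r)%:F / (\d_r)%:F by exact: repr_frac.
have cross : \n_r * g = f * \d_r.
  apply/eqP; rewrite -tofrac_eq [X in X == _]tofracM [X in _ == X]tofracM.
  by apply/eqP/(fracP _ _ yE); rewrite tofrac_eq0.
have dcross := congr1 (mderiv i) cross; rewrite !mderivM in dcross.
apply: fracP'; rewrite ?tofrac_eq0 ?expf_neq0 // -!tofracM; congr (_%:F).
exact: derE_aux cross dcross.
Qed.

Fact der_mul_denom_aux (L : fieldType) (f g df dg : L) : g != 0 ->
  (df * g - f * dg) / (g * g) * g = df - f / g * dg.
Proof. by move=> g0; field. Qed.

Lemma der_mul_denom i (y : K) (f g : S) : g != 0 -> y * g%:F = f%:F ->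
  der i y * g%:F = (f^`M(i))%:F - y * (g^`M(i))%:F.
Proof.
move=> g0 yg; have gF0 : g%:F != 0 :> K by rewrite tofrac_eq0.
have -> : y = f%:F / g%:F by rewrite -yg mulfK.
rewrite derE // tofracB 3!tofracM.
exact: der_mul_denom_aux.
Qed.

Fact frac_ex (y : K) : exists f g : S, g != 0 /\ y * g%:F = f%:F.
Proof.
have d0 : \d_(repr y) != 0 by exact: denom_ratioP.
exists \n_(repr y), \d_(repr y); split=> //.
by rewrite {1}(repr_frac y) divfK // tofrac_eq0.
Qed.

Fact derD_aux0 (L : fieldType) (y y' g g' : L) :
  (y + y') * (g * g') = y * g * g' + y' * g' * g.
Proof. by ring. Qed.

Fact derD_aux (L : fieldType) (u v w f f' g g' df df' dg dg' y y' : L) :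
  g != 0 -> g' != 0 -> y * g = f -> y' * g' = f' ->
  u * g = df - y * dg -> v * g' = df' - y' * dg' ->
  w * (g * g') = df * g' + f * dg' + (df' * g + f' * dg)
                 - (y + y') * (dg * g' + g * dg') ->
  w = u + v.
Proof.
move=> g0 g0' h h' e e' ew; apply: (mulIf (mulf_neq0 g0 g0')); rewrite ew.
transitivity (u * g * g' + v * g' * g); last by ring.
by rewrite e e' -h -h'; ring.
Qed.

Fact derM_aux (L : fieldType) (u v w f f' g g' df df' dg dg' y y' : L) :
  g != 0 -> g' != 0 -> y * g = f -> y' * g' = f' ->
  u * g = df - y * dg -> v * g' = df' - y' * dg' ->
  w * (g * g') = df * f' + f * df' - (y * y') * (dg * g' + g * dg') ->
  w = u * y' + y * v.
Proof.
move=> g0 g0' h h' e e' ew; apply: (mulIf (mulf_neq0 g0 g0')); rewrite ew.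
transitivity (u * g * y' * g' + v * g' * g * y); last by ring.
by rewrite e e' -h -h'; ring.
Qed.

Lemma derD i : {morph der i : y y' / y + y'}.
Proof.
move=> y y'.
have [f [g [g0 yg]]] := frac_ex y; have [f' [g' [g0' yg']]] := frac_ex y'.
have e := der_mul_denom i g0 yg; have e' := der_mul_denom i g0' yg'.
have yy : (y + y') * (g * g')%:F = (f * g' + f' * g)%:F.
  by rewrite tofracD 3!tofracM -yg -yg'; exact: derD_aux0.
have := der_mul_denom i (mulf_neq0 g0 g0') yy.
rewrite mderivD 3!mderivM 4!tofracD 7!tofracM => ew.
apply: (derD_aux _ _ yg yg' e e' ew); by rewrite tofrac_eq0.
Qed.

Lemma derM i y y' : der i (y * y') = der i y * y' + y * der i y'.
Proof.
have [f [g [g0 yg]]] := frac_ex y; have [f' [g' [g0' yg']]] := frac_ex y'.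
have e := der_mul_denom i g0 yg; have e' := der_mul_denom i g0' yg'.
have yy : (y * y') * (g * g')%:F = (f * f')%:F.
  by rewrite 2!tofracM -yg -yg'; exact: mulrACA.
have := der_mul_denom i (mulf_neq0 g0 g0') yy.
rewrite 2!mderivM 2!tofracD 5!tofracM => ew.
apply: (derM_aux _ _ yg yg' e e' ew); by rewrite tofrac_eq0.
Qed.

Lemma der_poly i (f : S) : der i f%:F = (f^`M(i))%:F.
Proof.
have h : f%:F * 1%:F = f%:F :> K by rewrite tofrac1 mulr1.
have := der_mul_denom i (oner_neq0 _) h.
by rewrite tofrac1 mulr1 -mpolyC1 mderivC tofrac0 mulr0 subr0.
Qed.

Lemma weyl_opD J P : weyl_op J P -> {morph P : y y' / y + y'}.
Proof.
elim=> [a _|i|{}P Q _ hP _ hQ|{}P Q _ hP _ hQ] y y' /=; first exact: mulrDr.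
- exact: derD.
- by rewrite hP hQ addrACA.
- by rewrite hQ hP.
Qed.


Lemma weyl_op_poly J (f : S) : weyl_op J (fun y => f%:F * y).
Proof. by apply: weyl_mul; exact: Sloc_poly. Qed.

Definition weyl_pred (J : {set 'I_d}) : {pred K -> K} :=
  [pred P | `[< weyl_op J P >]].

Lemma weyl_zmod_closed J : zmod_closed (weyl_pred J).
Proof.
split=> [|P Q /asboolP hP /asboolP hQ]; apply/asboolP.
  have := weyl_op_poly J 0; rewrite tofrac0.
  by congr weyl_op; apply/funext => y; rewrite mul0r.
have := weyl_add hP (weyl_comp (weyl_op_poly J (-1)) hQ).
by congr weyl_op; apply/funext => y; rewrite tofracN tofrac1 mulN1r.
Qed.
HB.instance Definition _ J :=
  GRing.isZmodClosed.Build (K -> K) (weyl_pred J) (weyl_zmod_closed J).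

Record weyl (J : {set 'I_d}) : Type :=
  Weyl { weyl_fun :> K -> K; _ : weyl_fun \in weyl_pred J }.

HB.instance Definition _ J := [isSub for @weyl_fun J].
HB.instance Definition _ J := [Choice of weyl J by <:].
HB.instance Definition _ J := [SubChoice_isSubZmodule of weyl J by <:].

Section WeylRing.
Variable J : {set 'I_d}.
Implicit Types P Q T : weyl J.

Fact weylP P : weyl_op J P.
Proof. by apply/asboolP; exact: (valP P). Qed.

Fact weyl_ext P Q : (forall y, P y = Q y) -> P = Q.
Proof. by move=> PQ; apply: val_inj; apply/funext. Qed.

Definition weyl_poly (f : S) : weyl J :=
  @Weyl J (fun y => f%:F * y) (introT (asboolP _) (weyl_op_poly J f)).

Definition weyl_pd (i : 'I_d) : weyl J :=
  @Weyl J (der i) (introT (asboolP _) (weyl_der J i)).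

Definition weyl_one : weyl J := weyl_poly 1.

Definition weyl_prod P Q : weyl J :=
  @Weyl J (fun y => P (Q y)) (introT (asboolP _) (weyl_comp (weylP P) (weylP Q))).

Fact weyl_prodA : associative weyl_prod.
Proof. by move=> P Q T; apply: weyl_ext. Qed.

Fact weyl_prod1l : left_id weyl_one weyl_prod.
Proof. by move=> P; apply: weyl_ext => y /=; rewrite tofrac1 mul1r. Qed.

Fact weyl_prod1r : right_id weyl_one weyl_prod.
Proof. by move=> P; apply: weyl_ext => y /=; rewrite tofrac1 mul1r. Qed.

Fact weyl_prodDl : left_distributive weyl_prod +%R.
Proof. by move=> P Q T; apply: weyl_ext. Qed.

Fact weyl_prodDr : right_distributive weyl_prod +%R.
Proof. by move=> P Q T; apply: weyl_ext => y /=; rewrite (weyl_opD (weylP P)). Qed.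

Fact weyl_one_neq0 : weyl_one != 0.
Proof.
apply/eqP => /(congr1 (fun P : weyl J => P 1)) /=.
by rewrite tofrac1 mulr1 => /eqP; rewrite oner_eq0.
Qed.

HB.instance Definition _ := GRing.Zmodule_isNzRing.Build (weyl J)
  weyl_prodA weyl_prod1l weyl_prod1r weyl_prodDl weyl_prodDr weyl_one_neq0.

Lemma weylDE P Q y : (P + Q) y = P y + Q y. Proof. by []. Qed.
Lemma weylNE P y : (- P) y = - P y. Proof. by []. Qed.
Lemma weyl0E y : (0 : weyl J) y = 0. Proof. by []. Qed.
Lemma weylME P Q y : (P * Q) y = P (Q y). Proof. by []. Qed.
Lemma weyl1E y : (1 : weyl J) y = y.
Proof. by rewrite /= tofrac1 mul1r. Qed.

Lemma weyl_polyM : {morph weyl_poly : f g / f * g}.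
Proof. by move=> f g; apply: weyl_ext => y /=; rewrite tofracM mulrA. Qed.

Lemma weyl_polyC f g : weyl_poly f * weyl_poly g = weyl_poly g * weyl_poly f.
Proof. by rewrite -!weyl_polyM mulrC. Qed.

Lemma weyl_pd_poly i f :
  weyl_pd i * weyl_poly f = weyl_poly f * weyl_pd i + weyl_poly f^`M(i).
Proof.
by apply: weyl_ext => y; rewrite weylDE !weylME /= derM der_poly addrC.
Qed.

End WeylRing.

(* The order filtration of A_{x^J}: normally ordered operators are indexed by
   polynomials in xi_1, ..., xi_d with coefficients in k[x]_{x^J}, that is, by
   the elements of S'_{x^J}. *)
Definition normal_op (q : {mpoly K[d]}) : K -> K :=
  fun y => \sum_(b <- msupp q) q@_b * der_mnm b y.

Definition Sploc (J : {set 'I_d}) : set {mpoly K[d]} :=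
  [set q | forall b, Sloc J q@_b].

Definition weyl_order (J : {set 'I_d}) (m : nat) : set (weyl J) :=
  [set P | exists2 q, Sploc J q /\ (msize q <= m.+1)%N &
                      weyl_fun P = normal_op q].

(* The class in gr_m(A_{x^J}) = (S'_{x^J})_m of an operator of order <= m. *)
Definition has_symbol (J : {set 'I_d}) (m : nat) (P : weyl J)
    (s : {mpoly K[d]}) : Prop :=
  exists2 q, [/\ Sploc J q, (msize q <= m.+1)%N & weyl_fun P = normal_op q] &
             s = pihomog mdeg m q.

Fact lift_mul_aux (L : fieldType) (x x' f y : L) : x != 0 -> x' != 0 ->
  x * x' * (f / x' * (y / x)) = f * y.
Proof. by move=> x0 x0'; field; rewrite x0 x0'. Qed.

Fact lift_der_aux (L : fieldType) (x y u x' : L) : x != 0 ->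
  x * x * u = x * (u * x + y / x * x') - x' * y.
Proof. by move=> x0; field. Qed.

Fact lifts_shift_aux (L : fieldType) (x x' y : L) : x' != 0 ->
  y / x = x' * y / (x * x').
Proof. by move=> x0; rewrite [x' * y]mulrC -mulf_div divff // mulr1. Qed.

Fact lift_add_aux (L : fieldType) (x x' y y' : L) :
  x * x' * (y + y') = x' * (x * y) + x * (x' * y').
Proof. by ring. Qed.

Lemma weyl_lift J (P : K -> K) (l : nat) : weyl_op J P ->
  exists (m : nat) (Q : weyl finset.set0), forall y,
    (xprod J ^+ m)%:F * P (y / (xprod J ^+ l)%:F) = Q y.
Proof.
move=> hP; elim: hP l => [a [f [p ->]]|i|{}P Q _ hP _ hQ|{}P Q _ hP _ hQ] l.
- exists (l + p)%N, (weyl_poly _ f) => y.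
  rewrite exprD tofracM; exact: lift_mul_aux (xprodF_neq0 J l) (xprodF_neq0 J p).
- exists (l + l)%N, (weyl_poly _ (xprod J ^+ l) * weyl_pd _ i
    - weyl_poly _ (xprod J ^+ l)^`M(i)) => y.
  rewrite weylDE weylNE weylME exprD tofracM /= -der_poly.
  set x := (xprod J ^+ l)%:F; have x0 : x != 0 := xprodF_neq0 J l.
  have yE : der i y = der i (y / x) * x + y / x * der i x.
    by rewrite -derM divfK.
  by rewrite yE; exact: lift_der_aux.
- have [m1 [Q1 h1]] := hP l; have [m2 [Q2 h2]] := hQ l.
  exists (m1 + m2)%N, (weyl_poly _ (xprod J ^+ m2) * Q1
    + weyl_poly _ (xprod J ^+ m1) * Q2) => y.
  rewrite weylDE 2!weylME -h1 -h2 exprD tofracM.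
  exact: lift_add_aux.
- have [m1 [Q1 h1]] := hQ l; have [m2 [P2 h2]] := hP m1.
  exists m2, (P2 * Q1) => y; rewrite weylME -h2 -h1.
  by rewrite [_%:F * Q _]mulrC mulfK ?xprodF_neq0.
Qed.

End Weyl.

Notation weyl_algebra k d := (@weyl k d (@finset.set0 'I_d)).

Section Localization.
Variables (k : fieldType) (d : nat) (F : lmodType (weyl_algebra k d)).
Variable J : {set 'I_d}.

Definition xpow (m : nat) : weyl_algebra k d :=
  weyl_poly finset.set0 (xprod k J ^+ m).

Fact xpowD m l : xpow (m + l) = xpow m * xpow l.
Proof. by rewrite -weyl_polyM -exprD. Qed.

Fact xpowC m l : xpow m * xpow l = xpow l * xpow m.
Proof. exact: weyl_polyC. Qed.

Fact xpowZD m l (f : F) : xpow (m + l) *: f = xpow m *: (xpow l *: f).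
Proof. by rewrite xpowD scalerA. Qed.

Fact xpowZC m l (f : F) : xpow m *: (xpow l *: f) = xpow l *: (xpow m *: f).
Proof. by rewrite -!xpowZD addnC. Qed.

Fact xpow0 : xpow 0 = 1. Proof. by rewrite /xpow expr0. Qed.

(* (f, l) stands for the fraction f / (x^J)^l. *)
Definition loc_equiv (u v : F * nat) : bool :=
  `[< exists r, xpow (v.2 + r) *: u.1 = xpow (u.2 + r) *: v.1 >].

Fact loc_equiv_refl : reflexive loc_equiv.
Proof. by move=> u; apply/asboolP; exists 0%N. Qed.

Fact loc_equiv_sym : ssrbool.symmetric loc_equiv.
Proof. by move=> u v; apply/asboolP/asboolP => -[r e]; exists r. Qed.

Fact loc_equiv_trans : transitive loc_equiv.
Proof.
move=> v u w /asboolP[r e] /asboolP[s e']; apply/asboolP.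
exists (v.2 + r + s)%N.
have -> : (w.2 + (v.2 + r + s) = (w.2 + s) + (v.2 + r))%N by lia.
have -> : (u.2 + (v.2 + r + s) = (u.2 + r) + (v.2 + s))%N by lia.
by rewrite !(xpowD (_ + _) (_ + _)) -!scalerA e -e' !scalerA xpowC.
Qed.

Canonical loc_equivRel :=
  EquivRel loc_equiv loc_equiv_refl loc_equiv_sym loc_equiv_trans.

Definition loc := {eq_quot loc_equiv}.
HB.instance Definition _ := Choice.on loc.

Definition frac_of (f : F) (l : nat) : loc := \pi_({eq_quot loc_equiv}) (f, l).

Fact frac_ofP f l g m : frac_of f l = frac_of g m <->
  exists r, xpow (m + r) *: f = xpow (l + r) *: g.
Proof.
split=> [/eqmodP/asboolP //|h].
by apply/eqmodP/asboolP.
Qed.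

Fact frac_ofK (u : loc) : frac_of (repr u).1 (repr u).2 = u.
Proof. by rewrite /frac_of -surjective_pairing reprK. Qed.

Fact frac_of_scale f l r : frac_of (xpow r *: f) (r + l) = frac_of f l.
Proof. by apply/frac_ofP; exists 0%N; rewrite !addn0 addnC xpowD scalerA. Qed.

Fact frac_of_ind (P : loc -> Prop) : (forall f l, P (frac_of f l)) ->
  forall u, P u.
Proof. by move=> h u; rewrite -(frac_ofK u). Qed.

Fact frac_of_common (u v : loc) :
  exists f g l, u = frac_of f l /\ v = frac_of g l.
Proof.
elim/frac_of_ind: u => f l; elim/frac_of_ind: v => g m.
exists (xpow m *: f), (xpow l *: g), (m + l)%N.
by rewrite frac_of_scale addnC frac_of_scale.
Qed.

Definition loc0 : loc := frac_of 0 0.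
Definition locD (u v : loc) : loc :=
  let a := repr u in let b := repr v in
  frac_of (xpow b.2 *: a.1 + xpow a.2 *: b.1) (a.2 + b.2).
Definition locN (u : loc) : loc := frac_of (- (repr u).1) (repr u).2.

Fact loc0E l : loc0 = frac_of 0 l.
Proof. by apply/frac_ofP; exists 0%N; rewrite !scaler0. Qed.

Fact locNE f l : locN (frac_of f l) = frac_of (- f) l.
Proof.
rewrite /locN; move: (frac_ofK (frac_of f l)) => /frac_ofP[r e].
by apply/frac_ofP; exists r; rewrite !scalerN e.
Qed.

Fact locDE f g l : locD (frac_of f l) (frac_of g l) = frac_of (f + g) l.
Proof.
rewrite /locD; move: (frac_ofK (frac_of f l)) (frac_ofK (frac_of g l)).
case: (repr (frac_of f l)) (repr (frac_of g l)) => [a m] [b p] /=.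
move=> /frac_ofP[r e] /frac_ofP[s e']; apply/frac_ofP; exists (r + l + s)%N.
rewrite !scalerDr; congr (_ + _).
  have -> : (l + (r + l + s) = (l + s) + (l + r))%N by lia.
  have -> : (m + p + (r + l + s) = (l + s) + p + (m + r))%N by lia.
  rewrite (xpowZD (_ + _) (_ + _)) (xpowZC (l + r) p) e.
  by rewrite (xpowZD (_ + _ + _) (_ + _)) (xpowZD _ p).
have -> : (l + (r + l + s) = (l + r) + (l + s))%N by lia.
have -> : (m + p + (r + l + s) = (l + r) + m + (p + s))%N by lia.
rewrite (xpowZD (_ + _) (_ + _)) (xpowZC (l + s) m) e'.
by rewrite (xpowZD (_ + _ + _) (_ + _)) (xpowZD _ m).
Qed.

Fact locDA : associative locD.
Proof.
move=> u v w; have [f [g [l [-> ->]]]] := frac_of_common u v.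
elim/frac_of_ind: w => h m.
rewrite -(frac_of_scale f l m) -(frac_of_scale g l m) -(frac_of_scale h m l).
by rewrite addnC !locDE addrA.
Qed.

Fact locDC : commutative locD.
Proof.
move=> u v; have [f [g [l [-> ->]]]] := frac_of_common u v.
by rewrite !locDE addrC.
Qed.

Fact loc0D : left_id loc0 locD.
Proof. by elim/frac_of_ind=> f l; rewrite (loc0E l) locDE add0r. Qed.

Fact locND : left_inverse loc0 locN locD.
Proof. by elim/frac_of_ind=> f l; rewrite (loc0E l) locNE locDE addNr. Qed.

HB.instance Definition _ := GRing.isZmodule.Build loc locDA locDC loc0D locND.

Fact frac_ofD f g l : frac_of f l + frac_of g l = frac_of (f + g) l.
Proof. exact: locDE. Qed.

(* P (f / (x^J)^l) = (Q f) / (x^J)^m, where (x^J)^m P (x^J)^(-l) = Q in A. *)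
Definition lifts (P : weyl k J) (l m : nat) (Q : weyl_algebra k d) : Prop :=
  forall y, (@FracField.tofrac {mpoly k[d]} (xprod k J ^+ m)) *
    P (y / @FracField.tofrac {mpoly k[d]} (xprod k J ^+ l)) = Q y.

Fact lifts_ex P l : exists mQ : nat * weyl_algebra k d, lifts P l mQ.1 mQ.2.
Proof. by have [m [Q h]] := weyl_lift l (weylP P); exists (m, Q). Qed.

Definition locZ (P : weyl k J) (u : loc) : loc :=
  let a := repr u in
  let mQ := sval (cid (lifts_ex P a.2)) in frac_of (mQ.2 *: a.1) mQ.1.

Fact lifts_shift P l m Q r s : lifts P (l + r) m Q ->
  lifts P l (s + m) (xpow s * Q * xpow r).
Proof.
move=> h y; rewrite !weylME -h /= [in LHS]exprD tofracM -mulrA; congr (_ * (_ * P _)).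
rewrite exprD tofracM; apply: lifts_shift_aux; exact: xprodF_neq0.
Qed.

Fact lifts_eq P l m Q m' Q' : lifts P l m Q -> lifts P l m' Q' ->
  xpow m' * Q = xpow m * Q'.
Proof.
move=> h h'; apply: weyl_ext => y; rewrite !weylME -h -h' /=; exact: mulrCA.
Qed.

Fact locZE P f l m Q : lifts P l m Q -> locZ P (frac_of f l) = frac_of (Q *: f) m.
Proof.
move=> h; rewrite /locZ; move: (frac_ofK (frac_of f l)).
case: (repr (frac_of f l)) => [a p] /= /frac_ofP[r e].
case: cid => -[m' Q'] /= h'.
have [[c T] /= hT] := lifts_ex P (p + l + r).
have hT1 : lifts P l (0 + c) (xpow 0 * T * xpow (p + r)).
  by apply: lifts_shift; rewrite (_ : _ + _ = p + l + r)%N //; lia.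
have hT2 : lifts P p (0 + c) (xpow 0 * T * xpow (l + r)).
  by apply: lifts_shift; rewrite (_ : _ + _ = p + l + r)%N //; lia.
rewrite xpow0 mul1r add0n in hT1 hT2.
have e1 := lifts_eq h hT1; have e2 := lifts_eq h' hT2.
apply/frac_ofP; exists c.
rewrite (addnC m) (addnC m') !xpowD 2!scalerA.
have -> : xpow c * xpow m * Q' = xpow m * (xpow m' * (T * xpow (l + r))).
  by rewrite -e2 mulrA (xpowC c).
have -> : xpow c * xpow m' * Q = xpow m' * (xpow m * (T * xpow (p + r))).
  by rewrite -e1 mulrA (xpowC c).
by rewrite -!scalerA e !scalerA (xpowC m').
Qed.

Fact locZA P P' u : locZ P (locZ P' u) = locZ (P * P') u.
Proof.
elim/frac_of_ind: u => f l.
have [[a Q'] /= h'] := lifts_ex P' l; have [[b Q] /= h] := lifts_ex P a.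
rewrite (locZE _ h') (locZE _ h) scalerA (@locZE _ _ _ b (Q * Q')) //.
move=> y; rewrite 2!weylME -h -h'; congr (_ * P _).
by rewrite [X in _ = X / _]mulrC mulfK ?xprodF_neq0.
Qed.

Fact loc1Z : left_id 1 locZ.
Proof.
elim/frac_of_ind=> f l; rewrite (@locZE _ _ _ l 1) ?scale1r // => y.
by rewrite !weyl1E mulrC divfK ?xprodF_neq0.
Qed.

Fact locZDr : right_distributive locZ +%R.
Proof.
move=> P u v; have [f [g [l [-> ->]]]] := frac_of_common u v.
have [[a Q] /= h] := lifts_ex P l.
by rewrite frac_ofD !(locZE _ h) frac_ofD scalerDr.
Qed.

Fact locZDl u : {morph locZ^~ u : P P' / P + P'}.
Proof.
move=> P P'; elim/frac_of_ind: u => f l.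
have [[a Q] /= h] := lifts_ex P l; have [[a' Q'] /= h'] := lifts_ex P' l.
rewrite (locZE _ h) (locZE _ h') (@locZE _ _ _ (a + a') (xpow a' * Q + xpow a * Q')).
  rewrite -(frac_of_scale (Q *: f) a a') -(frac_of_scale (Q' *: f) a' a).
  by rewrite [(a' + a)%N]addnC frac_ofD !scalerA -scalerDl.
move=> y; rewrite !weylDE !weylME -h -h' exprD tofracM; exact: lift_add_aux.
Qed.

HB.instance Definition _ := GRing.Zmodule_isLmodule.Build (weyl k J) loc
  locZA loc1Z locZDr locZDl.

End Localization.

(* Restriction F_{x^J} -> F_{x^J'} for J included in J'. *)
Definition loc_res (k : fieldType) (d : nat) (F : lmodType (weyl_algebra k d))
    (J J' : {set 'I_d}) (u : loc F J) : loc F J' :=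
  let a := repr u in
  frac_of J' (weyl_poly finset.set0 (xprod k (J' :\: J) ^+ a.2) *: a.1) a.2.

Section Grading.
Variables (k : fieldType) (n d : nat) (V : 'M[int]_(d, n)).

Notation S := {mpoly k[d]}.
Notation K := {fraction {mpoly k[d]}}.
Notation "f %:F" := (@FracField.tofrac {mpoly k[d]} f).

Definition class_homog (c : class_group V) (f : S) : Prop :=
  forall b, b \in msupp f -> class_mnm V b = c.

Definition xdeg (J : {set 'I_d}) : class_group V := \sum_(i in J) class_var V i.

(* The piece of degree c of k[x]_{x^J}. *)
Definition Sgr (J : {set 'I_d}) (c : class_group V) : set K :=
  [set y | exists (f : S) (m : nat),
     class_homog (c + xdeg J *+ m) f /\ y = f%:F / (xprod k J ^+ m)%:F].

(* The piece of degree c of S'_{x^J}; recall that deg(xi^b) = - deg(x^b). *)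
Definition Spgr (J : {set 'I_d}) (c : class_group V) : set {mpoly K[d]} :=
  [set q | forall b, Sgr J (c + class_mnm V b) q@_b].

Definition weyl_gr (J : {set 'I_d}) (c : class_group V) : set (weyl k J) :=
  [set P | exists2 q, Spgr J c q & weyl_fun P = normal_op q].

Fact class_ofD : {morph @class_of n d V : a b / a + b}.
Proof. by move=> a b; exact: Quotient.pi_add. Qed.

Fact class_mnmD (a b : 'X_{1..d}) :
  class_mnm V (a + b)%MM = class_mnm V a + class_mnm V b.
Proof.
rewrite /class_mnm -class_ofD; congr class_of.
by apply/rowP => i; rewrite !mxE mnmDE PoszD.
Qed.

Fact class_mnm0 : class_mnm V 0%MM = 0.
Proof. by apply: (addrI (class_mnm V 0%MM)); rewrite -class_mnmD addm0 addr0. Qed.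

Fact class_mnmU i : class_mnm V U_(i)%MM = class_var V i.
Proof.
rewrite /class_mnm /class_var; congr class_of; apply/rowP => j.
by rewrite !mxE mnm1E eqxx /= eq_sym; case: eqP.
Qed.

Fact class_homogB c f g : class_homog c f -> class_homog c g -> class_homog c (f - g).
Proof.
move=> hf hg b /msuppB_le; rewrite mem_cat => /orP[]; [exact: hf|exact: hg].
Qed.

Fact class_homogM c c' f g : class_homog c f -> class_homog c' g -> class_homog (c + c') (f * g).
Proof.
move=> hf hg b /msuppM_le /allpairsP[[a e] /= [ha he ->]].
by rewrite class_mnmD (hf _ ha) (hg _ he).
Qed.

Fact class_homog1 : class_homog 0 1.
Proof. by move=> b; rewrite msupp1 inE => /eqP->; exact: class_mnm0. Qed.

Fact class_homog_const a : class_homog 0 a%:MP.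
Proof.
move=> b; rewrite msuppC; case: ifP => // _.
by rewrite inE => /eqP->; exact: class_mnm0.
Qed.

Fact class_homogX c f m : class_homog c f -> class_homog (c *+ m) (f ^+ m).
Proof.
move=> hf; elim: m => [|m IH]; first exact: class_homog1.
by rewrite exprS mulrS; exact: class_homogM.
Qed.

Fact class_homog_xprod J m : class_homog (xdeg J *+ m) (xprod k J ^+ m).
Proof.
apply: class_homogX; rewrite /xdeg /xprod.
elim/big_rec2: _ => [|i c f _ IH]; first exact: class_homog1.
apply: class_homogM => // b; rewrite msuppX inE => /eqP->; exact: class_mnmU.
Qed.

Definition chart_pred (J : {set 'I_d}) : {pred K} := [pred y | `[< Sgr J 0 y >]].

Fact chart_subring_closed J : subring_closed (chart_pred J).
Proof.
split=> [|y y' /asboolP[f [m [hf ->]]] /asboolP[g [l [hg ->]]]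
         |y y' /asboolP[f [m [hf ->]]] /asboolP[g [l [hg ->]]]]; apply/asboolP.
- exists 1, 0%N; split; first by rewrite mulr0n addr0; exact: class_homog1.
  by rewrite expr0 tofrac1 divr1.
- rewrite add0r in hf; rewrite add0r in hg.
  exists (f * xprod k J ^+ l - g * xprod k J ^+ m), (m + l)%N; split.
    rewrite add0r mulrnDr; apply: class_homogB.
      exact: class_homogM hf (@class_homog_xprod J l).
    rewrite [X in class_homog X _]addrC; exact: class_homogM hg (@class_homog_xprod J m).
  rewrite -mulNr addf_div ?xprodF_neq0 // exprD tofracB 3!tofracM.
  by rewrite mulNr.
- rewrite add0r in hf; rewrite add0r in hg.
  exists (f * g), (m + l)%N; split.
    by rewrite add0r mulrnDr; exact: class_homogM.
  by rewrite mulf_div exprD 2!tofracM.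
Qed.
HB.instance Definition _ J :=
  GRing.isSubringClosed.Build K (chart_pred J) (chart_subring_closed J).

(* The coordinate ring (S_{x^sigmahat})_0 of U_sigma. *)
Record chart_ring (sigma : {set 'I_d}) : Type :=
  ChartRing { chart_val :> K; _ : chart_val \in chart_pred (~: sigma)%SET }.
HB.instance Definition _ sigma := [isSub for @chart_val sigma].
HB.instance Definition _ sigma := [Choice of chart_ring sigma by <:].
HB.instance Definition _ sigma :=
  [SubChoice_isSubComNzRing of chart_ring sigma by <:].

Fact chart_const_subproof sigma (a : k) :
  (a%:MP)%:F \in chart_pred (~: sigma)%SET.
Proof.
apply/asboolP; exists a%:MP, 0%N; split.
  by rewrite mulr0n addr0; exact: class_homog_const.
by rewrite expr0 tofrac1 divr1.
Qed.

Definition chart_const sigma (a : k) : chart_ring sigma :=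
  ChartRing (chart_const_subproof sigma a).

End Grading.

(* Objects of A-GrMod_theta. *)
Section ThetaGraded.
Variables (k : fieldType) (n d : nat) (V : 'M[int]_(d, n)).
Variable F : lmodType (weyl_algebra k d).

Definition theta (u : {additive class_group V -> int}) : weyl_algebra k d :=
  \sum_(i < d) (weyl_poly finset.set0 'X_i * weyl_pd k finset.set0 i)
                  *~ u (class_var V i).

Record theta_graded (Fgr : class_group V -> set F) : Prop := ThetaGraded {
  gr_zmod : forall c, Fgr c 0 /\ forall f g, Fgr c f -> Fgr c g -> Fgr c (f - g);
  gr_action : forall c c' P f, weyl_gr c P -> Fgr c' f -> Fgr (c + c') (P *: f);
  gr_span : forall f, exists (s : seq (class_group V)) (g : class_group V -> F),
    (forall c, Fgr c (g c)) /\ f = \sum_(c <- s) g c;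
  gr_direct : forall (s : seq (class_group V)) (g : class_group V -> F),
    uniq s -> (forall c, Fgr c (g c)) -> \sum_(c <- s) g c = 0 ->
    forall c, c \in s -> g c = 0;
  gr_theta : forall (u : {additive class_group V -> int}) c f,
    Fgr c f -> (theta u - (u c)%:~R) *: f = 0 }.

Definition finitely_generated : Prop :=
  exists (r : nat) (g : 'I_r -> F), forall f,
    exists c : 'I_r -> weyl_algebra k d, f = \sum_(i < r) c i *: g i.

(* H^0(U_sigma, F~) = (F_{x^sigmahat})_0 *)
Definition chart_mod (Fgr : class_group V -> set F) (sigma : {set 'I_d}) :
    set (loc F (~: sigma)%SET) :=
  [set u | exists (f : F) (l : nat),
     Fgr (xdeg V (~: sigma)%SET *+ l) f /\ u = frac_of _ f l].

End ThetaGraded.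

Arguments chart_mod {k n d V F} Fgr sigma u.

(* B is a ring filtered by Bfil, acting by act on the submodule N of M.
   Filtrations are indexed by nat, with Fil_{-1} = 0.  An element of a graded
   ring or module associated with a filtration is given by representatives of
   its homogeneous components. *)
Section Filtration.
Variables (B : Type) (Bfil : nat -> set B).
Variables (M : zmodType) (act : B -> M -> M) (N : set M).
Implicit Type Fil : nat -> set M.

Definition fil_prev Fil (l : nat) : set M :=
  if l is l'.+1 then Fil l' else [set 0].

Definition gr_finitely_generated Fil : Prop :=
  exists (r : nat) (e : 'I_r -> nat) (g : 'I_r -> M),
    (forall i, Fil (e i) (g i)) /\
    forall l u, Fil l u -> exists b : 'I_r -> B,
      (forall i, (e i <= l)%N -> Bfil (l - e i)%N (b i)) /\
      fil_prev Fil l (u - \sum_(i < r | (e i <= l)%N) act (b i) (g i)).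

Record good_filtration Fil : Prop := GoodFiltration {
  fil_zmod : forall l, Fil l 0 /\ forall u v, Fil l u -> Fil l v -> Fil l (u - v);
  fil_mono : forall l, Fil l `<=` Fil l.+1;
  fil_exhaustive : \bigcup_l Fil l = N;
  fil_act : forall m l b u, Bfil m b -> Fil l u -> Fil (m + l)%N (act b u);
  fil_gr_fg : gr_finitely_generated Fil }.

(* The product in gr(M) of s = sum_{m < a} [s_m] in gr(B) and
   x = sum_{j < c} [x_j] in gr(M) is zero. *)
Definition gr_act_eq0 Fil (a : nat) (s : nat -> B) (c : nat) (x : nat -> M) : Prop :=
  forall l, fil_prev Fil l
    (\sum_(m < a) \sum_(j < c | (m + j == l)%N) act (s m) (x j)).

(* The localization of gr(M) at the maximal ideal of gr(B) given by the k-point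
   chi = (chi_m : gr_m(B) -> k)_m is nonzero. *)
Definition in_support (k : fieldType) Fil (chi : nat -> B -> k) : Prop :=
  exists (c : nat) (x : nat -> M), (forall j, Fil j (x j)) /\
    forall (a : nat) (s : nat -> B), (forall m, Bfil m (s m)) ->
      \sum_(m < a) chi m (s m) != 0 -> ~ gr_act_eq0 Fil a s c x.

End Filtration.

Section CharVar.
Variables (k : fieldType) (d : nat).

Notation S := {mpoly k[d]}.
Notation S' := {mpoly {mpoly k[d]}[d]}.

Definition Sp_frac (q : S') : {mpoly {fraction S}[d]} :=
  map_mpoly (@FracField.tofrac S) q.

Definition Sp_eval (z : 'rV[k]_d * 'rV[k]_d) (q : S') : k :=
  (map_mpoly (meval (z.1 0)) q).@[z.2 0].

Variable F : lmodType (weyl_algebra k d).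

Definition good_A_filtration (Fil : nat -> set F) : Prop :=
  good_filtration (@weyl_order k d finset.set0) *:%R setT Fil.

(* Ann_{S'}(gr F): the class of q in gr(A) acts through lifts of its components. *)
Definition gr_ann (Fil : nat -> set F) : set S' :=
  [set q | forall P : nat -> weyl_algebra k d,
     (forall m, has_symbol m (P m) (pihomog mdeg m (Sp_frac q))) ->
     forall (c : nat) (x : nat -> F), (forall j, Fil j (x j)) ->
       gr_act_eq0 *:%R Fil (msize q) P c x].

(* The variety of sqrt(Ann(gr F)) is the same for all good filtrations of F. *)
Definition Ch : set ('rV[k]_d * 'rV[k]_d) :=
  [set z | exists2 Fil, good_A_filtration Fil &
     forall q, (exists N : nat, gr_ann Fil (q ^+ N)) -> Sp_eval z q = 0].

Variables (n : nat) (V : 'M[int]_(d, n)) (Delta : {set {set 'I_d}}).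

(* T = Hom(Cl(X), k^* ) *)
Definition torus : set (class_group V -> k) :=
  [set t | (forall c, t c != 0) /\ forall c c', t (c + c') = t c * t c'].

Definition torus_act (t : class_group V -> k) (z : 'rV[k]_d * 'rV[k]_d) :
    'rV[k]_d * 'rV[k]_d :=
  (\row_i (t (class_var V i) * z.1 0 i), \row_i ((t (class_var V i))^-1 * z.2 0 i)).

Definition torus_invariant (C : set ('rV[k]_d * 'rV[k]_d)) : Prop :=
  forall t z, torus t -> C z -> C (torus_act t z).

(* Var(b) x A^d *)
Definition irrelevant_locus : set ('rV[k]_d * 'rV[k]_d) :=
  [set z : 'rV[k]_d * 'rV[k]_d | forall sigma, sigma \in Delta ->
     (xprod k (~: sigma)%SET).@[z.1 0] = 0].

End CharVar.

(* The space obtained from the charts P i by gluing along the relation step. *)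
Section Glue.
Variables (I : Type) (P : I -> Type) (step : forall i j, P i -> P j -> Prop).

Definition glue_sum : Type := {classic {i : I & P i}}.

Definition glue_step (a b : glue_sum) : Prop := step (projT2 a) (projT2 b).

Definition glue_rel (a b : glue_sum) : bool :=
  `[< clos_refl_sym_trans _ glue_step a b >].

Fact glue_rel_refl : reflexive glue_rel.
Proof. by move=> a; apply/asboolP; exact: rst_refl. Qed.

Fact glue_rel_sym : ssrbool.symmetric glue_rel.
Proof. by move=> a b; apply/asboolP/asboolP => h; exact: rst_sym. Qed.

Fact glue_rel_trans : transitive glue_rel.
Proof.
move=> b a c /asboolP hab /asboolP hbc; apply/asboolP; exact: rst_trans hab hbc.
Qed.

Canonical glue_equivRel :=
  EquivRel glue_rel glue_rel_refl glue_rel_sym glue_rel_trans.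

Definition glue : Type := {eq_quot glue_rel}.

Definition glue_pt (i : I) (p : P i) : glue :=
  \pi_({eq_quot glue_rel}) (existT P i p).

End Glue.

(* Grothendieck's differential operators of order <= m on a commutative
   k-algebra R with structure map c. *)
Section DiffOp.
Variables (k : fieldType) (R : comNzRingType) (c : k -> R).

Fixpoint diff_order (m : nat) (D : R -> R) : Prop :=
  if m is m'.+1 then forall r, diff_order m' (fun s => D (r * s) - r * D s)
  else forall r s, D (r * s) - r * D s = 0.

Definition diff_op (m : nat) : set (R -> R) :=
  [set D | [/\ forall s t, D (s + t) = D s + D t,
               forall a s, D (c a * s) = c a * D s & diff_order m D]].

End DiffOp.

Section Charts.
Variables (k : fieldType) (n d : nat) (V : 'M[int]_(d, n)).
Variable Delta : {set {set 'I_d}}.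

Notation K := {fraction {mpoly k[d]}}.

Definition fan_cone : Type := {sigma : {set 'I_d} | sigma \in Delta}.

(* (S'_{x^sigmahat})_0 *)
Definition Sp0 (sigma : {set 'I_d}) : set {mpoly K[d]} :=
  Spgr (~: sigma)%SET (0 : class_group V).

(* k-points of Spec (S'_{x^sigmahat})_0; only the values on this ring matter. *)
Record quot_chart (sigma : {set 'I_d}) : Type := QuotChart {
  quot_val :> {mpoly K[d]} -> k;
  quot_valD : forall q q', Sp0 sigma q -> Sp0 sigma q' ->
    quot_val (q + q') = quot_val q + quot_val q';
  quot_valM : forall q q', Sp0 sigma q -> Sp0 sigma q' ->
    quot_val (q * q') = quot_val q * quot_val q';
  quot_valC : forall a : k,
    quot_val ((@FracField.tofrac {mpoly k[d]} a%:MP)%:MP) = a }.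

Definition quot_step (i j : fan_cone) (y : quot_chart (val i))
    (y' : quot_chart (val j)) : Prop :=
  val j \subset val i /\ forall q, Sp0 (val i) q -> y' q = y q.

(* The k-points of X' *)
Definition quot_space : Type := glue quot_step.

(* The quotient map pi, as a relation: over {x^sigmahat != 0}, the image of z is
   the evaluation at z. *)
Definition quot_map (z : 'rV[k]_d * 'rV[k]_d) (p : quot_space) : Prop :=
  exists (i : fan_cone) (y : quot_chart (val i)),
    [/\ (xprod k (~: val i)%SET).@[z.1 0] != 0,
        forall (q : {mpoly {mpoly k[d]}[d]}) (m : nat) (r : {mpoly K[d]}),
          r = (@FracField.tofrac {mpoly k[d]} (xprod k (~: val i)%SET ^+ m))^-1
              *: Sp_frac q ->
          Sp0 (val i) r ->
          y r = Sp_eval z q / (xprod k (~: val i)%SET).@[z.1 0] ^+ m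
      & p = glue_pt quot_step y].

(* The order filtration of H^0(U_sigma, D). *)
Definition chart_diff (sigma : {set 'I_d}) :
    nat -> set (chart_ring k V sigma -> chart_ring k V sigma) :=
  diff_op (chart_const V sigma).

(* D is the image of P under (A_{x^sigmahat})_0 -> H^0(U_sigma, D). *)
Definition chart_phi (sigma : {set 'I_d}) (P : weyl k (~: sigma)%SET)
    (D : chart_ring k V sigma -> chart_ring k V sigma) : Prop :=
  weyl_gr (0 : class_group V) P /\ forall r, P (val r) = val (D r).

(* k-points of Spec gr H^0(U_sigma, D): chi_m is the restriction to gr_m of a
   homomorphism of k-algebras gr H^0(U_sigma, D) -> k. *)
Record cot_chart (sigma : {set 'I_d}) : Type := CotChart {
  cot_val :> nat -> (chart_ring k V sigma -> chart_ring k V sigma) -> k;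
  cot_valD : forall m D D', chart_diff m D -> chart_diff m D' ->
    cot_val m (fun r => D r + D' r) = cot_val m D + cot_val m D';
  cot_val0 : forall m D, chart_diff m D -> cot_val m.+1 D = 0;
  cot_valM : forall m m' D D', chart_diff m D -> chart_diff m' D' ->
    cot_val (m + m')%N (fun r => D (D' r)) = cot_val m D * cot_val m' D';
  cot_valC : forall a : k, cot_val 0 (fun r => chart_const V sigma a * r) = a }.

(* D' extends D along the restriction of functions from U_sigma to U_tau. *)
Definition diff_extends (sigma tau : {set 'I_d})
    (D : chart_ring k V sigma -> chart_ring k V sigma)
    (D' : chart_ring k V tau -> chart_ring k V tau) : Prop :=
  forall r r', val r = val r' :> K -> val (D r) = val (D' r') :> K.

Definition cot_step (i j : fan_cone) (chi : cot_chart (val i))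
    (chi' : cot_chart (val j)) : Prop :=
  val j \subset val i /\
  forall m D D', chart_diff m D -> chart_diff m D' -> diff_extends D D' ->
    chi' m D' = chi m D.

(* The k-points of T^*X *)
Definition cotangent : Type := glue cot_step.

(* The canonical closed embedding T^*X -> X' with image pi(Z cap V), as a
   relation: over U_sigma it is given by (S'_{x^sigmahat})_0 -> gr H^0(U_sigma, D),
   mapping the symbol of P in (A_{x^sigmahat})_0 to the symbol of phi_sigma(P). *)
Definition cot_embed (c : cotangent) (p : quot_space) : Prop :=
  exists (i : fan_cone) (chi : cot_chart (val i)) (y : quot_chart (val i)),
    [/\ c = glue_pt cot_step chi, p = glue_pt quot_step y &
        forall m P D s, chart_phi P D -> has_symbol m P s -> y s = chi m D].

Variables (F : lmodType (weyl_algebra k d)) (Fgr : class_group V -> set F).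

(* The action of H^0(U_sigma, D) on (F_{x^sigmahat})_0 through the inverse of
   phi_sigma; xget picks a preimage of D. *)
Definition chart_act (sigma : {set 'I_d})
    (D : chart_ring k V sigma -> chart_ring k V sigma)
    (u : loc F (~: sigma)%SET) : loc F (~: sigma)%SET :=
  xget 0 [set P | chart_phi P D] *: u.

(* A good filtration of F~: good filtrations of the modules of sections over the
   U_sigma which define O_X-submodules of F~. *)
Definition good_D_filtration
    (G : forall sigma : {set 'I_d}, nat -> set (loc F (~: sigma)%SET)) : Prop :=
  (forall sigma, sigma \in Delta ->
     good_filtration (@chart_diff sigma) (@chart_act sigma)
       (chart_mod Fgr sigma) (G sigma)) /\
  forall sigma tau, sigma \in Delta -> tau \in Delta -> tau \subset sigma ->
    forall l v, G tau l v <->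
      exists (r : nat) (a : 'I_r -> chart_ring k V tau)
             (u : 'I_r -> loc F (~: sigma)%SET),
        (forall i, G sigma l (u i)) /\
        v = \sum_(i < r) chart_act (fun s => a i * s) (loc_res _ (u i)).

Definition Ch_sheaf : set cotangent :=
  [set c | exists2 G, good_D_filtration G &
     exists (i : fan_cone) (chi : cot_chart (val i)),
       c = glue_pt cot_step chi /\
       in_support (@chart_diff (val i)) (@chart_act (val i)) (G (val i)) chi].

End Charts.

(* Main.v *)
(* For a good filtration of a module M over a filtered ring with commutative
   associated graded ring, a point z lies in Ch(M) iff every P of order m which
   drops the filtration, that is, maps each Fil_l into Fil_(m+l-1), has a symbol of
   degree m vanishing at z. This condition does not depend on the good
   filtration: if two of them are at distance c and P drops the first one, then a
   power of P of exponent larger than 2c drops the second one, and its symbol is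
   a power of the symbol of P.

   So take the filtration of F generated by homogeneous generators. It is
   Cl(X)-graded, whence the T-invariance, and it induces good filtrations on the
   modules (F_(x^sigmahat))_0. On U_sigma, monomials in the x_j with j outside
   sigma are invertible and have all degrees, so an operator dropping one of the
   two filtrations gives one dropping the other, up to powers of x^sigmahat,
   which are nonzero at z; hence the two supports agree.

   For the identification with T^*X, sigma being smooth, k(x) carries monomials
   y_l of degree 0 (toric coordinates of U_sigma, up to inverting some of them)
   and derivations d_l of k[x]_(x^sigmahat) of degree 0 dual to them. A
   differential operator on U_sigma is determined by its values on the y^b and
   lifts to an operator in the d_l; modulo the theta_u, every x_i d_i is a
   combination of the y_l d_l. Finally, every point of Spec (S'_(x^sigmahat))_0
   comes from some z, which is found by extracting roots of the values of the
   y_l. *)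

Require Import Defs.
From HB Require Import structures.
From mathcomp Require Import all_boot all_order all_algebra.
From mathcomp Require Import fraction ring_quotient.
From Stdlib Require Import Relation_Operators.
From mathcomp Require Import ring zify.
From mathcomp Require Import ssrcomplements mpoly boolp classical_sets reals.

Set Implicit Arguments.
Unset Strict Implicit.
Unset Printing Implicit Defensive.

Import Order.TTheory GRing.Theory Num.Theory.

Local Open Scope classical_set_scope.
Local Open Scope ring_scope.

(** * Normally ordered differential operators *)

(** Sections over U_sigma carry an action of H^0(U_sigma, D) defined by choosing preimages under
    phi_sigma. Everything is therefore transported to the degree-0 part of A_(x^sigmahat). This
    needs two facts: phi_sigma is onto in each order, and its kernel acts as zero on
    (F_(x^sigmahat))_0. The second is where the theta condition enters: modulo operators acting as
    zero, every operator has a normal form in the d_l, and its action on functions determines that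
    form.

    The exponents of the y_l form an integral d x n matrix W of rank n. Since Cl(X) may have
    torsion, W has in general only a rational left inverse N^-1 M. Hence the coefficients of the d_l
    have denominator N, and N-th roots are extracted to build z.

    Points z of A^d x A^d and points chi of T^*X both give characters of the graded ring of a
    filtered ring, so one theory of supports serves F and the charts. Its criterion rests on the
    commutativity of gr: if each generator of gr(M) is killed by an element not vanishing at the
    point, the product of these elements kills gr(M) and does not vanish there. *)

Lemma mnm_ind n (P : 'X_{1..n} -> Prop) :
  P 0%MM -> (forall i b, P b -> P (U_(i) + b)%MM) -> forall b, P b.
Proof.
move=> P0 PS b; elim: {b}(mdeg b) {-2}b (erefl (mdeg b)) => [|m IH] b.
  by move/eqP; rewrite mdeg_eq0 => /eqP->.
move=> hb; have [i bi] : exists i, b i != 0%N.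
  have b0 : b != 0%MM by rewrite -mdeg_eq0 hb.
  apply/existsP; apply: contraNT b0 => /existsPn h; apply/eqP/mnmP => i.
  by rewrite mnm0E; apply/eqP; rewrite -[_ == _]negbK.
have Ub : (U_(i) <= b)%MM by rewrite lep1mP.
rewrite -(submK Ub) addmC; apply: PS; apply: IH.
by move: hb; rewrite -{1}(submK Ub) mdegD mdeg1 addn1 => -[].
Qed.

Section IterMonomial.
Variables (n : nat) (T : Type) (dl : 'I_n -> T -> T).
Hypothesis dlC : forall i j x, dl i (dl j x) = dl j (dl i x).

(** The fold is that of [der_mnm], so for [dl = der] this and [nop] below are convertible to
    [der_mnm] and [normal_op]. The type [T] is left free because symbols ([nabla]) and operators
    ([dtmon]) are iterated as well. *)
Definition mnm_iter (b : 'X_{1..n}) (x : T) : T :=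
  foldr (fun i => iter (b i) (dl i)) x (enum 'I_n).

Let f (s : seq 'I_n) (b : 'X_{1..n}) (x : T) : T :=
  foldr (fun i => iter (b i) (dl i)) x s.

Let iterC i j a a' x :
  iter a (dl i) (iter a' (dl j) x) = iter a' (dl j) (iter a (dl i) x).
Proof.
have h y : iter a (dl i) (dl j y) = dl j (iter a (dl i) y).
  by elim: a => //= a ->; rewrite dlC.
by elim: a' => //= a' IH; rewrite h IH.
Qed.

Lemma mnm_iter0 x : mnm_iter 0 x = x.
Proof. by rewrite /mnm_iter; elim: (enum _) => //= i s ->; rewrite mnm0E. Qed.

Lemma mnm_iterD b b' x : mnm_iter (b + b') x = mnm_iter b (mnm_iter b' x).
Proof.
have h s i a c y : iter a (dl i) (f s c y) = f s c (iter a (dl i) y).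
  by elim: s => //= j s IH; rewrite iterC IH.
rewrite /mnm_iter; elim: (enum _) => //= i s ->.
by rewrite mnmDE iterD -!/(f _ _ _) h.
Qed.

Lemma mnm_iterU i x : mnm_iter U_(i) x = dl i x.
Proof.
have fE s : uniq s -> f s U_(i) x = if i \in s then dl i x else x.
  elim: s => //= j s IH /andP[js us]; rewrite IH // inE mnm1E.
  have [->|ij] := eqVneq i j; first by rewrite (negPf js).
  by [].
by rewrite /mnm_iter -/(f _ _ _) fE ?enum_uniq // mem_enum.
Qed.

Lemma mnm_iterUD i b x : mnm_iter (U_(i) + b) x = dl i (mnm_iter b x).
Proof. by rewrite mnm_iterD mnm_iterU. Qed.

End IterMonomial.

Lemma sub_mm n (b : 'X_{1..n}) : (b - b = 0)%MM.
Proof. by apply/mnmP => i; rewrite mnmBE subnn mnm0E. Qed.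

Section LinearExtension.
Variables (n : nat) (L : fieldType) (V : lmodType L) (G : 'X_{1..n} -> V).

(** The linear extension of [G] from monomials to polynomials; it gives the linearity of [nop] in
    the symbol, which sums over a varying support hide. *)
Definition msum (q : {mpoly L[n]}) : V := \sum_(b <- msupp q) q@_b *: G b.

Lemma msumE q w : (msize q <= w)%N ->
  msum q = \sum_(b : 'X_{1..n < w}) q@_b *: G b.
Proof.
move=> le; rewrite /msum (big_mksub 'X_{1..n < w}) ?msupp_uniq //=; first last.
  by move=> x /msize_mdeg_lt /leq_trans; apply.
by rewrite big_rmcond //= => j /memN_msupp_eq0 ->; rewrite scale0r.
Qed.

Lemma msum_is_linear : linear msum.
Proof.
move=> a p q; pose w := maxn (msize (a *: p + q)) (maxn (msize p) (msize q)).
rewrite !(@msumE _ w) ?leq_max ?leqnn ?orbT // scaler_sumr -big_split /=.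
by apply: eq_bigr => b _; rewrite mcoeffD mcoeffZ scalerDl scalerA.
Qed.

HB.instance Definition _ := GRing.isLinear.Build L {mpoly L[n]} V *:%R msum
  msum_is_linear.

Lemma msumX b : msum 'X_[b] = G b.
Proof. by rewrite /msum msuppX big_seq1 mcoeffX eqxx scale1r. Qed.

End LinearExtension.

Section NormalOperators.
Variables (n : nat) (L : fieldType) (dl : 'I_n -> L -> L).
Hypothesis dlD : forall i x y, dl i (x + y) = dl i x + dl i y.
Hypothesis dlM : forall i x y, dl i (x * y) = dl i x * y + x * dl i y.
Hypothesis dlC : forall i j x, dl i (dl j x) = dl j (dl i x).

Definition nop (q : {mpoly L[n]}) (y : L) : L :=
  \sum_(b <- msupp q) q@_b * mnm_iter dl b y.

Lemma nop_msum q y : nop q y = msum (V := L^o) (fun b => mnm_iter dl b y) q.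
Proof. by []. Qed.

Lemma nopD p q y : nop (p + q) y = nop p y + nop q y.
Proof. by rewrite !nop_msum raddfD. Qed.
Lemma nop0 y : nop 0 y = 0.
Proof. by rewrite nop_msum raddf0. Qed.
Lemma nopN q y : nop (- q) y = - nop q y.
Proof. by rewrite !nop_msum raddfN. Qed.
Lemma nopZ a q y : nop (a *: q) y = a * nop q y.
Proof. by rewrite !nop_msum linearZ. Qed.
Lemma nopX b y : nop 'X_[b] y = mnm_iter dl b y.
Proof. by rewrite nop_msum msumX. Qed.
Lemma nopC a y : nop a%:MP y = a * y.
Proof. by rewrite -[a%:MP]mulr1 mul_mpolyC nopZ -mpolyX0 nopX mnm_iter0. Qed.

Lemma dl0 i : dl i 0 = 0.
Proof. by have := dlD i 0 0; rewrite addr0 => /eqP; rewrite -subr_eq0 opprD addNKr oppr_eq0 => /eqP. Qed.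
Lemma dl_sum i (I : Type) (s : seq I) (P : pred I) (F : I -> L) :
  dl i (\sum_(j <- s | P j) F j) = \sum_(j <- s | P j) dl i (F j).
Proof. by apply: big_morph; [exact: dlD|exact: dl0]. Qed.
Lemma mnm_iterDr b x y :
  mnm_iter dl b (x + y) = mnm_iter dl b x + mnm_iter dl b y.
Proof. by elim/mnm_ind: b => [|i b IH]; rewrite ?mnm_iter0 // !mnm_iterUD // IH dlD. Qed.

Lemma nop_additive q x y : nop q (x + y) = nop q x + nop q y.
Proof.
by rewrite /nop -big_split; apply: eq_bigr => b _; rewrite mnm_iterDr mulrDr.
Qed.

(* Commuting dl i past a normally ordered operator: xi_i q + (dl i)(q). *)
Definition cmap (i : 'I_n) (q : {mpoly L[n]}) : {mpoly L[n]} :=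
  \sum_(b <- msupp q) dl i q@_b *: 'X_[b].

Lemma mcoeff_cmap i q b : (cmap i q)@_b = dl i q@_b.
Proof.
rewrite /cmap raddf_sum /=.
under eq_bigr do rewrite mcoeffZ mcoeffX.
have [hb|hb] := boolP (b \in msupp q).
  rewrite (big_rem b) //= eqxx mulr1 big_seq big1 ?addr0 // => c.
  rewrite mem_rem_uniq ?msupp_uniq // inE => /andP[/negPf-> _]; by rewrite mulr0.
rewrite big_seq big1 => [|c hc]; first by rewrite (memN_msupp_eq0 hb) dl0.
by have [e|] := eqVneq c b; [rewrite -e hc in hb|rewrite mulr0].
Qed.

Definition nabla (i : 'I_n) (q : {mpoly L[n]}) := 'X_i * q + cmap i q.

Lemma cmapD i p q : cmap i (p + q) = cmap i p + cmap i q.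
Proof. by apply/mpolyP => b; rewrite mcoeffD !mcoeff_cmap mcoeffD dlD. Qed.

Lemma cmapC i j q : cmap i (cmap j q) = cmap j (cmap i q).
Proof. by apply/mpolyP => b; rewrite !mcoeff_cmap dlC. Qed.

Lemma mcoeffUM (i : 'I_n) (q : {mpoly L[n]}) b :
  ('X_i * q)@_b = if (U_(i) <= b)%MM then q@_(b - U_(i)) else 0.
Proof.
case: ifP => [h|h]; first by rewrite -{1}(submK h) mulrC addmC mcoeffMX.
apply: memN_msupp_eq0; apply/negP; rewrite mulrC (perm_mem (msuppMX _ _)).
by case/mapP => c _ e; rewrite e lem_addr in h.
Qed.

Lemma cmapUM i j q : cmap i ('X_j * q) = 'X_j * cmap i q.
Proof.
apply/mpolyP => b; rewrite mcoeff_cmap !mcoeffUM; case: ifP => _ //.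
  by rewrite mcoeff_cmap.
exact: dl0.
Qed.

Lemma nablaC i j q : nabla i (nabla j q) = nabla j (nabla i q).
Proof.
by rewrite /nabla !cmapD !cmapUM !mulrDr cmapC (mulrCA 'X_i) !addrA (addrAC ('X_j * _)).
Qed.

Lemma dl_nop i q y : dl i (nop q y) = nop (nabla i q) y.
Proof.
have -> : nop (nabla i q) y = nop (cmap i q) y + nop ('X_i * q) y.
  by rewrite -nopD addrC.
rewrite {1}/nop dl_sum.
under eq_bigr do rewrite dlM.
rewrite big_split /=; congr (_ + _).
  rewrite /cmap nop_msum raddf_sum; apply: eq_bigr => b _ /=.
  by rewrite linearZ /= msumX.
have -> : 'X_i * q = \sum_(b <- msupp q) q@_b *: 'X_[U_(i) + b].
  rewrite {1}[q]mpolyE mulr_sumr; apply: eq_bigr => b _.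
  by rewrite -scalerAr -mpolyXD.
rewrite nop_msum raddf_sum; apply: eq_bigr => b _ /=.
by rewrite linearZ /= msumX mnm_iterUD.
Qed.

Lemma mnm_iter_nop b q y : mnm_iter dl b (nop q y) = nop (mnm_iter nabla b q) y.
Proof.
elim/mnm_ind: b => [|i b IH]; rewrite ?mnm_iter0 // !mnm_iterUD ?IH ?dl_nop //.
exact: nablaC.
Qed.

(** The full symbol of a composite of normally ordered operators: each xi^b of [p] acts on [q]
    through [nabla]. *)
Definition star (p q : {mpoly L[n]}) : {mpoly L[n]} :=
  \sum_(b <- msupp p) p@_b *: mnm_iter nabla b q.

Lemma nop_star p q y : nop p (nop q y) = nop (star p q) y.
Proof.
rewrite {1}/nop; under eq_bigr do rewrite mnm_iter_nop.
by rewrite /star [in RHS]nop_msum raddf_sum; apply: eq_bigr => b _; rewrite /= linearZ.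
Qed.

Lemma msize_sum_le (I : eqType) (s : seq I) (F : I -> {mpoly L[n]}) w :
  (forall i, i \in s -> msize (F i) <= w)%N -> (msize (\sum_(i <- s) F i)%R <= w)%N.
Proof.
move=> h; apply: leq_trans (mmeasure_sum _ _ _ _) _.
by rewrite big_seq; elim/big_ind: _ => // x y hx hy; rewrite geq_max hx.
Qed.

Lemma msize_cmap i q : (msize (cmap i q) <= msize q)%N.
Proof.
apply: msize_sum_le => b hb; apply: leq_trans (msizeZ_le _ _) _.
by rewrite msizeX; exact: msize_mdeg_lt.
Qed.

Lemma msizeUM i (q : {mpoly L[n]}) w : (msize q <= w)%N -> (msize ('X_i * q)%R <= w.+1)%N.
Proof.
move=> h; have [->|q0] := eqVneq q 0; first by rewrite mulr0 mmeasure0.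
have X0 : 'X_i != 0 :> {mpoly L[n]} by rewrite -msize_poly_eq0 msizeX.
by rewrite msizeM // msizeX mdeg1.
Qed.

Lemma msizeD_lt (p q : {mpoly L[n]}) w : (msize p <= w)%N -> (msize q <= w)%N ->
  (msize (p + q)%R <= w)%N.
Proof. by move=> hp hq; apply: leq_trans (mmeasureD_le _ _ _) _; rewrite geq_max hp. Qed.

Lemma msize_nabla i (q : {mpoly L[n]}) w : (msize q <= w)%N -> (msize (nabla i q) <= w.+1)%N.
Proof.
move=> h; apply: msizeD_lt; first exact: msizeUM.
by apply: leq_trans (msize_cmap _ _) _; exact: leqW.
Qed.

(** [nabla i] is multiplication by xi_i plus [cmap i], which does not raise the degree; so every
    correction to the product loses at least one order. *)
Lemma msize_nablaX b (q : {mpoly L[n]}) w : (msize q <= w.+1)%N ->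
  (msize (mnm_iter nabla b q) <= (mdeg b + w).+1)%N /\
  (msize (mnm_iter nabla b q - 'X_[b] * q)%R <= mdeg b + w)%N.
Proof.
move=> h; elim/mnm_ind: b => [|i b [IH1 IH2]].
  by rewrite mnm_iter0 mdeg0 add0n mpolyX0 mul1r subrr mmeasure0.
rewrite mnm_iterUD; last exact: nablaC.
rewrite mdegD mdeg1 add1n addSn; split; first exact: msize_nabla.
rewrite mpolyXD -mulrA {1}/nabla addrAC -mulrBr; apply: msizeD_lt.
  exact: msizeUM.
exact: leq_trans (msize_cmap _ _) IH1.
Qed.

Lemma star_sub p q : star p q - p * q
  = \sum_(b <- msupp p) p@_b *: (mnm_iter nabla b q - 'X_[b] * q).
Proof.
rewrite [p in p * q]mpolyE mulr_suml -sumrB; apply: eq_bigr => b _.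
by rewrite -scalerAl scalerBr.
Qed.

(** The second bound, one below the size of the product, makes symbols multiplicative and the graded
    ring commutative. *)
Lemma msize_star (p q : {mpoly L[n]}) v w : (msize p <= v.+1)%N -> (msize q <= w.+1)%N ->
  (msize (star p q) <= (v + w).+1)%N /\ (msize (star p q - p * q)%R <= v + w)%N.
Proof.
move=> hp hq; split.
  apply: msize_sum_le => b hb; apply: leq_trans (msizeZ_le _ _) _.
  have [h _] := msize_nablaX b hq; apply: leq_trans h _.
  by rewrite ltnS leq_add2r -ltnS; apply: leq_trans (msize_mdeg_lt hb) hp.
rewrite star_sub; apply: msize_sum_le => b hb; apply: leq_trans (msizeZ_le _ _) _.
have [_ h] := msize_nablaX b hq; apply: leq_trans h _.
by rewrite leq_add2r -ltnS; apply: leq_trans (msize_mdeg_lt hb) hp.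
Qed.

(* C c is the part of degree c of L, and xi_i lowers the degree by e i. *)
Section Closure.
Variables (H : zmodType) (C : H -> set L) (e : 'I_n -> H).
Hypothesis C0 : forall c, C c 0.
Hypothesis CD : forall c x y, C c x -> C c y -> C c (x + y).
Hypothesis CM : forall c c' x y, C c x -> C c' y -> C (c + c') (x * y).
Hypothesis Cdl : forall c i x, C c x -> C (c - e i) (dl i x).

Definition mdegw (b : 'X_{1..n}) : H := \sum_i e i *+ b i.
Definition coeffs_in (c : H) (q : {mpoly L[n]}) : Prop :=
  forall b, C (c + mdegw b) q@_b.

Lemma mdegw0 : mdegw 0 = 0.
Proof. by rewrite /mdegw big1 // => i _; rewrite mnm0E. Qed.
Lemma mdegwD b b' : mdegw (b + b') = mdegw b + mdegw b'.
Proof. by rewrite /mdegw -big_split; apply: eq_bigr => i _; rewrite mnmDE mulrnDr. Qed.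
Lemma mdegwU i : mdegw U_(i) = e i.
Proof.
rewrite /mdegw (bigD1 i) //= mnm1E eqxx big1 ?addr0 // => j ji.
by rewrite mnm1E eq_sym (negPf ji).
Qed.

Lemma coeffs_inD c p q : coeffs_in c p -> coeffs_in c q -> coeffs_in c (p + q).
Proof. by move=> hp hq b; rewrite mcoeffD; exact: CD. Qed.

Lemma coeffs_in0 c : coeffs_in c 0.
Proof. by move=> b; rewrite mcoeff0. Qed.

Lemma coeffs_inZ c c' a q : C c a -> coeffs_in c' q -> coeffs_in (c + c') (a *: q).
Proof. by move=> ha hq b; rewrite mcoeffZ -addrA; exact: CM. Qed.

Lemma coeffs_in_nabla c i q : coeffs_in c q -> coeffs_in (c - e i) (nabla i q).
Proof.
move=> h; apply: coeffs_inD => b.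
  rewrite mcoeffUM; case: ifP => // hb.
  by rewrite -{1}(submK hb) mdegwD mdegwU (addrC (mdegw _)) addrA subrK.
by rewrite mcoeff_cmap addrAC; apply: Cdl.
Qed.

Lemma coeffs_in_star c c' p q : coeffs_in c p -> coeffs_in c' q ->
  coeffs_in (c + c') (star p q).
Proof.
move=> hp hq; rewrite /star; elim/big_rec: _ => [|b r _ hr]; first exact: coeffs_in0.
apply: coeffs_inD hr.
have -> : c + c' = (c + mdegw b) + (c' - mdegw b) by rewrite addrACA subrr addr0.
apply: coeffs_inZ => //; elim/mnm_ind: b => [|i b IH].
  by rewrite mnm_iter0 mdegw0 subr0.
rewrite mnm_iterUD; last exact: nablaC.
by rewrite mdegwD mdegwU opprD (addrC (- e i)) addrA; exact: coeffs_in_nabla.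
Qed.

End Closure.

(* Coordinates y_j with dl i y_j = delta_ij over a field k of constants. *)
Section Coordinates.
Variables (k : fieldType) (io : {rmorphism k -> L}) (y : 'I_n -> L).
Hypothesis dl_const : forall i a, dl i (io a) = 0.
Hypothesis dl_coord : forall i j, dl i (y j) = (i == j)%:R.
Hypothesis pchar0 : [pchar k] =i pred0.

Definition cev (g : {mpoly k[n]}) : L := mmap io y g.

Lemma cevD p q : cev (p + q) = cev p + cev q. Proof. exact: mmapD. Qed.
Lemma cevM p q : cev (p * q) = cev p * cev q.
Proof. by rewrite /cev rmorphM. Qed.
Lemma cevZ a q : cev (a *: q) = io a * cev q.
Proof. by rewrite /cev mmapZ. Qed.
Lemma cevC a : cev a%:MP = io a.
Proof. by rewrite /cev mmapC. Qed.
Lemma cev0 : cev 0 = 0.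
Proof. by rewrite /cev raddf0. Qed.
Lemma cev1 : cev 1 = 1.
Proof. by rewrite /cev rmorph1. Qed.
Lemma cevU i : cev 'X_i = y i.
Proof. by rewrite /cev mmapX mmap1U. Qed.

Lemma dl_cev i g : dl i (cev g) = cev g^`M(i).
Proof.
rewrite [g]mpolyE raddf_sum /=; rewrite /cev !raddf_sum dl_sum /=.
apply: eq_bigr => b _; rewrite -!/(cev _) linearZ /= !cevZ dlM dl_const mul0r add0r.
congr (_ * _); elim/mnm_ind: b => [|j b IH].
  by rewrite mpolyX0 -mpolyC1 cevC mderivC cev0 dl_const.
rewrite mpolyXD mderivM cevD !cevM dlM IH cevU; congr (_ * _ + _).
rewrite dl_coord mderivX mnm1E eq_sym; case: eqP => [->|_].
  by rewrite sub_mm mpolyX0 scale1r cev1.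
by rewrite scale0r cev0.
Qed.

Lemma mnm_iter_cev b g : mnm_iter dl b (cev g) = cev g^`M[b].
Proof.
elim/mnm_ind: b => [|i b IH]; first by rewrite mnm_iter0 mderivm0m.
by rewrite mnm_iterUD // IH dl_cev -mderivmU1m -mderivmDm addmC.
Qed.

(* The monomial y^b of least degree in the support detects the coefficient. *)
Lemma nop_eq0 q w : (forall g, (msize g <= w)%N -> nop q (cev g) = 0) ->
  (msize q <= w)%N -> q = 0.
Proof.
move=> h hw; apply/mpolyP => b; rewrite mcoeff0.
have [m] := ubnP (mdeg b); elim: m b => // m IH b; rewrite ltnS => hm.
apply/eqP; rewrite mcoeff_eq0; apply/negP => hb.
have := h 'X_[b]; rewrite msizeX => /(_ (leq_trans (msize_mdeg_lt hb) hw)).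
rewrite /nop (big_rem b) //= [X in _ + X]big_seq [X in _ + X]big1 ?addr0; last first.
  move=> c; rewrite mem_rem_uniq ?msupp_uniq // inE => /andP[cb hc].
  (* Coefficients in smaller degree vanish by induction. For any other c, c <= b fails, so the c-th
     derivative kills y^b. *)
  have [lt|ge] := ltnP (mdeg c) (mdeg b).
    by rewrite IH ?mul0r //; exact: leq_trans lt hm.
  rewrite mnm_iter_cev mderivmX cevZ; suff [i hi] : exists i, (b i < c i)%N.
    by rewrite (bigD1 i) //= ffact_small // mul0n rmorph0 mul0r mulr0.
  apply/existsP; apply: contraNT cb => /existsPn hle.
  have le : (c <= b)%MM by apply/mnm_lepP => i; rewrite leqNgt.
  have e : mdeg (b - c) = 0%N.
    by move: ge; rewrite -{1}(submK le) mdegD; lia.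
  by rewrite -(submK le); move/eqP: e; rewrite mdeg_eq0 => /eqP->; rewrite add0m.
rewrite mnm_iter_cev mderivmX cevZ sub_mm mpolyX0 cev1 mulr1 => /eqP; rewrite mulf_eq0 => /orP[|].
  by rewrite mcoeff_eq0 hb.
rewrite fmorph_eq0 => /eqP e0.
have fact0 : (\prod_(i < n) b i ^_ b i)%N != 0%N.
  by rewrite -lt0n prodn_gt0 // => i; rewrite ffactnn fact_gt0.
by move/pcharf0P: pchar0 => /(_ (\prod_(i < n) b i ^_ b i)%N); rewrite e0 eqxx (negPf fact0).
Qed.

End Coordinates.
End NormalOperators.

Lemma mcoeff_pihomog n (R : nzRingType) m (p : {mpoly R[n]}) b :
  (pihomog mdeg m p)@_b = if mdeg b == m then p@_b else 0.
Proof.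
rewrite pihomogE raddf_sum /=; under eq_bigr do rewrite mcoeffZ mcoeffX.
have [hb|hb] := boolP (b \in msupp p); last first.
  rewrite (memN_msupp_eq0 hb) if_same big_seq_cond big1 // => c /andP[hc _].
  by have [e|] := eqVneq c b; [rewrite -e hc in hb|rewrite mulr0].
rewrite big_mkcond (big_rem b) //= eqxx mulr1 big_seq big1 ?addr0 // => c.
rewrite mem_rem_uniq ?msupp_uniq // inE => /andP[/negPf-> _].
by rewrite mulr0 if_same.
Qed.

(** * Differential operators on localizations of k[x] *)

Section HomogeneousParts.
Variables (n : nat) (L : fieldType).
Implicit Types p q : {mpoly L[n]}.

Lemma msize_leP p w : (forall b, (w <= mdeg b)%N -> p@_b = 0) -> (msize p <= w)%N.
Proof.
move=> h; rewrite msizeE big_seq; elim/big_ind: _ => // [x y hx hy|b hb].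
  by rewrite geq_max hx.
by rewrite ltnNge; apply: contraL hb => /h /eqP; rewrite mcoeff_eq0.
Qed.

Lemma mcoeff_msize p w b : (msize p <= w)%N -> (w <= mdeg b)%N -> p@_b = 0.
Proof. by move=> h1 h2; apply/memN_msupp_eq0/msize_mdeg_ge/(leq_trans h1). Qed.

Lemma msize_pihomog m p : (msize (pihomog mdeg m p) <= m.+1)%N.
Proof.
apply: msize_leP => b hb; rewrite mcoeff_pihomog; case: eqP => // e.
by rewrite e ltnn in hb.
Qed.

Lemma msize_subr_pihomog m p : (msize p <= m.+1)%N ->
  (msize (p - pihomog mdeg m p)%R <= m)%N.
Proof.
move=> h; apply: msize_leP => b; rewrite leq_eqVlt mcoeffB mcoeff_pihomog eq_sym.
by case: eqP => [_ _|_ /= hb]; rewrite ?subrr // subr0 (mcoeff_msize h).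
Qed.

Lemma pihomog_small m p : (msize p <= m)%N -> pihomog mdeg m p = 0.
Proof.
move=> h; apply/mpolyP => b; rewrite mcoeff_pihomog mcoeff0.
by case: eqP => // e; apply: mcoeff_msize h _; rewrite e.
Qed.

Lemma msizeM_lt p q v w : (msize p <= v.+1)%N -> (msize q <= w)%N ->
  (msize (p * q)%R <= v + w)%N.
Proof.
have [->|p0] := eqVneq p 0; first by rewrite mul0r mmeasure0.
have [->|q0] := eqVneq q 0; first by rewrite mulr0 mmeasure0.
rewrite msizeM //; move: (msize p) (msize q) => a b; lia.
Qed.

Lemma pihomogM m m' p q : (msize p <= m.+1)%N -> (msize q <= m'.+1)%N ->
  pihomog mdeg (m + m') (p * q) = pihomog mdeg m p * pihomog mdeg m' q.
Proof.
move=> hp hq; rewrite -{1}(subrK (pihomog mdeg m p) p) mulrDl raddfD /=.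
rewrite pihomog_small ?add0r; last first.
  by rewrite mulrC addnC; apply: msizeM_lt => //; exact: msize_subr_pihomog.
rewrite -{1}(subrK (pihomog mdeg m' q) q) mulrDr raddfD /=.
rewrite pihomog_small ?add0r; last first.
  by apply: msizeM_lt; [exact: msize_pihomog|exact: msize_subr_pihomog].
by rewrite pihomog_dE //; apply: dhomogM; exact: pihomogP.
Qed.

End HomogeneousParts.

(** The commutator of two derivations is a derivation, so it vanishes on f / g as soon as it
    vanishes on f and on g. *)
Lemma derivation_comm_frac (L : fieldType) (D E : L -> L) (y f g : L) :
  {morph D : a b / a + b} -> {morph E : a b / a + b} ->
  (forall a b, D (a * b) = D a * b + a * D b) ->
  (forall a b, E (a * b) = E a * b + a * E b) ->
  g != 0 -> y * g = f -> D (E f) = E (D f) -> D (E g) = E (D g) ->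
  D (E y) = E (D y).
Proof.
move=> DD ED DM EM g0 <-; rewrite EM DD DM DM DM ED EM EM => e eg.
apply: (mulIf g0); apply: (addIr (E y * D g + (D y * E g + y * D (E g)))).
by rewrite addrA e eg -!addrA; congr (_ + _); rewrite addrCA.
Qed.

Section NormalForm.
Variables (k : fieldType) (d : nat).
Notation S := {mpoly k[d]}.
Notation K := {fraction {mpoly k[d]}}.
Notation "f %:F" := (@FracField.tofrac {mpoly k[d]} f).
Notation der := (@der k d).
Local Opaque Defs.der.

Lemma tofrac_inj : injective (fun f : S => f%:F).
Proof. by move=> f g /eqP; rewrite tofrac_eq => /eqP. Qed.

Lemma derC i j (y : K) : der i (der j y) = der j (der i y).
Proof.
have [f [g [g0 yg]]] := frac_ex y.
have gF : g%:F != 0 :> K by rewrite tofrac_eq0.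
have comm_poly (h : S) : der i (der j h%:F) = der j (der i h%:F).
  by rewrite !der_poly; congr (_%:F); exact: mderiv_comm.
exact: (derivation_comm_frac (@derD _ _ i) (@derD _ _ j) (@derM _ _ i)
  (@derM _ _ j) gF yg (comm_poly f) (comm_poly g)).
Qed.

Definition const (a : k) : K := (a%:MP)%:F.
Fact const_is_additive : additive const.
Proof. by move=> a b; rewrite /const mpolyCB tofracB. Qed.
Fact const_is_multiplicative : multiplicative const.
Proof. by split=> [a b|]; rewrite /const ?mpolyCM ?tofracM // mpolyC1 tofrac1. Qed.
HB.instance Definition _ := GRing.isAdditive.Build k K const const_is_additive.
HB.instance Definition _ := GRing.isMultiplicative.Build k K const const_is_multiplicative.

Lemma der_const i a : der i (const a) = 0.
Proof. by rewrite /const der_poly mderivC tofrac0. Qed.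

Lemma der_coord i j : der i ('X_j)%:F = (i == j)%:R.
Proof.
rewrite der_poly mderivX mnm1E eq_sym; case: eqP => [->|_].
  by rewrite sub_mm mpolyX0 scale1r tofrac1.
by rewrite scale0r tofrac0.
Qed.

Lemma Sloc_ring (J : {set 'I_d}) : [/\ Sloc J (0 : K),
  forall x y : K, Sloc J x -> Sloc J y -> Sloc J (x + y),
  forall x y : K, Sloc J x -> Sloc J y -> Sloc J (x * y) &
  forall i (x : K), Sloc J x -> Sloc J (der i x)].
Proof.
split=> [|x y [f [m ->]] [g [l ->]]|x y [f [m ->]] [g [l ->]]|i x [f [m ->]]].
- by exists 0, 0%N; rewrite tofrac0 mul0r.
- exists (f * xprod k J ^+ l + g * xprod k J ^+ m), (m + l)%N.
  by rewrite addf_div ?xprodF_neq0 // exprD tofracD !tofracM.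
- by exists (f * g), (m + l)%N; rewrite mulf_div exprD !tofracM.
rewrite derE ?expf_neq0 ?xprod_neq0 // -exprM.
by eexists; exists (m * 2)%N; reflexivity.
Qed.

Let derDl := @derD k d.
Let derMl := @derM k d.
Notation star := (star der).

Lemma SplocD (J : {set 'I_d}) (p q : {mpoly K[d]}) :
  Sploc J p -> Sploc J q -> Sploc J (p + q).
Proof. by have [_ h _ _] := Sloc_ring J => hp hq b; rewrite mcoeffD; exact: h. Qed.

Lemma SplocZ (J : {set 'I_d}) a (q : {mpoly K[d]}) :
  Sloc J a -> Sploc J q -> Sploc J (a *: q).
Proof. by have [_ _ h _] := Sloc_ring J => hp hq b; rewrite mcoeffZ; exact: h. Qed.

Lemma Sploc0 (J : {set 'I_d}) : Sploc J (0 : {mpoly K[d]}).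
Proof. by have [h _ _ _] := Sloc_ring J => b; rewrite mcoeff0. Qed.

Lemma Sloc1 (J : {set 'I_d}) : Sloc J (1 : K).
Proof. by rewrite -tofrac1; exact: Sloc_poly. Qed.

Lemma SplocX (J : {set 'I_d}) m : Sploc J ('X_[m] : {mpoly K[d]}).
Proof.
move=> b; rewrite mcoeffX; case: eqP => _; [exact: Sloc1|].
by have [h _ _ _] := Sloc_ring J.
Qed.

Lemma SplocC (J : {set 'I_d}) a : Sloc J a -> Sploc J (a%:MP : {mpoly K[d]}).
Proof.
move=> ha; rewrite -[a%:MP]mulr1 mul_mpolyC -mpolyX0.
by apply: SplocZ => //; exact: SplocX.
Qed.

Lemma Sploc_star (J : {set 'I_d}) (p q : {mpoly K[d]}) :
  Sploc J p -> Sploc J q -> Sploc J (star p q).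
Proof.
have [h0 hD hM hd] := Sloc_ring J; move=> hp hq.
(* With all weights zero and every graded piece equal to the whole localization, the graded closure
   statement becomes the ungraded one. *)
have := @coeffs_in_star d K der derDl derC int (fun _ => Sloc J) (fun _ => 0)
  (fun _ => h0) (fun _ => hD) (fun _ _ => hM) (fun _ => hd) 0 0 p q hp hq.
by [].
Qed.

Lemma weyl_op_nop (J : {set 'I_d}) (P : K -> K) : weyl_op J P ->
  exists2 q, Sploc J q & P = nop der q.
Proof.
elim=> [a ha|i|{}P Q _ [p hp ->] _ [q hq ->]|{}P Q _ [p hp ->] _ [q hq ->]].
- by exists a%:MP; [exact: SplocC|apply/funext => y; rewrite nopC].
- exists 'X_i; [exact: SplocX|apply/funext => y].
  by rewrite nopX mnm_iterU.
- by exists (p + q); [exact: SplocD|apply/funext => y; rewrite nopD].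
- exists (star p q); [exact: Sploc_star|apply/funext => y].
  by rewrite (nop_star derDl derMl derC).
Qed.

Lemma nop_weyl_op (J : {set 'I_d}) (q : {mpoly K[d]}) : Sploc J q ->
  weyl_op J (nop der q).
Proof.
have h0 : weyl_op J (fun _ : K => 0).
  have := weyl_op_poly J (0 : S); rewrite tofrac0.
  by congr weyl_op; apply/funext => y; rewrite mul0r.
have hmon b : weyl_op J (fun y : K => mnm_iter der b y).
  elim/mnm_ind: b => [|i b IH].
    have := weyl_op_poly J (1 : S); rewrite tofrac1.
    by congr weyl_op; apply/funext => y; rewrite mul1r mnm_iter0.
  have := weyl_comp (weyl_der k J i) IH.
  by congr weyl_op; apply/funext => y; rewrite mnm_iterUD //; exact: derC.
move=> hq; rewrite /nop; elim: (msupp q) => [|b s IH].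
  by move: h0; congr weyl_op; apply/funext => y; rewrite big_nil.
have := weyl_add (weyl_comp (weyl_mul (hq b)) (hmon b)) IH.
by congr weyl_op; apply/funext => y; rewrite big_cons.
Qed.

Fact weyl_nf_ex (J : {set 'I_d}) (P : weyl k J) :
  exists q, Sploc J q /\ weyl_fun P = nop der q.
Proof. by have [q h1 h2] := weyl_op_nop (weylP P); exists q. Qed.

Definition nf (J : {set 'I_d}) (P : weyl k J) : {mpoly K[d]} :=
  sval (cid (weyl_nf_ex P)).

Lemma nf_loc (J : {set 'I_d}) (P : weyl k J) : Sploc J (nf P).
Proof. by rewrite /nf; case: cid => q []. Qed.

Lemma nfE (J : {set 'I_d}) (P : weyl k J) : weyl_fun P = nop der (nf P).
Proof. by rewrite /nf; case: cid => q []. Qed.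

Hypothesis pchar0 : [pchar k] =i pred0.

(** In characteristic zero an operator is determined by its values on polynomials: [nop_eq0] applies
    with the coordinates x_i. *)
Lemma nop_inj (p q : {mpoly K[d]}) : nop der p = nop der q -> p = q.
Proof.
move=> h; apply/eqP; rewrite -subr_eq0; apply/eqP.
apply: (@nop_eq0 d K der derDl derMl derC k const (fun i => ('X_i)%:F)
          der_const der_coord pchar0 _ (msize (p - q))) => // g _.
by rewrite nopD nopN h subrr.
Qed.

Lemma nf_unique (J : {set 'I_d}) (P : weyl k J) q :
  weyl_fun P = nop der q -> nf P = q.
Proof. by rewrite nfE => /nop_inj. Qed.

Lemma nf_inj (J : {set 'I_d}) : injective (@nf J).
Proof. by move=> P Q h; apply: weyl_ext => y; rewrite !nfE h. Qed.

Fact opn_ex (J : {set 'I_d}) q : Sploc J q -> exists P : weyl k J, nf P = q.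
Proof.
move=> h; exists (@Weyl k d J _ (introT (asboolP _) (nop_weyl_op h))).
exact: nf_unique.
Qed.

(** Inverse of [nf]. If a coefficient of [q] is outside k[x]_(x^J), no operator has this normal form
    and the value is 0, whence the conditions [Sploc J q] below. *)
Definition opn (J : {set 'I_d}) (q : {mpoly K[d]}) : weyl k J :=
  xget 0 [set P | nf P = q].

Lemma opnK (J : {set 'I_d}) q : Sploc J q -> nf (opn J q) = q.
Proof. by rewrite /opn => /opn_ex[P hP]; case: xgetP => // /(_ P). Qed.

Lemma opnE (J : {set 'I_d}) q y : Sploc J q -> opn J q y = nop der q y.
Proof. by move=> h; rewrite nfE opnK. Qed.

Lemma nf_is_additive (J : {set 'I_d}) : additive (@nf J).
Proof.
by move=> P Q; apply: nf_unique; apply/funext => y; rewrite nopD nopN -!nfE.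
Qed.
HB.instance Definition _ (J : {set 'I_d}) :=
  GRing.isAdditive.Build (weyl k J) {mpoly K[d]} (@nf J) (@nf_is_additive J).

Lemma nf0 (J : {set 'I_d}) : nf (0 : weyl k J) = 0.
Proof. exact: raddf0. Qed.
Lemma nfD (J : {set 'I_d}) (P Q : weyl k J) : nf (P + Q) = nf P + nf Q.
Proof. exact: raddfD. Qed.
Lemma nfB (J : {set 'I_d}) (P Q : weyl k J) : nf (P - Q) = nf P - nf Q.
Proof. exact: raddfB. Qed.

Lemma nfM (J : {set 'I_d}) (P Q : weyl k J) : nf (P * Q) = star (nf P) (nf Q).
Proof.
apply: nf_unique; apply/funext => y.
by rewrite -(nop_star derDl derMl derC) -!nfE.
Qed.

Definition wmul (J : {set 'I_d}) (a : K) : weyl k J := opn J a%:MP.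

Lemma nf_wmul (J : {set 'I_d}) a : Sloc J a -> nf (wmul J a) = a%:MP.
Proof. by move=> h; rewrite opnK //; exact: SplocC. Qed.

Lemma wmulE (J : {set 'I_d}) a y : Sloc J a -> wmul J a y = a * y.
Proof. by move=> h; rewrite nfE nf_wmul // nopC. Qed.

Lemma nf_poly (J : {set 'I_d}) f : nf (weyl_poly J f) = (f%:F)%:MP.
Proof. by apply: nf_unique; apply/funext => y; rewrite nopC. Qed.

Lemma nf_pd (J : {set 'I_d}) i : nf (weyl_pd k J i) = 'X_i.
Proof. by apply: nf_unique; apply/funext => y; rewrite nopX mnm_iterU. Qed.

Lemma weyl_orderE (J : {set 'I_d}) m (P : weyl k J) :
  weyl_order m P <-> (msize (nf P) <= m.+1)%N.
Proof.
split=> [[q [_ hq] /nf_unique->] //|h].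
by exists (nf P); [split=> //; exact: nf_loc|exact: nfE].
Qed.

(** Size at most [l] is order at most [l - 1]; for [l = 0] both sides say that [P] is zero. *)
Lemma prev_orderE (J : {set 'I_d}) l (P : weyl k J) :
  fil_prev (@weyl_order k d J) l P <-> (msize (nf P) <= l)%N.
Proof.
case: l => [|l] /=; last exact: weyl_orderE.
rewrite leqn0 msize_poly_eq0; split=> [->|/eqP h]; first by rewrite raddf0.
by apply: nf_inj; rewrite h raddf0.
Qed.

Lemma has_symbolE (J : {set 'I_d}) m (P : weyl k J) s :
  has_symbol m P s <-> weyl_order m P /\ s = pihomog mdeg m (nf P).
Proof.
split=> [[q [h1 h2 h3] ->]|[/weyl_orderE h ->]].
  by rewrite (nf_unique h3); split=> //; apply/weyl_orderE; rewrite (nf_unique h3).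
by exists (nf P) => //; split=> //; [exact: nf_loc|exact: nfE].
Qed.

Lemma weyl_orderB (J : {set 'I_d}) m (P Q : weyl k J) :
  weyl_order m P -> weyl_order m Q -> weyl_order m (P - Q).
Proof.
rewrite !weyl_orderE => hP hQ; rewrite raddfB /=.
by apply: msizeD_lt => //; rewrite mmeasureN.
Qed.

Lemma weyl_order0 (J : {set 'I_d}) m : weyl_order m (0 : weyl k J).
Proof. by rewrite weyl_orderE raddf0 mmeasure0. Qed.

Lemma weyl_orderD (J : {set 'I_d}) m (P Q : weyl k J) :
  weyl_order m P -> weyl_order m Q -> weyl_order m (P + Q).
Proof. by rewrite !weyl_orderE raddfD => hP hQ; exact: msizeD_lt. Qed.

Lemma weyl_order_le (J : {set 'I_d}) m m' (P : weyl k J) :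
  (m <= m')%N -> weyl_order m P -> weyl_order m' P.
Proof. by rewrite !weyl_orderE => h /leq_trans; apply; rewrite ltnS. Qed.

Lemma weyl_orderM (J : {set 'I_d}) m m' (P Q : weyl k J) :
  weyl_order m P -> weyl_order m' Q -> weyl_order (m + m') (P * Q).
Proof.
rewrite !weyl_orderE nfM => hP hQ.
by have [] := msize_star derDl derC hP hQ.
Qed.

(** P Q and Q P have the same leading part, the product of the two normal forms, which cancels. *)
Lemma weyl_order_comm (J : {set 'I_d}) m m' (P Q : weyl k J) :
  weyl_order m P -> weyl_order m' Q ->
  fil_prev (@weyl_order k d J) (m + m') (P * Q - Q * P).
Proof.
rewrite !weyl_orderE prev_orderE raddfB /= !nfM => hP hQ.
have [_ h1] := msize_star derDl derC hP hQ.
have [_ h2] := msize_star derDl derC hQ hP.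
rewrite -[star _ _](subrK (nf P * nf Q)) -[X in _ - X](subrK (nf Q * nf P)).
rewrite [nf Q * nf P]mulrC opprD addrACA subrr addr0.
by apply: msizeD_lt => //; rewrite mmeasureN addnC [nf P * _]mulrC.
Qed.

Definition wsymb (J : {set 'I_d}) m (P : weyl k J) := pihomog mdeg m (nf P).

Lemma wsymbM (J : {set 'I_d}) m m' (P Q : weyl k J) :
  weyl_order m P -> weyl_order m' Q ->
  wsymb (m + m') (P * Q) = wsymb m P * wsymb m' Q.
Proof.
rewrite !weyl_orderE => hP hQ; rewrite /wsymb -pihomogM // nfM.
have [_ h] := msize_star derDl derC hP hQ.
by apply/eqP; rewrite -subr_eq0 -pihomogB pihomog_small.
Qed.

Lemma wsymb_small (J : {set 'I_d}) m (P : weyl k J) :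
  fil_prev (@weyl_order k d J) m P -> wsymb m P = 0.
Proof. by rewrite prev_orderE => h; exact: pihomog_small. Qed.

Lemma wsymbD (J : {set 'I_d}) m (P Q : weyl k J) :
  wsymb m (P + Q) = wsymb m P + wsymb m Q.
Proof. by rewrite /wsymb !raddfD. Qed.

Lemma wsymbB (J : {set 'I_d}) m (P Q : weyl k J) :
  wsymb m (P - Q) = wsymb m P - wsymb m Q.
Proof. by rewrite /wsymb !raddfB. Qed.

End NormalForm.

(** Axiomatized so that one theory covers A, its localizations, and the degree-0 subring [BF0]. The
    field [fr_comm] says that the associated graded ring is commutative. *)
Record filtered_ring (B : nzRingType) (BF : nat -> set B) : Prop := FilteredRing {
  fr0 : forall m, BF m 0;
  frB : forall m P Q, BF m P -> BF m Q -> BF m (P - Q);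
  fr_mono : forall m, BF m `<=` BF m.+1;
  fr1 : BF 0%N 1;
  frM : forall m m' P Q, BF m P -> BF m' Q -> BF (m + m')%N (P * Q);
  fr_comm : forall m m' P Q, BF m P -> BF m' Q ->
    fil_prev BF (m + m') (P * Q - Q * P) }.

(** A k-point of Spec gr(B), given by its restrictions to the graded pieces. It abstracts the
    evaluation [chz] at a point z and the pullback [chiW] of a point of T^*X. *)
Record gr_character (k : fieldType) (B : nzRingType) (BF : nat -> set B)
    (chi : nat -> B -> k) : Prop := GrCharacter {
  gcD : forall m P Q, BF m P -> BF m Q -> chi m (P + Q) = chi m P + chi m Q;
  gc_prev : forall m P, fil_prev BF m P -> chi m P = 0;
  gcM : forall m m' P Q, BF m P -> BF m' Q ->
    chi (m + m')%N (P * Q) = chi m P * chi m' Q;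
  gc1 : chi 0%N 1 = 1 }.

(** * Supports of filtered modules *)

Section Filtered.
Variables (k : fieldType) (B : nzRingType) (BF : nat -> set B).
Variables (M : lmodType B) (N : set M).
Hypothesis frBF : filtered_ring BF.
Implicit Type Fil : nat -> set M.

(* The class of P in degree m of gr(B) annihilates gr(M). *)
Definition drops Fil m (P : B) := forall l u, Fil l u -> fil_prev Fil (m + l) (P *: u).

Definition supp_at Fil (chi : nat -> B -> k) :=
  forall m P, BF m P -> drops Fil m P -> chi m P = 0.

(** Fil_(a-j) with the convention that pieces of negative index are zero, which truncated
    subtraction would lose. *)
Definition dropn Fil (a j : nat) : set M :=
  [set u | if (j <= a)%N then Fil (a - j)%N u else u = 0].

Lemma fil_prevE Fil a u : fil_prev Fil a u <-> dropn Fil a 1 u.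
Proof. by case: a => [|a] //; rewrite /dropn /= subn1. Qed.

Section Good.
Variable Fil : nat -> set M.
Hypothesis good : good_filtration BF *:%R N Fil.

Lemma fil0 l : Fil l 0. Proof. by have [] := fil_zmod good l. Qed.
Lemma filB l u v : Fil l u -> Fil l v -> Fil l (u - v).
Proof. by have [_] := fil_zmod good l; apply. Qed.
Lemma filN l u : Fil l u -> Fil l (- u).
Proof. by move=> h; rewrite -sub0r; apply: filB => //; exact: fil0. Qed.
Lemma filD l u v : Fil l u -> Fil l v -> Fil l (u + v).
Proof. by move=> hu hv; rewrite -[v]opprK; apply: filB => //; exact: filN. Qed.
Lemma fil_le l l' u : (l <= l')%N -> Fil l u -> Fil l' u.
Proof.
move=> /subnK<-; elim: (l' - l)%N => // n IH /IH; exact: (fil_mono good).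
Qed.
Lemma prev0 l : fil_prev Fil l 0. Proof. by case: l => //= l; exact: fil0. Qed.
Lemma prevD l u v : fil_prev Fil l u -> fil_prev Fil l v -> fil_prev Fil l (u + v).
Proof. by case: l => [/= -> ->|l]; [rewrite /= addr0|exact: filD]. Qed.
Lemma prev_le l l' u : (l <= l')%N -> fil_prev Fil l u -> fil_prev Fil l' u.
Proof. by case: l l' => [|l] [|l'] // h; [move=> ->; exact: fil0|exact: fil_le]. Qed.

Lemma fil_act_prev m l b u : BF m b -> fil_prev Fil l u -> fil_prev Fil (m + l) (b *: u).
Proof.
move=> hb; case: l => [->|l hu]; first by rewrite scaler0; exact: prev0.
by rewrite addnS /=; exact: (fil_act good).
Qed.
Lemma prev_act m l b u : fil_prev BF m b -> Fil l u -> fil_prev Fil (m + l) (b *: u).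
Proof.
case: m => [->|m hb hu]; first by rewrite scale0r => _; exact: prev0.
by rewrite addSn /=; exact: (fil_act good).
Qed.

(** P Q u = Q P u + [P, Q] u, and the commutator has order below m + m'. *)
Lemma drops_comm m P m' Q l u : BF m P -> BF m' Q -> Fil l u ->
  fil_prev Fil (m + l) (P *: u) -> fil_prev Fil (m + m' + l) (P *: (Q *: u)).
Proof.
move=> hP hQ hu hPu; rewrite scalerA -[P * Q](subrK (Q * P)) scalerDl.
apply: prevD; first by apply: prev_act => //; exact: (fr_comm frBF).
rewrite -scalerA (addnC m) -addnA; exact: fil_act_prev.
Qed.

(** Lifts of homogeneous generators of gr(M) generate the filtration: an element of Fil_l is
    corrected by B_(l - e i) g_i down to the previous piece. Stated as an induction principle, in
    which only the elements b g_i need checking. *)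
Lemma good_ind : exists (r : nat) (e : 'I_r -> nat) (g : 'I_r -> M),
  (forall i, Fil (e i) (g i)) /\
  forall Q : nat -> set M,
    (forall l, Q l 0) -> (forall l u v, Q l u -> Q l v -> Q l (u + v)) ->
    (forall l, Q l `<=` Q l.+1) ->
    (forall i l b, (e i <= l)%N -> BF (l - e i)%N b -> Q l (b *: g i)) ->
    forall l, Fil l `<=` Q l.
Proof.
have [r [e [g [he hg]]]] := fil_gr_fg good; exists r, e, g; split=> // Q Q0 QD QS Qg.
elim=> [|l IH] u /hg[b [hb]] /=.
  move=> /eqP; rewrite subr_eq0 => /eqP->; elim/big_ind: _ => //; first exact: QD.
  by move=> i hi; apply: Qg => //; exact: hb.
move=> /IH /QS; set v := \sum_(_ < _ | _) _ => hv; rewrite -(subrK v u).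
apply: (QD l.+1) => //; rewrite /v; elim/big_ind: _ => //; first exact: QD.
by move=> i hi; apply: Qg => //; exact: hb.
Qed.

(** By commutativity of gr(B), annihilating gr(M) can be tested on its finitely many generators. *)
Lemma drops_gens : exists (r : nat) (e : 'I_r -> nat) (g : 'I_r -> M),
  (forall i, Fil (e i) (g i)) /\
  forall m P, BF m P -> (forall i, fil_prev Fil (m + e i) (P *: g i)) -> drops Fil m P.
Proof.
have [r [e [g [he hg]]]] := good_ind; exists r, e, g; split=> // m P hP hPg.
move=> l; apply: (hg (fun l => [set u | fil_prev Fil (m + l) (P *: u)])) => /=.
- by move=> l'; rewrite scaler0; exact: prev0.
- by move=> l' u v hu hv; rewrite scalerDr; exact: prevD.
- by move=> l' u /=; apply: prev_le; rewrite leq_add2l.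
- move=> i l' b hl hb; rewrite -(subnK hl) addnA.
  exact: drops_comm.
Qed.

Lemma drops_pow m P j l u : drops Fil m P -> Fil l u ->
  dropn Fil (l + m * j) j (P ^+ j *: u).
Proof.
move=> hP hu; elim: j => [|j IH].
  by rewrite /dropn /= muln0 addn0 subn0 expr0 scale1r.
rewrite exprS -scalerA; move: IH; rewrite /dropn /=.
case: ifP => [le h|gt ->]; last first.
  by rewrite scaler0; case: ifP => // _; exact: fil0.
have := hP _ _ h; rewrite fil_prevE /dropn /=.
have -> : (m + (l + m * j - j) = l + m * j.+1 - j)%N by nia.
case: ifP => [h1 h2|h1 ->].
  have -> : (j < l + m * j.+1)%N by nia.
  by rewrite (_ : _ - _ = l + m * j.+1 - j - 1)%N //; lia.
by case: ifP => // _; exact: fil0.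
Qed.

End Good.

Lemma fr_pow m P j : BF m P -> BF (m * j)%N (P ^+ j).
Proof.
move=> h; elim: j => [|j IH]; first by rewrite muln0 expr0; exact: (fr1 frBF).
by rewrite exprS mulnS; exact: (frM frBF).
Qed.

Lemma gc_pow (chi : nat -> B -> k) m P j : gr_character BF chi -> BF m P ->
  chi (m * j)%N (P ^+ j) = chi m P ^+ j.
Proof.
move=> hchi h; elim: j => [|j IH]; first by rewrite muln0 !expr0 (gc1 hchi).
by rewrite !exprS mulnS (gcM hchi) ?IH //; exact: fr_pow.
Qed.

(** Each generator of the first filtration lies in some piece of the second; the sum of these
    indices bounds the shift for all of them. *)
Lemma good_compare Fil Fil' :
  good_filtration BF *:%R N Fil -> good_filtration BF *:%R N Fil' ->
  exists c, forall l, Fil l `<=` Fil' (l + c)%N.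
Proof.
move=> good good'; have [r [e [g [he hg]]]] := good_ind good.
have hN i : exists c, Fil' c (g i).
  have : N (g i) by rewrite -(fil_exhaustive good); exists (e i).
  by rewrite -(fil_exhaustive good') => -[c]; exists c.
have [c hc] := choice hN; exists (\sum_i c i)%N.
apply: (hg (fun l => Fil' (l + \sum_i c i)%N)) => [l|l u v|l|i l b hl hb].
- exact: (fil0 good').
- exact: (filD good').
- by rewrite addSn; exact: (fil_mono good').
- apply: (fil_le good' _ (fil_act good' hb (hc i))).
  by apply: leq_add; [exact: leq_subr|rewrite (bigD1 i) //= leq_addr].
Qed.

(* If P lowers Fil by one, then P ^ (c + c' + 1) lowers Fil' by one, where c and
   c' bound the shifts needed to compare Fil and Fil'. *)
Lemma supp_at_indep Fil Fil' (chi : nat -> B -> k) :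
  good_filtration BF *:%R N Fil -> good_filtration BF *:%R N Fil' ->
  gr_character BF chi -> supp_at Fil' chi -> supp_at Fil chi.
Proof.
move=> good good' hchi h m P hP hdrop.
have [c hc] := good_compare good good'; have [c' hc'] := good_compare good' good.
pose j := (c + c').+1.
suff : chi (m * j)%N (P ^+ j) = 0.
  by rewrite gc_pow // => /eqP; rewrite expf_eq0 => /andP[_ /eqP].
apply: h => [|l u /hc' hu]; first exact: fr_pow.
have := drops_pow good j hdrop hu; rewrite /dropn /= fil_prevE /dropn /=.
rewrite {-1}/j; case: ifP => [h1 /hc h2|_ ->]; last first.
  by case: ifP => // _; exact: (fil0 good').
have -> : (0 < m * j + l)%N by rewrite /j; nia.
by apply: (fil_le good' _ h2); rewrite /j; lia.
Qed.

Lemma gr_act_eq0_single Fil m P c (x : nat -> M) : good_filtration BF *:%R N Fil ->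
  BF m P -> drops Fil m P -> (forall j, Fil j (x j)) ->
  gr_act_eq0 *:%R Fil m.+1 (fun i => if i == m then P else 0) c x.
Proof.
move=> good hP hdrop hx l; rewrite big_ord_recr /= eqxx big1 ?add0r; last first.
  move=> i _; rewrite big1 // => j _.
  by rewrite (ltn_eqF (ltn_ord i)) scale0r.
elim/big_ind: _ => [|u v|j /eqP<-].
- exact: (prev0 good).
- exact: (prevD good).
- exact: hdrop.
Qed.

(** If some P dropping the filtration does not vanish at chi, it kills every class, so the
    localization at chi is zero. Conversely, if the localization is zero, each generator is killed
    by a homogeneous element not vanishing at chi. The product of these elements then drops the
    filtration and does not vanish either. *)
Lemma supp_atP Fil (chi : nat -> B -> k) : good_filtration BF *:%R N Fil ->
  gr_character BF chi -> in_support BF *:%R Fil chi <-> supp_at Fil chi.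
Proof.
move=> good hchi; split=> [[c [x [hx h]]] m P hP hdrop|h].
  apply: contrapT => /eqP nz; apply: h (gr_act_eq0_single c good hP hdrop hx).
    by move=> i; case: eqP => [->|_] //; exact: (fr0 frBF).
  rewrite big_ord_recr /= eqxx big1 ?add0r // => i _.
  rewrite (ltn_eqF (ltn_ord i)); apply: (gc_prev hchi).
  by case: (nat_of_ord i) => //= i'; exact: (fr0 frBF).
apply: contrapT => nsupp.
have [r [e [g [he hg]]]] := drops_gens good.
have kill i : exists mP : nat * B, [/\ BF mP.1 mP.2, chi mP.1 mP.2 != 0 &
    fil_prev Fil (mP.1 + e i) (mP.2 *: g i)].
  apply: contrapT => nokill; apply: nsupp.
  exists (e i).+1, (fun j => if j == e i then g i else 0); split.
    by move=> j; case: eqP => [->|_] //; exact: (fil0 good).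
  move=> a s hs nz hann.
  have [m hm] : exists m : 'I_a, chi m (s m) != 0.
    apply/existsP; apply: contraNT nz => /existsPn nz.
    by rewrite big1 // => m _; apply/eqP; rewrite -[_ == _]negbK.
  apply: nokill; exists (nat_of_ord m, s m); split => //=.
  (* As x is concentrated in degree [e i], the relation in degree [m + e i] isolates the component
     s_m, chosen with nonzero value at chi. *)
  have := hann (m + e i)%N.
  rewrite (bigD1 m) //= [X in _ + X]big1 ?addr0; last first.
    move=> m' mm'; rewrite big1 // => j /eqP hj; case: eqP => [ej|]; last by rewrite scaler0.
    case/eqP: mm'; apply: val_inj => /=; apply: (@addIn (e i)).
    by rewrite -hj ej.
  rewrite (bigD1 ord_max) //= eqxx big1 ?addr0 // => j /andP[_ jm].
  by rewrite ifN ?scaler0.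
have [mP hmP] := choice kill.
pose prodm (s : seq 'I_r) := (\sum_(i <- s) (mP i).1)%N.
pose prodP (s : seq 'I_r) := \prod_(i <- s) (mP i).2.
have BFprod s : BF (prodm s) (prodP s).
  rewrite /prodm /prodP; elim: s => [|i s IH]; first by rewrite !big_nil; exact: (fr1 frBF).
  by rewrite !big_cons; apply: (frM frBF) => //; have [] := hmP i.
have chiprod s : chi (prodm s) (prodP s) != 0.
  rewrite /prodm /prodP; elim: s => [|i s IH]; first by rewrite !big_nil (gc1 hchi) oner_neq0.
  have [h1 h2 _] := hmP i.
  by rewrite !big_cons (gcM hchi h1 (BFprod s)) mulf_neq0.
have killprod s i : i \in s -> fil_prev Fil (prodm s + e i) (prodP s *: g i).
  rewrite /prodm /prodP; elim: s => // j s IH; rewrite inE !big_cons => /orP[/eqP<-|/IH hs].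
    have [h1 _ h3] := hmP i; rewrite -scalerA.
    exact: (drops_comm good h1 (BFprod s) (he i) h3).
  by have [h1 _ _] := hmP j; rewrite -scalerA -addnA; exact: (fil_act_prev good).
have := chiprod (enum 'I_r); rewrite h ?eqxx //.
apply: hg => // i; apply: killprod; by rewrite mem_enum.
Qed.

End Filtered.

(** * Laurent monomials and gradings *)

Section LogDerivative.
Variables (L : fieldType) (D : L -> L).
Hypothesis DM : forall a b, D (a * b) = D a * b + a * D b.

(** The logarithmic derivative turns products into sums, so that positive and negative exponents are
    treated alike when differentiating Laurent monomials. *)
Definition ld (u : L) := D u / u.

Lemma ldM u v : u != 0 -> v != 0 -> ld (u * v) = ld u + ld v.
Proof. by move=> u0 v0; rewrite /ld DM; field; rewrite u0 v0. Qed.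

Lemma ld1 : ld 1 = 0.
Proof.
have h : ld (1 * 1) = ld 1 + ld 1 by apply: ldM; exact: oner_neq0.
by rewrite mulr1 in h; apply: (addIr (ld 1)); rewrite -h add0r.
Qed.

Lemma ldV u : u != 0 -> ld u^-1 = - ld u.
Proof.
by move=> u0; apply/eqP; rewrite -addr_eq0 -ldM ?invr_eq0 // mulVf // ld1.
Qed.

Lemma ldXn u m : u != 0 -> ld (u ^+ m) = m%:R * ld u.
Proof.
move=> u0; elim: m => [|m IH]; first by rewrite mul0r expr0 ld1.
by rewrite exprS ldM ?expf_neq0 // IH -add1n natrD mulrDl mul1r.
Qed.

Lemma ldXz u (z : int) : u != 0 -> ld (u ^ z) = z%:~R * ld u.
Proof.
move=> u0; case: z => m; first exact: ldXn.
by rewrite NegzE -exprnN ldV ?expf_neq0 // ldXn // mulrNz mulNr.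
Qed.

Lemma ld_prod (I : Type) (s : seq I) (f : I -> L) : (forall i, f i != 0) ->
  ld (\prod_(i <- s) f i) = \sum_(i <- s) ld (f i).
Proof.
move=> f0; elim: s => [|i s IH]; first by rewrite !big_nil ld1.
have p0 : \prod_(j <- s) f j != 0.
  by elim: s {IH} => [|j s h]; rewrite ?big_nil ?oner_neq0 // big_cons mulf_neq0.
by rewrite !big_cons ldM ?IH.
Qed.
End LogDerivative.

Section Decomposition.
Variables (H : eqType) (V : zmodType) (Q : H -> set V).
Hypothesis Q0 : forall c, Q c 0.
Hypothesis QD : forall c x y, Q c x -> Q c y -> Q c (x + y).

(** Degrees are listed without repetition so that components can later be compared through
    [gr_direct]. *)
Definition dec : set V := [set y | exists (s : seq H) (g : H -> V),
  [/\ uniq s, forall c, Q c (g c) & y = \sum_(c <- s) g c]].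

Lemma dec0 : dec 0.
Proof. by exists [::], (fun => 0); split=> //; rewrite big_nil. Qed.

Lemma dec1 c y : Q c y -> dec y.
Proof.
move=> h; exists [:: c], (fun c' => if c' == c then y else 0); split=> //.
  by move=> c'; case: eqP => [->|].
by rewrite big_seq1 eqxx.
Qed.

Lemma decD x y : dec x -> dec y -> dec (x + y).
Proof.
move=> [s [g [us hg ->]]] [s' [g' [us' hg' ->]]].
exists (undup (s ++ s')), (fun c => (if c \in s then g c else 0) +
                                    (if c \in s' then g' c else 0)).
split; [exact: undup_uniq|by move=> c; apply: QD; case: ifP|].
have aux (t : seq H) (f : H -> V) : uniq t -> {subset t <= s ++ s'} ->
    \sum_(c <- t) f c = \sum_(c <- undup (s ++ s')) (if c \in t then f c else 0).
  move=> ut sub; rewrite -big_mkcond -big_filter; apply: perm_big.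
  apply: uniq_perm => //; first by rewrite filter_uniq ?undup_uniq.
  move=> c; rewrite mem_filter mem_undup andb_idr //; exact: sub.
rewrite big_split /= (aux s) // ?(aux s') // => c hc; by rewrite mem_cat hc ?orbT.
Qed.

Lemma dec_sum (I : eqType) (s : seq I) (F : I -> V) :
  (forall i, i \in s -> dec (F i)) -> dec (\sum_(i <- s) F i).
Proof.
by move=> h; rewrite big_seq; elim/big_ind: _ => //; [exact: dec0|exact: decD].
Qed.
End Decomposition.

Section Laurent.
Variables (k : fieldType) (n d : nat) (V : 'M[int]_(d, n)).
Notation S := {mpoly k[d]}.
Notation K := {fraction {mpoly k[d]}}.
Notation "f %:F" := (@FracField.tofrac {mpoly k[d]} f).
Notation der := (@der k d).
Local Opaque Defs.der.

Definition lmon (a : 'rV[int]_d) : K := \prod_(i < d) ('X_i)%:F ^ (a 0 i).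

Lemma X_neq0 (i : 'I_d) : ('X_i)%:F != 0 :> K.
Proof. by rewrite tofrac_eq0 -msize_poly_eq0 msizeX. Qed.

Lemma lmonD a b : lmon (a + b) = lmon a * lmon b.
Proof.
rewrite /lmon -big_split; apply: eq_bigr => i _.
by rewrite mxE expfzDr // X_neq0.
Qed.

Lemma lmon0 : lmon 0 = 1.
Proof. by rewrite /lmon big1 // => i _; rewrite mxE expr0z. Qed.

Lemma lmon_neq0 a : lmon a != 0.
Proof. by apply/prodf_neq0 => i _; rewrite expfz_neq0 // X_neq0. Qed.

Lemma lmonN a : lmon (- a) = (lmon a)^-1.
Proof. by apply: (mulIf (lmon_neq0 a)); rewrite -lmonD addNr lmon0 mulVf ?lmon_neq0. Qed.

Lemma lmonB a b : lmon (a - b) = lmon a / lmon b.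
Proof. by rewrite lmonD lmonN. Qed.

Definition mnm_row (b : 'X_{1..d}) : 'rV[int]_d := \row_i (b i)%:Z.

Lemma lmon_mnm b : ('X_[b])%:F = lmon (mnm_row b).
Proof.
rewrite mpolyXE_id /lmon rmorph_prod; apply: eq_bigr => i _.
by rewrite mxE rmorphXn.
Qed.

Lemma der_lmon i a : der i (lmon a) = (a 0 i)%:~R * lmon (a - delta_mx 0 i).
Proof.
have h : ld (der i) (lmon a) = (a 0 i)%:~R / ('X_i)%:F.
  rewrite /lmon (ld_prod (@derM _ _ i)) => [|j]; last by rewrite expfz_neq0 // X_neq0.
  rewrite (bigD1 i) //= big1 ?addr0 => [|j ji].
    rewrite ldXz ?X_neq0 //; last exact: derM.
    by rewrite /ld der_coord eqxx mul1r.
  rewrite ldXz ?X_neq0 //; last exact: derM.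
  by rewrite /ld der_coord eq_sym (negPf ji) mul0r mulr0.
rewrite -[LHS](divfK (lmon_neq0 a)) -/(ld (der i) (lmon a)) h lmonB.
suff -> : lmon (delta_mx 0 i) = ('X_i)%:F by rewrite mulrAC mulrA.
rewrite lmon_mnm; congr lmon; apply/rowP => j; rewrite !mxE mnm1E eqxx /=.
by rewrite eq_sym; case: eqP.
Qed.

Definition nonneg_off (J : {set 'I_d}) (a : 'rV[int]_d) : Prop :=
  forall i, i \notin J -> 0 <= a 0 i.

Definition ind_row (J : {set 'I_d}) : 'rV[int]_d := \row_i (i \in J)%:Z.

Lemma ind_rowMn (J : {set 'I_d}) m i :
  (ind_row J *+ m) 0 i = if i \in J then m%:Z else 0.
Proof.
rewrite mulmxnE mxE; case: (i \in J); last by rewrite mul0rn.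
by rewrite -[RHS]natz.
Qed.

Lemma xprod_lmon (J : {set 'I_d}) m : (xprod k J ^+ m)%:F = lmon (ind_row J *+ m).
Proof.
elim: m => [|m IH]; first by rewrite expr0 tofrac1 mulr0n lmon0.
rewrite exprS tofracM IH mulrS lmonD; congr (_ * _).
rewrite /xprod rmorph_prod /lmon big_mkcond; apply: eq_bigr => i _.
by rewrite mxE; case: (i \in J).
Qed.

Lemma class_of_is_additive : additive (class_of V).
Proof.
move=> a b; apply: (addIr (class_of V b)).
by rewrite -class_ofD !subrK.
Qed.
HB.instance Definition _ :=
  GRing.isAdditive.Build 'rV[int]_d (class_group V) (class_of V) class_of_is_additive.

Lemma xdegE (J : {set 'I_d}) m : xdeg V J *+ m = class_of V (ind_row J *+ m).
Proof.
rewrite raddfMn; congr (_ *+ _); rewrite /xdeg /class_var -raddf_sum.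
congr (class_of V _); apply/rowP => i; rewrite !mxE summxE.
have [hi|hi] := boolP (i \in J).
  rewrite (bigD1 i) //= mxE !eqxx big1 // => j /andP[_ ji].
  by rewrite mxE eq_sym (negPf ji) andbF.
by rewrite big1 // => j hj; rewrite mxE eqxx /=; case: eqP => // e; rewrite e hj in hi.
Qed.

Lemma class_mnmE b : class_mnm V b = class_of V (mnm_row b).
Proof. by []. Qed.

Lemma lmon_Sgr (J : {set 'I_d}) a : nonneg_off J a -> Sgr J (class_of V a) (lmon a).
Proof.
(* The exponent m exceeds every |a_i|, so multiplying by (x^J)^m turns x^a into a genuine monomial
   x^b. *)
move=> ha; pose m := (\sum_(i < d) `|a 0%R i|)%N.
pose b : 'X_{1..d} := [multinom absz ((a + ind_row J *+ m)%R 0%R i) | i < d].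
have hb : mnm_row b = a + ind_row J *+ m.
  apply/rowP => i; rewrite mxE mnmE mxE ind_rowMn.
  have le : (`|a 0%R i| <= m)%N by rewrite /m (bigD1 i) //= leq_addr.
  rewrite gez0_abs //; move: (ha i); case: (i \in J) => /= [_|/(_ isT) h]; last first.
    by rewrite addr0.
  by clearbody m; move: le; set z := a _ _; move: (z : int) => {}z le; lia.
exists 'X_[b], m; split.
  by move=> c; rewrite msuppX inE => /eqP->; rewrite xdegE -raddfD -hb.
by rewrite xprod_lmon lmon_mnm hb lmonD mulfK ?lmon_neq0.
Qed.

(** Each graded piece of k[x]_(x^J) is spanned by Laurent monomials whose exponents outside J are
    nonnegative; additive statements reduce to these. *)
Lemma Sgr_ind (J : {set 'I_d}) c (P : K -> Prop) : P 0 ->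
  (forall x y, P x -> P y -> P (x + y)) ->
  (forall a t, nonneg_off J a -> class_of V a = c -> P (const d t * lmon a)) ->
  forall y, Sgr J c y -> P y.
Proof.
move=> P0 PD Pm y [f [m [hf ->]]].
rewrite [f]mpolyE rmorph_sum mulr_suml big_seq.
elim/big_ind: _ => // b hb; rewrite /= -mul_mpolyC tofracM -mulrA.
rewrite xprod_lmon lmon_mnm -lmonB; apply: Pm => [i iJ|].
  by rewrite 2!mxE [X in _ + X]mxE ind_rowMn (negPf iJ) subr0.
by rewrite raddfB /= -xdegE -class_mnmE (hf _ hb) addrK.
Qed.

Lemma Sgr_Sloc (J : {set 'I_d}) c y : Sgr (V := V) J c y -> Sloc (k := k) J y.
Proof. by move=> [f [m [_ ->]]]; exists f, m. Qed.

Lemma Sgr0 (J : {set 'I_d}) (c : class_group V) : Sgr J c (0 : K).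
Proof.
exists 0, 0%N; split; last by rewrite tofrac0 mul0r.
by move=> b; rewrite msupp0.
Qed.

Lemma SgrM (J : {set 'I_d}) (c c' : class_group V) (x y : K) :
  Sgr J c x -> Sgr J c' y -> Sgr J (c + c') (x * y).
Proof.
move=> [f [m [hf ->]]] [g [l [hg ->]]]; exists (f * g), (m + l)%N; split.
  by rewrite mulrnDr addrACA; exact: class_homogM.
by rewrite mulf_div exprD 2!tofracM.
Qed.

Lemma Sgr_const (J : {set 'I_d}) (t : k) : Sgr J (0 : class_group V) (const d t).
Proof.
exists t%:MP, 0%N; split; last by rewrite expr0 tofrac1 divr1.
by rewrite mulr0n addr0; exact: class_homog_const.
Qed.

Lemma SgrB (J : {set 'I_d}) (c : class_group V) (x y : K) :
  Sgr J c x -> Sgr J c y -> Sgr J c (x - y).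
Proof.
move=> [f [m [hf ->]]] [g [l [hg ->]]].
exists (f * xprod k J ^+ l - g * xprod k J ^+ m), (m + l)%N; split.
  rewrite mulrnDr addrA; apply: class_homogB.
    exact: class_homogM hf (@class_homog_xprod k n d V J l).
  rewrite addrAC; exact: class_homogM hg (@class_homog_xprod k n d V J m).
by rewrite -mulNr addf_div ?xprodF_neq0 // exprD tofracB 3!tofracM mulNr.
Qed.

Lemma SgrD (J : {set 'I_d}) (c : class_group V) (x y : K) :
  Sgr J c x -> Sgr J c y -> Sgr J c (x + y).
Proof.
move=> hx hy; rewrite -[y]opprK; apply: SgrB => //; rewrite -sub0r.
by apply: SgrB => //; exact: Sgr0.
Qed.

Lemma SgrZ (J : {set 'I_d}) (c : class_group V) t (x : K) :
  Sgr J c x -> Sgr J c (const d t * x).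
Proof. by move=> hx; rewrite -[c]add0r; apply: SgrM hx; exact: Sgr_const. Qed.

Lemma Sgr_der (J : {set 'I_d}) (c : class_group V) i (x : K) :
  Sgr J c x -> Sgr J (c - class_var V i) (der i x).
Proof.
apply: (Sgr_ind (P := fun x => Sgr J (c - class_var V i) (der i x))).
- by rewrite -tofrac0 der_poly mderiv0 tofrac0; exact: Sgr0.
- by move=> y y' hy hy'; rewrite derD; exact: SgrD.
move=> a t ha hc; rewrite derM der_const mul0r add0r der_lmon; apply: SgrZ.
have [->|ai] := eqVneq (a 0 i) 0; first by rewrite mul0r; exact: Sgr0.
have -> : (a 0 i)%:~R = const d ((a 0 i)%:~R : k) by rewrite (rmorph_int (const d)).
apply: SgrZ; rewrite -hc /class_var -raddfB; apply: lmon_Sgr => j jJ.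
rewrite !mxE eqxx /=; have [e|_] := eqVneq j i; last by rewrite subr0; exact: ha.
by have := ha j jJ; rewrite e; move: ai; move: (a _ i : int) => z /=; lia.
Qed.

(** Multiplication by the monomial (x^J)^m shifts the support of f injectively and its classes by a
    constant, so homogeneity can be read off from the numerator. *)
Lemma Sgr_poly (J : {set 'I_d}) (c : class_group V) (f : S) :
  Sgr J c f%:F -> class_homog c f.
Proof.
move=> [g [m [hg e]]] b hb.
have eg : g = f * xprod k J ^+ m.
  apply: tofrac_inj; rewrite tofracM e divfK // xprodF_neq0 //.
pose u := [multinom ((i \in J) * m)%N | i < d].
have xu : xprod k J ^+ m = 'X_[u].
  apply: tofrac_inj; rewrite xprod_lmon lmon_mnm; congr lmon.
  by apply/rowP => i; rewrite ind_rowMn mxE mnmE; case: (i \in J); rewrite ?mul1n.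
have : (u + b)%MM \in msupp g.
  by rewrite eg xu mcoeff_msupp mcoeffMX -mcoeff_msupp.
move=> /hg; rewrite class_mnmD [class_mnm V u](_ : _ = xdeg V J *+ m).
  by rewrite addrC => /addIr.
rewrite xdegE class_mnmE; congr class_of.
by apply/rowP => i; rewrite ind_rowMn mxE mnmE; case: (i \in J); rewrite ?mul1n.
Qed.

Lemma Sgr_poly0 (c : class_group V) (f : S) (J : {set 'I_d}) :
  class_homog c f -> Sgr J c f%:F.
Proof.
move=> hf; exists f, 0%N; split; last by rewrite expr0 tofrac1 divr1.
by rewrite mulr0n addr0.
Qed.

Lemma Sloc_dec (J : {set 'I_d}) (y : K) : Sloc J y -> dec (Sgr (V := V) J) y.
Proof.
move=> [f [m ->]]; rewrite [f]mpolyE rmorph_sum mulr_suml.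
apply: dec_sum => [c|c x x'|b hb]; [exact: Sgr0|exact: SgrD|].
rewrite /= -mul_mpolyC tofracM -mulrA xprod_lmon lmon_mnm -lmonB.
apply: dec1; first exact: Sgr0.
apply: SgrZ; apply: lmon_Sgr => i iJ.
by rewrite 2!mxE [X in _ + X]mxE ind_rowMn (negPf iJ) subr0.
Qed.

Lemma class_mnm_mdegw b : class_mnm V b = mdegw (class_var V) b.
Proof.
elim/mnm_ind: b => [|i b IH]; first by rewrite class_mnm0 mdegw0.
by rewrite class_mnmD class_mnmU mdegwD mdegwU IH.
Qed.

Lemma Spgr_coeffs (J : {set 'I_d}) c (q : {mpoly K[d]}) :
  Spgr J c q <-> coeffs_in (Sgr (V := V) J) (class_var V) c q.
Proof. by split=> h b; have := h b; rewrite class_mnm_mdegw. Qed.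

Lemma Spgr_star (J : {set 'I_d}) (c c' : class_group V) (p q : {mpoly K[d]}) :
  Spgr J c p -> Spgr J c' q -> Spgr J (c + c') (star der p q).
Proof.
rewrite !Spgr_coeffs; apply: coeffs_in_star.
- exact: derD.
- exact: derC.
- exact: Sgr0.
- exact: SgrD.
- exact: SgrM.
- exact: Sgr_der.
Qed.

Lemma SpgrD (J : {set 'I_d}) (c : class_group V) (p q : {mpoly K[d]}) :
  Spgr J c p -> Spgr J c q -> Spgr J c (p + q).
Proof. by move=> hp hq b; rewrite mcoeffD; exact: SgrD. Qed.
Lemma SpgrB (J : {set 'I_d}) (c : class_group V) (p q : {mpoly K[d]}) :
  Spgr J c p -> Spgr J c q -> Spgr J c (p - q).
Proof. by move=> hp hq b; rewrite mcoeffB; exact: SgrB. Qed.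
Lemma Spgr0 (J : {set 'I_d}) (c : class_group V) : Spgr J c (0 : {mpoly K[d]}).
Proof. by move=> b; rewrite mcoeff0; exact: Sgr0. Qed.

Lemma SpgrM (J : {set 'I_d}) (c c' : class_group V) (p q : {mpoly K[d]}) :
  Spgr J c p -> Spgr J c' q -> Spgr J (c + c') (p * q).
Proof.
move=> hp hq b; rewrite (mcoeff_poly_mul _ _ (ltnSn _)).
elim/big_ind: _ => [|x y|[b1 b2] /= /eqP e]; [exact: Sgr0|exact: SgrD|].
by rewrite {1}e class_mnmD addrACA; exact: SgrM.
Qed.

Lemma SpgrZX (J : {set 'I_d}) (c : class_group V) b a :
  Sgr J (c + class_mnm V b) a -> Spgr J c (a *: 'X_[b] : {mpoly K[d]}).
Proof.
move=> h b'; rewrite mcoeffZ mcoeffX; case: eqP => [<-|_]; first by rewrite mulr1.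
by rewrite mulr0; exact: Sgr0.
Qed.

Lemma SpgrC (J : {set 'I_d}) (c : class_group V) a :
  Sgr J c a -> Spgr J c (a%:MP : {mpoly K[d]}).
Proof.
move=> h; rewrite -[a%:MP]mulr1 mul_mpolyC -mpolyX0; apply: SpgrZX.
by rewrite class_mnm0 addr0.
Qed.

Lemma Spgr_pihomog (J : {set 'I_d}) (c : class_group V) m (q : {mpoly K[d]}) :
  Spgr J c q -> Spgr J c (pihomog mdeg m q).
Proof. by move=> h b; rewrite mcoeff_pihomog; case: ifP => _; [exact: h|exact: Sgr0]. Qed.

Lemma Spgr_Sploc (J : {set 'I_d}) (c : class_group V) (q : {mpoly K[d]}) :
  Spgr J c q -> Sploc J q.
Proof. by move=> h b; exact: Sgr_Sloc (h b). Qed.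

Hypothesis pchar0 : [pchar k] =i pred0.

Lemma weyl_grE (J : {set 'I_d}) (c : class_group V) (P : weyl k J) :
  weyl_gr c P <-> Spgr J c (nf P).
Proof.
split=> [[q hq /(nf_unique pchar0)->] //|h]; exists (nf P) => //; exact: nfE.
Qed.

Lemma weyl_gr0 (J : {set 'I_d}) (c : class_group V) : weyl_gr c (0 : weyl k J).
Proof. by apply/weyl_grE; rewrite nf0 //; exact: Spgr0. Qed.

Lemma weyl_grD (J : {set 'I_d}) (c : class_group V) (P Q : weyl k J) :
  weyl_gr c P -> weyl_gr c Q -> weyl_gr c (P + Q).
Proof. by rewrite !weyl_grE nfD //; exact: SpgrD. Qed.

Lemma weyl_grB (J : {set 'I_d}) (c : class_group V) (P Q : weyl k J) :
  weyl_gr c P -> weyl_gr c Q -> weyl_gr c (P - Q).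
Proof. by rewrite !weyl_grE nfB //; exact: SpgrB. Qed.

Lemma weyl_grM (J : {set 'I_d}) (c c' : class_group V) (P Q : weyl k J) :
  weyl_gr c P -> weyl_gr c' Q -> weyl_gr (c + c') (P * Q).
Proof. by rewrite !weyl_grE nfM //; exact: Spgr_star. Qed.

Lemma weyl_gr_wmul (J : {set 'I_d}) (c : class_group V) a :
  Sgr J c a -> weyl_gr c (wmul (k := k) J a).
Proof.
by move=> h; rewrite weyl_grE nf_wmul //; [exact: SpgrC|exact: Sgr_Sloc h].
Qed.

Lemma weyl_gr_poly (J : {set 'I_d}) (c : class_group V) (f : S) :
  class_homog c f -> weyl_gr c (weyl_poly J f).
Proof. by move=> h; rewrite weyl_grE nf_poly //; apply: SpgrC; exact: Sgr_poly0. Qed.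

Lemma weyl_gr1 (J : {set 'I_d}) : weyl_gr (0 : class_group V) (1 : weyl k J).
Proof. exact: (@weyl_gr_poly J 0 1 (@class_homog1 k n d V)). Qed.

Lemma weyl_gr_pd (J : {set 'I_d}) i : weyl_gr (- class_var V i) (weyl_pd k J i).
Proof.
rewrite weyl_grE nf_pd // -[mpolyX _ _]scale1r; apply: SpgrZX.
by rewrite class_mnmU addNr -[1](rmorph1 (const d)); exact: Sgr_const.
Qed.

Lemma order_wmul (J : {set 'I_d}) a : Sloc J a -> weyl_order 0 (wmul (k := k) J a).
Proof. by move=> h; rewrite weyl_orderE // nf_wmul // msizeC; case: (a != 0). Qed.

Lemma order_poly (J : {set 'I_d}) f : weyl_order 0 (weyl_poly (k := k) J f).
Proof. by rewrite weyl_orderE // nf_poly // msizeC; case: (_ != 0). Qed.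

Lemma order_pd (J : {set 'I_d}) i : weyl_order 1 (weyl_pd k J i).
Proof. by rewrite weyl_orderE // nf_pd // msizeX mdeg1. Qed.

Lemma order_ex (J : {set 'I_d}) (P : weyl k J) : exists m, weyl_order m P.
Proof. by exists (msize (nf P)); rewrite weyl_orderE. Qed.

Lemma weyl_dec (J : {set 'I_d}) m (P : weyl k J) : weyl_order m P ->
  dec (fun c : class_group V => [set P : weyl k J | weyl_gr c P /\ weyl_order m P]) P.
Proof.
rewrite weyl_orderE // => hP.
have Q0 (c : class_group V) : [set P : weyl k J | weyl_gr c P /\ weyl_order m P] (0 : weyl k J).
  by split; [exact: weyl_gr0|exact: weyl_order0].
have QD (c : class_group V) (x y : weyl k J) : weyl_gr c x /\ weyl_order m x ->
    weyl_gr c y /\ weyl_order m y -> weyl_gr c (x + y) /\ weyl_order m (x + y).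
  by move=> [? ?] [? ?]; split; [exact: weyl_grD|exact: weyl_orderD].
have -> : P = \sum_(b <- msupp (nf P)) opn J ((nf P)@_b *: 'X_[b]).
  apply: nf_inj; rewrite (big_morph _ (nfD pchar0 (J := J)) (nf0 pchar0 J)).
  rewrite {1}[nf P]mpolyE; apply: eq_bigr => b _; rewrite opnK //.
  by apply: SplocZ; [exact: nf_loc|exact: SplocX].
apply: dec_sum => // b hb.
have [s [g [us hg e]]] := Sloc_dec (nf_loc P b).
have hop c : nf (opn J (g c *: 'X_[b])) = g c *: 'X_[b].
  by rewrite opnK //; apply: SplocZ; [exact: Sgr_Sloc (hg c)|exact: SplocX].
have -> : opn J ((nf P)@_b *: 'X_[b]) = \sum_(c <- s) opn J (g c *: 'X_[b]).
  apply: nf_inj; rewrite (big_morph _ (nfD pchar0 (J := J)) (nf0 pchar0 J)).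
  rewrite opnK //; last by apply: SplocZ; [exact: nf_loc|exact: SplocX].
  by rewrite e scaler_suml; apply: eq_bigr => c _; rewrite hop.
apply: dec_sum => // c _; apply: (@dec1 _ _ _ Q0 (c - class_mnm V b)); split.
  by rewrite weyl_grE hop; apply: SpgrZX; rewrite subrK.
rewrite weyl_orderE // hop; apply: leq_trans (msizeZ_le _ _) _.
by rewrite msizeX; apply: leq_trans hP; exact: msize_mdeg_lt.
Qed.

Lemma Sploc_clear (J : {set 'I_d}) (q : {mpoly K[d]}) : Sploc J q ->
  exists N q', (xprod k J ^+ N)%:F *: q = Sp_frac q'.
Proof.
move=> hq; have /choice[fm hfm] : forall b, exists fm : S * nat,
    q@_b = fm.1%:F / (xprod k J ^+ fm.2)%:F.
  by move=> b; have [f [m e]] := hq b; exists (f, m).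
pose N := (\sum_(b <- msupp q) (fm b).2)%N.
exists N, (\sum_(b <- msupp q) ((fm b).1 * xprod k J ^+ (N - (fm b).2)) *: 'X_[b]).
have -> : (xprod k J ^+ N)%:F *: q
    = \sum_(b <- msupp q) ((xprod k J ^+ N)%:F * q@_b) *: 'X_[b].
  by rewrite {1}[q]mpolyE scaler_sumr; apply: eq_bigr => b _; rewrite scalerA.
rewrite /Sp_frac raddf_sum big_seq [RHS]big_seq; apply: eq_bigr => b hb.
have le : ((fm b).2 <= N)%N by rewrite /N (big_rem b) //= leq_addr.
rewrite /= map_mpolyZ map_mpolyX hfm; congr (_ *: _).
rewrite [RHS]rmorphM /= -{1}(subnK le) exprD tofracM.
have aux (L : fieldType) (x y f : L) : y != 0 -> x * y * (f / y) = f * x.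
  by move=> y0; field.
exact: aux (xprodF_neq0 k J _).
Qed.

Lemma Sp_frac_Sploc (J : {set 'I_d}) q : Sploc J (Sp_frac (k := k) q : {mpoly K[d]}).
Proof. by move=> b; rewrite /Sp_frac mcoeff_map_mpoly; exact: Sloc_poly. Qed.

Lemma nf_weyl0 (Q : weyl_algebra k d) : exists q, nf Q = Sp_frac q.
Proof.
have [N [q e]] := Sploc_clear (nf_loc Q); exists q.
by move: e; rewrite /xprod big_set0 expr1n tofrac1 scale1r.
Qed.

(* Clearing denominators: x^(J N) P is a differential operator on k[x]. *)
Lemma weyl_clear (J : {set 'I_d}) (P : weyl k J) : exists N (Q : weyl_algebra k d),
  [/\ nf Q = (xprod k J ^+ N)%:F *: nf P,
      forall y, Q y = (xprod k J ^+ N)%:F * P y,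
      forall m, weyl_order m P -> weyl_order m Q &
      forall c : class_group V, weyl_gr c P -> weyl_gr (c + xdeg V J *+ N) Q].
Proof.
have [N [q e]] := Sploc_clear (nf_loc P).
exists N, (opn finset.set0 (Sp_frac q)).
have h : nf (opn finset.set0 (Sp_frac q)) = (xprod k J ^+ N)%:F *: nf P.
  by rewrite opnK ?e //; exact: Sp_frac_Sploc.
split=> //.
- by move=> y; rewrite !nfE h nopZ.
- by move=> m; rewrite !weyl_orderE // h; apply: leq_trans; exact: msizeZ_le.
move=> c; rewrite !weyl_grE h => hP b.
have : Sgr (V := V) J (c + xdeg V J *+ N + class_mnm V b) (Sp_frac q)@_b.
  rewrite -e mcoeffZ addrAC [X in Sgr _ X]addrC; apply: SgrM; last exact: hP.
  by apply: Sgr_poly0; exact: class_homog_xprod.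
by rewrite e /Sp_frac mcoeff_map_mpoly => /Sgr_poly; exact: Sgr_poly0.
Qed.

End Laurent.

(** * Evaluation of symbols *)

Section Evaluation.
Variables (k : fieldType) (d : nat).
Notation S := {mpoly k[d]}.
Notation K := {fraction {mpoly k[d]}}.
Notation "f %:F" := (@FracField.tofrac {mpoly k[d]} f).
Variables (z : 'rV[k]_d * 'rV[k]_d).

Lemma Sp_evalD p q : Sp_eval z (p + q) = Sp_eval z p + Sp_eval z q.
Proof. by rewrite /Sp_eval !raddfD. Qed.
Lemma Sp_evalM p q : Sp_eval z (p * q) = Sp_eval z p * Sp_eval z q.
Proof. by rewrite /Sp_eval !rmorphM. Qed.
Lemma Sp_eval0 : Sp_eval z 0 = 0.
Proof. by rewrite /Sp_eval !raddf0. Qed.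
Lemma Sp_evalX p N : Sp_eval z (p ^+ N) = Sp_eval z p ^+ N.
Proof. by rewrite /Sp_eval !rmorphXn. Qed.
Lemma Sp_evalZ (f : S) q : Sp_eval z (f *: q) = f.@[z.1 0] * Sp_eval z q.
Proof. by rewrite /Sp_eval map_mpolyZ mevalZ. Qed.
Lemma Sp_evalXm b : Sp_eval z 'X_[b] = \prod_i z.2 0 i ^+ b i.
Proof. by rewrite /Sp_eval map_mpolyX mevalX. Qed.

Lemma mcoeff_Sp_frac q b : (Sp_frac q : {mpoly K[d]})@_b = (q@_b)%:F.
Proof. exact: mcoeff_map_mpoly. Qed.

Lemma Sp_fracE q : Sp_frac q = map_mpoly (@FracField.tofrac {mpoly k[d]}) q.
Proof. by []. Qed.
Local Opaque Sp_frac.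

Lemma Sp_frac_inj : injective (@Sp_frac k d).
Proof.
move=> p q h; apply/mpolyP => b; apply: tofrac_inj.
by rewrite -mcoeff_Sp_frac h mcoeff_Sp_frac.
Qed.

Lemma Sp_fracZ (f : S) q : Sp_frac (f *: q) = f%:F *: Sp_frac q.
Proof. by rewrite Sp_fracE map_mpolyZ. Qed.
Lemma Sp_fracD p q : Sp_frac (p + q) = Sp_frac p + Sp_frac q :> {mpoly K[d]}.
Proof. by rewrite Sp_fracE raddfD. Qed.
Lemma Sp_fracM p q : Sp_frac (p * q) = Sp_frac p * Sp_frac q :> {mpoly K[d]}.
Proof. by rewrite Sp_fracE rmorphM. Qed.
Lemma Sp_frac_pihomog m q : Sp_frac (pihomog mdeg m q) = pihomog mdeg m (Sp_frac q) :> {mpoly K[d]}.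
Proof.
apply/mpolyP => b; rewrite [LHS]mcoeff_Sp_frac [in LHS]mcoeff_pihomog.
rewrite [RHS]mcoeff_pihomog [in RHS]mcoeff_Sp_frac.
by case: ifP => _ //; exact: tofrac0.
Qed.

Variable J : {set 'I_d}.
Notation xz := ((xprod k J).@[z.1 0]).

Lemma xprod_evalE : (xz != 0) = [forall (i | i \in J), z.1 0 i != 0].
Proof.
rewrite /xprod rmorph_prod /=; under eq_bigr do rewrite mevalXU.
apply/idP/forall_inP => [h i hi|h]; last by apply/prodf_neq0 => i hi; exact: h.
by apply: contraNneq h => e; rewrite (bigD1 i) //= e mul0r.
Qed.

(** Evaluation of S'_(x^J) at z through a chosen numerator; [spevE] shows that the choice does not
    matter when x^J does not vanish at z. *)
Definition spev (q : {mpoly K[d]}) : k :=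
  xget 0 [set v | exists q' N, Sp_frac q' = (xprod k J ^+ N)%:F *: q /\
                               v = Sp_eval z q' / xz ^+ N].

Hypothesis xz0 : xz != 0.

Lemma spevE q q' N : Sp_frac q' = (xprod k J ^+ N)%:F *: q ->
  spev q = Sp_eval z q' / xz ^+ N.
Proof.
move=> h; rewrite /spev; case: xgetP => [v _ [p [M [hp ->]]]|/(_ (Sp_eval z q' / xz ^+ N))[]]; last first.
  by exists q', N.
have e : xprod k J ^+ N *: p = xprod k J ^+ M *: q'.
  by apply: Sp_frac_inj; rewrite !Sp_fracZ hp h !scalerA mulrC.
move: (congr1 (Sp_eval z) e); rewrite !Sp_evalZ !rmorphXn /= => ee.
apply/eqP; rewrite eqr_div ?expf_neq0 //; apply/eqP.
by rewrite mulrC ee mulrC.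
Qed.

Lemma spevD p q : Sploc J p -> Sploc J q -> spev (p + q) = spev p + spev q.
Proof.
move=> /Sploc_clear[N [p' hp]] /Sploc_clear[M [q' hq]].
rewrite (spevE (esym hp)) (spevE (esym hq)).
rewrite (@spevE _ (xprod k J ^+ M *: p' + xprod k J ^+ N *: q') (N + M)%N).
  rewrite Sp_evalD !Sp_evalZ !rmorphXn /= exprD.
  by rewrite addf_div ?expf_neq0 // [_ * Sp_eval z p']mulrC [_ * Sp_eval z q']mulrC.
rewrite Sp_fracD !Sp_fracZ -hp -hq !scalerA -!tofracM scalerDr -!exprD.
by rewrite (addnC M).
Qed.

Lemma spevM p q : Sploc J p -> Sploc J q -> spev (p * q) = spev p * spev q.
Proof.
move=> /Sploc_clear[N [p' hp]] /Sploc_clear[M [q' hq]].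
rewrite (spevE (esym hp)) (spevE (esym hq)).
rewrite (@spevE _ (p' * q') (N + M)%N).
  by rewrite Sp_evalM exprD mulf_div.
rewrite Sp_fracM -hp -hq exprD tofracM -scalerAl -scalerAr scalerA.
by rewrite mulrC.
Qed.

Lemma spev_poly q : spev (Sp_frac q) = Sp_eval z q.
Proof.
rewrite (@spevE _ q 0%N) ?expr0 ?divr1 //.
by rewrite tofrac1 scale1r.
Qed.

Lemma spev0 : spev 0 = 0.
Proof.
have := spev_poly 0; rewrite Sp_eval0 => <-; congr spev.
by apply/mpolyP => b; rewrite mcoeff0 mcoeff_Sp_frac mcoeff0 tofrac0.
Qed.

Lemma spevN p : Sploc J p -> spev (- p) = - spev p.
Proof.
move=> hp; apply/eqP; rewrite -addr_eq0 -spevD ?addNr ?spev0 //.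
rewrite -scaleN1r; apply: SplocZ => //.
by exists (-1), 0%N; rewrite expr0 tofrac1 divr1 tofracN tofrac1.
Qed.

Lemma spevB p q : Sploc J p -> Sploc J q -> spev (p - q) = spev p - spev q.
Proof.
move=> hp hq; rewrite spevD ?spevN // -scaleN1r; apply: SplocZ => //.
by exists (-1), 0%N; rewrite expr0 tofrac1 divr1 tofracN tofrac1.
Qed.

Lemma spev_sum (I : Type) (s : seq I) (F : I -> {mpoly K[d]}) :
  (forall i, Sploc J (F i)) -> spev (\sum_(i <- s) F i) = \sum_(i <- s) spev (F i).
Proof.
move=> h; elim: s => [|i s IH]; first by rewrite !big_nil spev0.
rewrite !big_cons spevD ?IH //; elim: s {IH} => [|j s IH].
  by rewrite big_nil; exact: Sploc0.
by rewrite big_cons; exact: SplocD.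
Qed.

Definition lev (a : 'rV[int]_d) : k := \prod_(i < d) z.1 0 i ^ (a 0 i).

Lemma spev_lmon a b t : nonneg_off J a ->
  spev ((const d t * lmon k a) *: 'X_[b]) = t * lev a * \prod_i z.2 0 i ^+ b i.
Proof.
move=> ha; pose m := (\sum_(i < d) `|a 0%R i|)%N.
pose c : 'X_{1..d} := [multinom absz ((a + ind_row J *+ m)%R 0%R i) | i < d].
have hc : mnm_row c = a + ind_row J *+ m.
  apply/rowP => i; rewrite mxE mnmE mxE ind_rowMn.
  have le : (`|a 0%R i| <= m)%N by rewrite /m (bigD1 i) //= leq_addr.
  rewrite gez0_abs //; move: (ha i); case: (i \in J) => /= [_|/(_ isT) h]; last first.
    by rewrite addr0.
  by clearbody m; move: le; set y := a _ _; move: (y : int) => {}y le; lia.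
rewrite (@spevE _ ((t *: 'X_[c]) *: 'X_[b]) m); last first.
  rewrite Sp_fracZ Sp_fracE map_mpolyX scalerA; congr (_ *: _).
  rewrite -mul_mpolyC tofracM lmon_mnm hc lmonD xprod_lmon.
  by rewrite mulrA mulrC.
rewrite Sp_evalZ Sp_evalXm mevalZ mevalX mulrAC; congr (_ * _).
rewrite -mulrA; congr (_ * _); apply: (canLR (mulfK (expf_neq0 _ xz0))).
rewrite /xprod rmorph_prod /= -prodrXl [\prod_(i in J) _]big_mkcond /lev -[RHS]big_split /=.
apply: eq_bigr => i _.
have := congr1 (fun r : 'rV[int]_d => r 0 i) hc; rewrite mxE [RHS]mxE ind_rowMn.
rewrite /index_iota -[z.1 0 i ^+ c i]/(z.1 0 i ^ (c i)%:Z) => ->.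
case: ifP => hi; last by rewrite addr0 mulr1.
have zi : z.1 0 i != 0 by move: xz0; rewrite xprod_evalE => /forall_inP/(_ i hi).
by rewrite mevalXU expfzDr.
Qed.

Lemma spev_const t : spev (const d t)%:MP = t.
Proof.
have := @spev_lmon 0 0%MM t (fun i _ => _); rewrite lmon0 mulr1.
rewrite mpolyX0 -mul_mpolyC mulr1 => ->; last by move=> i; rewrite mxE.
rewrite /lev big1 => [|i _]; last by rewrite mxE expr0z.
by rewrite big1 ?mulr1 // => i _; rewrite mnm0E expr0.
Qed.

Hypothesis pchar0 : [pchar k] =i pred0.

Lemma wsymb_Sploc m (P : weyl k J) : Sploc J (wsymb m P).
Proof.
move=> b; rewrite /wsymb mcoeff_pihomog; case: ifP => _; first exact: nf_loc.
by have [h _ _ _] := Sloc_ring k J.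
Qed.

(** The character of gr(A_(x^J)) attached to z: the value at z of the symbol of degree m. *)
Definition chz m (P : weyl k J) : k := spev (wsymb m P).

Lemma chzD m P Q : chz m (P + Q) = chz m P + chz m Q.
Proof. by rewrite /chz wsymbD // spevD //; exact: wsymb_Sploc. Qed.
Lemma chzB m P Q : chz m (P - Q) = chz m P - chz m Q.
Proof. by rewrite /chz wsymbB // spevB //; exact: wsymb_Sploc. Qed.
Lemma chz_prev m P : fil_prev (@weyl_order k d J) m P -> chz m P = 0.
Proof. by move=> h; rewrite /chz wsymb_small // spev0. Qed.
Lemma chzM m m' P Q : weyl_order m P -> weyl_order m' Q ->
  chz (m + m') (P * Q) = chz m P * chz m' Q.
Proof. by move=> hP hQ; rewrite /chz wsymbM // spevM //; exact: wsymb_Sploc. Qed.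

Lemma chz_wmul a : Sloc J a -> chz 0 (wmul J a) = spev a%:MP.
Proof.
move=> ha; rewrite /chz /wsymb nf_wmul //; congr spev; apply/mpolyP => b.
rewrite mcoeff_pihomog mcoeffC mdeg_eq0 eq_sym; case: eqP => // _.
by rewrite mulr0.
Qed.

Lemma chz_const t : chz 0 (wmul J (const d t)) = t.
Proof. by rewrite chz_wmul ?spev_const //; exact: Sloc_poly. Qed.

Lemma chz1 : chz 0 1 = 1.
Proof.
rewrite -[RHS]chz_const; congr chz; apply: weyl_ext => y.
by rewrite wmulE ?rmorph1 ?mul1r ?weyl1E //; exact: Sloc_poly.
Qed.

Lemma weyl_filtered : filtered_ring (@weyl_order k d J).
Proof.
split.
- exact: weyl_order0.
- exact: weyl_orderB.
- by move=> m P; apply: weyl_order_le.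
- exact: order_poly.
- exact: weyl_orderM.
- exact: weyl_order_comm.
Qed.

Lemma chz_character : gr_character (@weyl_order k d J) chz.
Proof.
split.
- by move=> *; exact: chzD.
- exact: chz_prev.
- exact: chzM.
- exact: chz1.
Qed.

End Evaluation.

Lemma class_of_eq0 n d (V : 'M[int]_(d, n)) a :
  class_of V a = 0 <-> exists p : 'cV[int]_n, a = (V *m p)^T.
Proof.
have e : class_of V a = 0 <-> a \in principal V.
  have h0 : class_of V 0 = 0 by exact: raddf0.
  rewrite -{1}h0; split=> [/eqmodP|h].
    by rewrite /= Quotient.equivE subr0.
  by apply/eqmodP; rewrite /= Quotient.equivE subr0.
rewrite e; split=> [/asboolP[p ->]|[p ->]].
  by exists p; apply/rowP => i; rewrite !mxE; apply: eq_bigr => j _; rewrite !mxE.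
apply/asboolP; exists p; apply/rowP => i; rewrite !mxE.
by apply: eq_bigr => j _; rewrite !mxE.
Qed.

(* Coordinates of U_sigma: l |-> column l of W is the exponent of the l-th
   toric coordinate, and N^-1 M is a left inverse of W over the rationals whose
   rows f i, i in sigma, are the standard basis vectors. *)
Record chart_data n d (V : 'M[int]_(d, n)) (sigma : {set 'I_d}) := ChartData {
  cdW : 'M[int]_(d, n);
  cdf : 'I_d -> 'I_n;
  cdM : 'M[int]_(n, d);
  cdN : nat;
  cdN_gt0 : (0 < cdN)%N;
  cdW_sigma : forall i l, i \in sigma -> cdW i l = (cdf i == l)%:R;
  cd_principal : forall a, class_of V a = 0 <-> exists p : 'cV[int]_n, a = (cdW *m p)^T;
  cdMW : cdM *m cdW = (cdN%:Z)%:M;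
  cdM_sigma : forall i j, i \in sigma -> cdM (cdf i) j = (cdN%:Z) *+ (i == j) }.

Lemma common_denominator m n (C : 'M[rat]_(m, n)) :
  exists (N : nat) (M : 'M[int]_(m, n)), (0 < N)%N /\
    forall i j, (M i j)%:~R = N%:R * C i j.
Proof.
pose N := (\prod_(ij : 'I_m * 'I_n) `|denq (C ij.1 ij.2)|)%N.
have hN : (0 < N)%N by apply: prodn_gt0 => ij; rewrite absz_gt0 denq_neq0.
have hdiv i j : exists r : nat, N = (r * `|denq (C i j)|)%N.
  by rewrite /N (bigD1 (i, j)) //= mulnC; eexists.
have /choice[r hr] : forall ij : 'I_m * 'I_n, exists r : nat,
    N = (r * `|denq (C ij.1 ij.2)|)%N by move=> ij; exact: hdiv.
exists N, (\matrix_(i, j) ((r (i, j))%:Z * numq (C i j))); split=> // i j.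
rewrite mxE intrM {1}(hr (i, j)) /= natrM -mulrA; congr (_ * _).
rewrite -[X in _ * X]divq_num_den; have d0 := denq_neq0 (C i j).
have -> : (`|denq (C i j)|%N)%:R = (denq (C i j))%:~R :> rat.
  by rewrite -[X in _ = X%:~R]absz_denq.
by rewrite mulrC divfK // intr_eq0.
Qed.

(** By smoothness the rays of sigma are among the rows of a basis B of N. In this basis V becomes W
    = V B^-1, whose row i is a standard basis vector for i in sigma. Since the rays span, W has a
    rational left inverse; it is normalized on the rows f i, and then denominators are cleared. *)
Lemma chart_data_exists (R : realType) n d (V : 'M[int]_(d, n)) Delta sigma :
  smooth_fan R V Delta -> sigma \in Delta -> inhabited (chart_data V sigma).
Proof.
move=> sf hsigma; have [B [f [Bu finj hf]]] := fan_smooth sf hsigma.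
have full : row_full (map_mx intr V : 'M[rat]_(d, n)).
  (* The rank of an integral matrix is the same over Q and over R. *)
  have := fan_span sf; rewrite -(row_full_map (@ratr R)); congr row_full.
  by apply/matrixP => i j; rewrite !mxE /= ratr_int.
pose W := V *m invmx B.
have hW i l : i \in sigma -> W i l = (f i == l)%:R.
  move=> hi; have -> : W i l = (row i V *m invmx B) 0 l.
    by rewrite -row_mul [RHS]mxE.
  by rewrite hf // -row_mul mulmxV // !mxE.
have VW : V = W *m B by rewrite /W mulmxKV.
pose Wq : 'M[rat]_(d, n) := map_mx intr W.
have fullW : row_full Wq.
  move: full; rewrite VW map_mxM /= => h.
  apply/eqP/anti_leq; rewrite rank_leq_col /=.
  by rewrite -{1}(eqP h); exact: mxrankM_maxl.
pose C0 := pinvmx Wq; have hC0 : C0 *m Wq = 1%:M by exact: mulVpmx.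
pose g l := [pick i in sigma | f i == l].
have gP l : (exists2 i, (i \in sigma) && (f i == l) & g l = Some i) \/ g l = None.
  by rewrite /g; case: pickP => [i hi|_]; [left; exists i|right].
have gf i : i \in sigma -> g (f i) = Some i.
  rewrite /g => hi; case: pickP => [i' /andP[hi' /eqP fi']|/(_ i)].
    by congr Some; exact: finj.
  by rewrite hi eqxx.
(* Row f i of the left inverse may be replaced by the i-th coordinate form: applied to W it gives
   row i of W, which is already the required row of the identity. *)
pose C : 'M[rat]_(n, d) := \matrix_(l, j)
  if g l is Some i then (i == j)%:R else C0 l j.
have hC : C *m Wq = 1%:M.
  apply/matrixP => l l'; rewrite mxE [RHS]mxE.
  have [[i /andP[hi /eqP fi] gl]|gl] := gP l.
    rewrite (bigD1 i) //= big1 => [|j ji].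
      by rewrite mxE gl eqxx mul1r addr0 mxE hW // fi; case: eqP.
    by rewrite mxE gl eq_sym (negPf ji) mul0r.
  have := congr1 (fun X : 'M_n => X l l') hC0; rewrite mxE [RHS]mxE => <-.
  by apply: eq_bigr => j _; rewrite mxE gl.
have [N [M [N0 hM]]] := common_denominator C.
constructor; exists W f M N => //.
- move=> a; rewrite class_of_eq0; split=> [[p ->]|[p ->]].
    by exists (B *m p); rewrite mulmxA -VW.
  by exists (invmx B *m p); rewrite mulmxA.
- apply/matrixP => l l'; apply: (@intr_inj rat); rewrite !mxE rmorph_sum /=.
  have := congr1 (fun X : 'M_n => X l l') hC; rewrite !mxE => h.
  have -> : \sum_j (M l j * W j l')%:~R = N%:R * \sum_j C l j * Wq j l'.
    rewrite mulr_sumr; apply: eq_bigr => j _.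
    by rewrite intrM hM mulrA [Wq _ _]mxE.
  by rewrite h; case: eqP => _; rewrite ?mulr1 ?mulr0 ?mulr1n ?mulr0n.
move=> i j hi; apply: (@intr_inj rat); rewrite hM mxE gf //.
by case: eqP => _; rewrite ?mulr1 ?mulr0 ?mulr1n ?mulr0n.
Qed.

Lemma mx_mulz m n (A : 'M[int]_(m, n)) (z : int) i j : (A *~ z) i j = A i j * z.
Proof.
case: z => r; first by rewrite -pmulrn mulmxnE pmulrn mulrzz.
by rewrite NegzE mulrNz mxE -pmulrn mulmxnE pmulrn mulrzz mulrN.
Qed.

(** * Toric coordinates and differential operators on a chart *)

Section ChartOperators.
Variables (k : fieldType) (n d : nat) (V : 'M[int]_(d, n)) (sigma : {set 'I_d}).
Hypothesis pchar0 : [pchar k] =i pred0.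
Variable cd : chart_data V sigma.
Notation S := {mpoly k[d]}.
Notation K := {fraction {mpoly k[d]}}.
Notation "f %:F" := (@FracField.tofrac {mpoly k[d]} f).
Notation der := (@der k d).
Local Opaque Defs.der.
Notation J := (~: sigma)%SET.
Notation W := (cdW cd).
Notation f := (cdf cd).
Notation M := (cdM cd).
Notation N := (cdN cd).
Notation lmon := (@lmon k d).
Notation const := (@const k d).

Lemma natr_neq0 m : (0 < m)%N -> m%:R != 0 :> k.
Proof. by move=> h; move/pcharf0P: pchar0 => ->; rewrite -lt0n. Qed.

Lemma weyl_sumE (J' : {set 'I_d}) (I : Type) (s : seq I) (P : I -> weyl k J') y :
  (\sum_(i <- s) P i) y = \sum_(i <- s) P i y.
Proof. by elim: s => [|i s IH]; rewrite ?big_nil // !big_cons weylDE IH. Qed.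

Lemma nonneg_offP a : nonneg_off J a <-> forall i, i \in sigma -> 0 <= a 0 i.
Proof. by split=> h i hi; apply: h; move: hi; rewrite finset.in_setC negbK. Qed.

Definition al (l : 'I_n) : 'rV[int]_d := \row_j W j l.
Definition yl (l : 'I_n) : K := lmon (al l).
Definition cf (l : 'I_n) (j : 'I_d) : k := (M l j)%:~R / N%:R.

Lemma al_principal l : class_of V (al l) = 0.
Proof.
apply/(cd_principal cd); exists (delta_mx l 0); apply/rowP => j.
by rewrite -colE !mxE.
Qed.

Lemma al_sigma i l : i \in sigma -> al l 0 i = (f i == l)%:R.
Proof. by move=> hi; rewrite mxE (cdW_sigma cd). Qed.

Lemma al_nonneg l : nonneg_off J (al l).
Proof. by apply/nonneg_offP => i hi; rewrite al_sigma //; case: eqP. Qed.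

Lemma cdf_inj : {in sigma &, injective f}.
Proof.
move=> i i' hi hi' e; have := cdM_sigma cd i' hi; rewrite e (cdM_sigma cd) // eqxx.
by case: eqP => // _; have := cdN_gt0 cd; case: N.
Qed.

(** A pole along x_i with i in sigma could occur only for l = f i. Then the normalization of row f i
    of M makes the coefficient zero unless j = i, where x_j cancels the pole. *)
Lemma dt_coef_Sgr l j :
  Sgr J (class_var V j) (const (cf l j) * lmon (delta_mx 0 j - al l)).
Proof.
have [M0|M0] := eqVneq (M l j) 0; first by rewrite /cf M0 mul0r rmorph0 mul0r; exact: Sgr0.
apply: SgrZ; rewrite /class_var -[class_of V _]subr0 -(al_principal l) -raddfB.
apply: lmon_Sgr; apply/nonneg_offP => i hi; rewrite mxE [X in _ + X]mxE al_sigma //.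
rewrite mxE eqxx /=; case: (f i =P l) => [e|_]; last by rewrite subr0.
move: M0; rewrite -e (cdM_sigma cd) //; have [_|_] := eqVneq i j; first by rewrite subrr.
by rewrite mulr0n eqxx.
Qed.

(** The derivation y_l^-1 sum_j (M_lj / N) x_j d_j. It multiplies x^b by (N^-1 M b)_l / y_l, so M W
    = N makes it dual to the coordinates y_l. *)
Definition dtop (l : 'I_n) : weyl k J :=
  \sum_j wmul J (const (cf l j) * lmon (delta_mx 0 j - al l)) * weyl_pd k J j.

Definition dt (l : 'I_n) (y : K) : K := dtop l y.

Lemma dtE l y : dt l y = \sum_j const (cf l j) * lmon (delta_mx 0 j - al l) * der j y.
Proof.
rewrite /dt weyl_sumE; apply: eq_bigr => j _.
by rewrite weylME wmulE //; exact: Sgr_Sloc (dt_coef_Sgr l j).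
Qed.

Lemma dtD l x y : dt l (x + y) = dt l x + dt l y.
Proof. by rewrite !dtE -big_split; apply: eq_bigr => j _; rewrite derD mulrDr. Qed.

Lemma dtM l x y : dt l (x * y) = dt l x * y + x * dt l y.
Proof.
rewrite !dtE mulr_suml mulr_sumr -big_split; apply: eq_bigr => j _ /=.
by rewrite derM mulrDr mulrA [x * (_ * der j y)]mulrCA.
Qed.

Lemma dt_const l t : dt l (const t) = 0.
Proof. by rewrite dtE big1 // => j _; rewrite der_const mulr0. Qed.

Lemma dtZ l t y : dt l (const t * y) = const t * dt l y.
Proof. by rewrite dtM dt_const mul0r add0r. Qed.

Lemma dt0 l : dt l 0 = 0.
Proof. by rewrite -(rmorph0 (const)) dt_const. Qed.

Definition pair (l : 'I_n) (b : 'rV[int]_d) : k := \sum_j cf l j * (b 0 j)%:~R.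

Lemma pairB l a b : pair l (a - b) = pair l a - pair l b.
Proof.
rewrite /pair -sumrB; apply: eq_bigr => j _.
by rewrite mxE [X in _ + X]mxE rmorphB mulrBr.
Qed.

Lemma pair_al l l' : pair l (al l') = (l == l')%:R.
Proof.
have hN := natr_neq0 (cdN_gt0 cd).
have := congr1 (fun X : 'M_n => X l l') (cdMW cd); rewrite !mxE => /(congr1 (fun z : int => z%:~R : k)).
rewrite rmorph_sum /= => h; apply: (mulfI hN).
rewrite mulr_sumr; transitivity (\sum_j ((M l j * W j l')%:~R : k)).
  apply: eq_bigr => j _; rewrite mxE rmorphM /cf mulrA; congr (_ * _).
  by rewrite mulrC divfK.
by rewrite h; case: eqP => _; rewrite ?mulr1 ?mulr0 ?mulr1n ?mulr0n.
Qed.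

Lemma dt_lmon l b : dt l (lmon b) = const (pair l b) * lmon (b - al l).
Proof.
rewrite dtE /pair rmorph_sum mulr_suml; apply: eq_bigr => j _ /=.
rewrite der_lmon mulrACA -lmonD [in RHS]rmorphM (rmorph_int const).
by rewrite [in lmon (_ + _)]addrC addrA subrK.
Qed.

Lemma dt_coord l l' : dt l (yl l') = (l == l')%:R.
Proof.
rewrite dt_lmon pair_al; case: eqP => [->|_]; last by rewrite rmorph0 mul0r.
by rewrite rmorph1 mul1r subrr lmon0.
Qed.

Lemma derivation_sum (D : K -> K) (DD : forall x y, D (x + y) = D x + D y)
  (D0 : D 0 = 0) (I : Type) (s : seq I) (F : I -> K) :
  D (\sum_(i <- s) F i) = \sum_(i <- s) D (F i).
Proof. by elim: s => [|i s IH]; rewrite ?big_nil // !big_cons DD IH. Qed.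

Lemma tofrac_mpolyE (g : S) : g%:F = \sum_(b <- msupp g) const g@_b * lmon (mnm_row b).
Proof.
rewrite {1}[g]mpolyE rmorph_sum; apply: eq_bigr => b _.
by rewrite /= -mul_mpolyC tofracM lmon_mnm.
Qed.

(** Reduced from fractions to polynomials by [derivation_comm_frac], and then to monomials x^b,
    which both composites send to multiples of x^b / (y_l y_l'). *)
Lemma dt_comm l l' y : dt l (dt l' y) = dt l' (dt l y).
Proof.
have comm_lmon b : dt l (dt l' (lmon b)) = dt l' (dt l (lmon b)).
  rewrite !dt_lmon !dtZ !dt_lmon !mulrA -!rmorphM !pairB !pair_al eq_sym.
  rewrite addrAC; congr (const _ * _).
  case: eqP => [->|_]; first by rewrite mulrC.
  by rewrite !subr0 mulrC.
have comm_poly (g : S) : dt l (dt l' g%:F) = dt l' (dt l g%:F).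
  rewrite tofrac_mpolyE.
  rewrite !(derivation_sum (@dtD _) (dt0 _)); apply: eq_bigr => b _.
  by rewrite !dtZ comm_lmon.
have [g [h [h0 e]]] := frac_ex y.
have hF : h%:F != 0 :> K by rewrite tofrac_eq0.
exact: (derivation_comm_frac (@dtD l) (@dtD l') (@dtM l) (@dtM l') hF e
  (comm_poly g) (comm_poly h)).
Qed.

Lemma dtop_gr l : weyl_gr (0 : class_group V) (dtop l).
Proof.
rewrite /dtop; elim/big_ind: _ => [|P Q|j _]; [exact: weyl_gr0|exact: weyl_grD|].
rewrite -(subrr (class_var V j)); apply: weyl_grM => //; last exact: weyl_gr_pd.
by apply: weyl_gr_wmul => //; exact: dt_coef_Sgr.
Qed.

Lemma dtop_order l : weyl_order 1 (dtop l).
Proof.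
rewrite /dtop; elim/big_ind: _ => [|P Q|j _]; [exact: weyl_order0|exact: weyl_orderD|].
apply: (weyl_orderM pchar0 (m := 0) (m' := 1)); last exact: order_pd.
by apply: order_wmul => //; exact: Sgr_Sloc (dt_coef_Sgr l j).
Qed.

(* Every class has a monomial in the x_j, j outside sigma, which are units on U_sigma. *)
Lemma unit_mon (c : class_group V) : exists m : 'rV[int]_d,
  class_of V m = c /\ forall i, i \in sigma -> m 0 i = 0.
Proof.
have [a ->] : exists a, c = class_of V a by exists (repr c); rewrite /class_of reprK.
(* On sigma, [al (f i)] is the i-th unit vector, and its class is zero; subtracting clears the
   exponents on sigma within the class. *)
exists (a - \sum_(i in sigma) al (f i) *~ a 0 i); split.
  rewrite raddfB raddf_sum /= big1 ?subr0 // => i _.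
  by rewrite raddfMz /= al_principal mul0rz.
move=> i hi; rewrite mxE [X in _ + X]mxE summxE (bigD1 i) //= big1 => [|j /andP[hj ji]].
  by rewrite addr0 mx_mulz al_sigma // eqxx mul1r subrr.
rewrite mx_mulz al_sigma //; case: eqP => [e|_]; last by rewrite mul0r.
by rewrite (cdf_inj hi hj e) eqxx in ji.
Qed.

Lemma nop_Sgr (c c' : class_group V) (q : {mpoly K[d]}) y :
  Spgr J c q -> Sgr J c' y -> Sgr J (c + c') (nop der q y).
Proof.
move=> hq hy; rewrite /nop; elim/big_ind: _ => [|u v|b _]; [exact: Sgr0|exact: SgrD|].
have -> : c + c' = (c + class_mnm V b) + (c' - class_mnm V b) by rewrite addrACA subrr addr0.
apply: SgrM; first exact: hq.
elim/mnm_ind: b => [|i b IH].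
  by rewrite mnm_iter0 class_mnm0 subr0.
rewrite mnm_iterUD; last exact: derC.
by rewrite class_mnmD class_mnmU opprD addrA addrAC; exact: Sgr_der.
Qed.

Lemma weyl_gr_Sgr (c c' : class_group V) (P : weyl k J) y :
  weyl_gr c P -> Sgr J c' y -> Sgr J (c + c') (P y).
Proof. by move=> /weyl_grE-/(_ pchar0) hP hy; rewrite nfE; exact: nop_Sgr. Qed.

Lemma yl_Sgr l : Sgr J (0 : class_group V) (yl l).
Proof. by rewrite -(al_principal l); apply: lmon_Sgr; exact: al_nonneg. Qed.

Definition dtmon (b : 'X_{1..n}) : weyl k J := mnm_iter (fun l P => dtop l * P) b 1.

Lemma dtmonE b y : dtmon b y = mnm_iter dt b y.
Proof.
have comm i j (P : weyl k J) : dtop i * (dtop j * P) = dtop j * (dtop i * P).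
  by apply: weyl_ext => u; rewrite !weylME; exact: dt_comm.
rewrite /dtmon; elim/mnm_ind: b => [|i b IH]; first by rewrite !mnm_iter0 weyl1E.
by rewrite !mnm_iterUD ?weylME -?IH //; exact: dt_comm.
Qed.

Lemma dtmon_gr_order b : weyl_gr (0 : class_group V) (dtmon b) /\ weyl_order (mdeg b) (dtmon b).
Proof.
have comm i j (P : weyl k J) : dtop i * (dtop j * P) = dtop j * (dtop i * P).
  by apply: weyl_ext => u; rewrite !weylME; exact: dt_comm.
rewrite /dtmon; elim/mnm_ind: b => [|i b [IH1 IH2]].
  rewrite mnm_iter0 mdeg0; split; [exact: weyl_gr1|].
  exact: (@order_poly k d pchar0 J 1).
rewrite mnm_iterUD // mdegD mdeg1; split.
  by rewrite -[0]addr0; apply: weyl_grM => //; exact: dtop_gr.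
by apply: weyl_orderM => //; exact: dtop_order.
Qed.

Definition in_chart (A : {mpoly K[n]}) := forall b, Sgr J (0 : class_group V) A@_b.

Definition dtnop (A : {mpoly K[n]}) : weyl k J :=
  \sum_(b <- msupp A) wmul J A@_b * dtmon b.

Lemma dtnopE A y : in_chart A -> dtnop A y = nop dt A y.
Proof.
move=> hA; rewrite /dtnop weyl_sumE; apply: eq_bigr => b _.
by rewrite weylME wmulE ?dtmonE //; exact: Sgr_Sloc (hA b).
Qed.

Lemma dtnop_gr A : in_chart A -> weyl_gr (0 : class_group V) (dtnop A).
Proof.
move=> hA; rewrite /dtnop; elim/big_ind: _ => [|P Q|b _]; [exact: weyl_gr0|exact: weyl_grD|].
rewrite -[0]addr0; apply: weyl_grM => //; last by have [] := dtmon_gr_order b.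
by apply: weyl_gr_wmul => //; exact: hA.
Qed.

Lemma dtnop_order A m : in_chart A -> (msize A <= m.+1)%N -> weyl_order m (dtnop A).
Proof.
move=> hA hm; rewrite /dtnop big_seq.
elim/big_ind: _ => [|P Q|b hb]; [exact: weyl_order0|exact: weyl_orderD|].
apply: (@weyl_order_le _ _ pchar0 _ (0 + mdeg b)).
  by rewrite add0n -ltnS; apply: leq_trans (msize_mdeg_lt hb) hm.
apply: weyl_orderM => //; last by have [] := dtmon_gr_order b.
by apply: order_wmul => //; exact: Sgr_Sloc (hA b).
Qed.

Notation cev := (cev const yl).

Lemma cev_Sgr g : Sgr J (0 : class_group V) (cev g).
Proof.
elim/mpolyind: g => [|c b g _ _ IH]; first by rewrite cev0; exact: Sgr0.
rewrite cevD cevZ; apply: SgrD => //; apply: SgrZ.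
elim/mnm_ind: b => [|i b IHb].
  by rewrite mpolyX0 cev1 -(rmorph1 const); exact: Sgr_const.
rewrite mpolyXD cevM cevU -[0]addr0; apply: SgrM => //; exact: yl_Sgr.
Qed.

(** Uniqueness of the normal form in the [dt l]: the argument that gave it for the d_i, now with the
    coordinates y_l. *)
Lemma in_chart_eq0 A w : in_chart A -> (forall g, (msize g <= w)%N -> nop dt A (cev g) = 0) ->
  (msize A <= w)%N -> A = 0.
Proof.
by move=> _; apply: (nop_eq0 dtD dtM dt_comm dt_const dt_coord pchar0).
Qed.

(* Elements of the coordinate ring are polynomials in the y_l up to monomial
   denominators. *)
Lemma chart_denom y : Sgr J (0 : class_group V) y ->
  exists b g, cev 'X_[b] * y = cev g.
Proof.
have prod_y b : cev 'X_[b] = lmon (\sum_l al l *+ b l).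
  elim/mnm_ind: b => [|i b IH].
    by rewrite mpolyX0 cev1 big1 ?lmon0 // => l _; rewrite mnm0E.
  rewrite mpolyXD cevM cevU IH /yl -lmonD; congr lmon.
  under [RHS]eq_bigr do rewrite mnmDE mulrnDr.
  rewrite big_split /=; congr (_ + _); rewrite (bigD1 i) //= mnm1E eqxx big1 ?addr0 // => l li.
  by rewrite mnm1E eq_sym (negPf li).
apply: (Sgr_ind (P := fun y => exists b g, cev 'X_[b] * y = cev g)).
- by exists 0%MM, 0; rewrite mulr0 cev0.
- move=> u v [b [g e]] [b' [g' e']]; exists (b + b')%MM, ('X_[b'] * g + 'X_[b] * g').
  by rewrite mpolyXD cevM cevD !cevM mulrDr -e -e' !mulrA [cev 'X_[b'] * _]mulrC.
move=> a t ha /(cd_principal cd)[p ap].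
have aE : a = \sum_l al l *~ p l 0.
  rewrite ap; apply/rowP => j; rewrite !mxE summxE; apply: eq_bigr => l _.
  by rewrite mx_mulz mxE.
(* The denominator prod y_l^|p_l| makes all exponents |p_l| + p_l nonnegative. *)
exists [multinom absz (p l 0%R) | l < n],
  (t *: 'X_[[multinom absz (`|p l 0%R| + p l 0%R)%R | l < n]]).
rewrite cevZ !prod_y mulrCA -lmonD aE; congr (_ * lmon _).
rewrite -big_split; apply: eq_bigr => l _ /=; rewrite !mnmE.
rewrite !pmulrn -mulrzDr; congr (_ *~ _).
by move: (p l 0) => z; lia.
Qed.

End ChartOperators.

(** * Grothendieck differential operators on U_sigma and their lifts *)

Section ChartDiffOps.
Variables (k : fieldType) (n d : nat) (V : 'M[int]_(d, n)) (sigma : {set 'I_d}).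
Hypothesis pchar0 : [pchar k] =i pred0.
Notation K := {fraction {mpoly k[d]}}.
Notation der := (@der k d).
Local Opaque Defs.der.
Notation J := (~: sigma)%SET.
Notation R0 := (chart_ring k V sigma).
Notation const := (@const k d).

Lemma chart_valP (r : R0) : Sgr J (0 : class_group V) (val r).
Proof. by apply/asboolP; exact: (valP r). Qed.

Definition mkchart (y : K) (h : Sgr J (0 : class_group V) y) : R0 :=
  @ChartRing k n d V sigma y (introT (asboolP _) h).

Lemma chart_valD (r s : R0) : val (r + s) = val r + val s. Proof. by []. Qed.
Lemma chart_valN (r : R0) : val (- r) = - val r. Proof. by []. Qed.
Lemma chart_valM (r s : R0) : val (r * s) = val r * val s. Proof. by []. Qed.
Lemma chart_val0 : val (0 : R0) = 0. Proof. by []. Qed.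
Lemma chart_phi_ex (P : weyl k J) : weyl_gr (0 : class_group V) P ->
  exists D : R0 -> R0, chart_phi P D.
Proof.
move=> hP.
have h (r : R0) : Sgr J (0 : class_group V) (P (val r)).
  by rewrite -[0]addr0; apply: weyl_gr_Sgr => //; exact: chart_valP.
by exists (fun r => mkchart (h r)).
Qed.

Lemma order0_wmul (P : weyl k J) : weyl_order 0 P ->
  forall y, P y = (nf P)@_0%MM * y.
Proof.
by move=> /weyl_orderE-/(_ pchar0)/msize1_polyC e y; rewrite nfE {1}e nopC.
Qed.

(** Commutators with functions lower the order in the Weyl algebra, which is the recursion defining
    [diff_order]; operators of order 0 are multiplications. *)
Lemma chart_phi_order m (P : weyl k J) (D : R0 -> R0) :
  chart_phi P D -> weyl_order m P -> diff_order m D.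
Proof.
elim: m P D => [|m IH] P D [hP PD] oP.
  move=> r s; apply: val_inj; rewrite chart_valD chart_valN chart_valM -!PD.
  by rewrite chart_valM !order0_wmul // mulrCA subrr.
move=> r; pose a := wmul J (val r).
have ha : Sgr J (0 : class_group V) (val r) by exact: chart_valP.
apply: (IH (P * a - a * P)).
  split=> [|s].
    by apply: weyl_grB => //; rewrite -[0]addr0; apply: weyl_grM => //; exact: weyl_gr_wmul.
  rewrite weylDE weylNE !weylME /a !wmulE //; try exact: Sgr_Sloc ha.
  by rewrite chart_valD chart_valN chart_valM -!PD.
have oa : weyl_order 0 a by apply: order_wmul => //; exact: Sgr_Sloc ha.
by have := weyl_order_comm pchar0 oP oa; rewrite addn0.
Qed.

Lemma chart_phi_diff m (P : weyl k J) (D : R0 -> R0) :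
  chart_phi P D -> weyl_order m P -> chart_diff m D.
Proof.
move=> PD oP; split; last exact: chart_phi_order oP.
  move=> s t; apply: val_inj; rewrite chart_valD; case: PD => _ PD.
  by rewrite -!PD chart_valD (weyl_opD (weylP P)).
move=> a s; apply: val_inj; rewrite chart_valM; case: PD => _ PD.
rewrite -!PD chart_valM /= -/(const a) !nfE /nop mulr_sumr; apply: eq_bigr => b _.
rewrite mulrCA; congr (_ * _); elim/mnm_ind: b => [|i b IH]; first by rewrite !mnm_iter0.
by rewrite !(mnm_iterUD (@derC k d)) IH derM der_const mul0r add0r.
Qed.

Variable cd : chart_data V sigma.
Notation yl := (yl k cd).
Notation cev := (cev const yl).
Notation dt := (@dt k n d V sigma cd).
Let tD := dtD pchar0 cd.
Let tM := dtM pchar0 cd.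
Let tC := dt_comm pchar0 cd.
Let tconst := dt_const pchar0 cd.
Let tcoord := dt_coord pchar0 cd.
Notation in_chart := (@in_chart k n d V sigma).

Definition gev (g : {mpoly k[n]}) : R0 := mkchart (cev_Sgr cd g).

Lemma gevE g : val (gev g) = cev g. Proof. by []. Qed.

Lemma gevM g h : gev (g * h) = gev g * gev h.
Proof. by apply: val_inj; rewrite chart_valM !gevE cevM. Qed.
Lemma gevD g h : gev (g + h) = gev g + gev h.
Proof. by apply: val_inj; rewrite chart_valD !gevE cevD. Qed.
Lemma gevZ c h : gev (c *: h) = chart_const V sigma c * gev h.
Proof. by apply: val_inj; rewrite chart_valM !gevE cevZ. Qed.
Lemma gev1 : gev 1 = 1.
Proof. by apply: val_inj; rewrite gevE cev1. Qed.
Lemma gev0 : gev 0 = 0.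
Proof. by apply: val_inj; rewrite gevE cev0. Qed.

Lemma diff_op0 m (D : R0 -> R0) : chart_diff m D -> D 0 = 0.
Proof. by case=> hD _ _; apply: (addrI (D 0)); rewrite -hD !addr0. Qed.

Lemma diff_op_bracket m (D : R0 -> R0) r :
  chart_diff m.+1 D -> chart_diff m (fun s => D (r * s) - r * D s).
Proof.
move=> [hD hc ho]; split; last exact: ho.
  by move=> s t; rewrite mulrDr !hD mulrDr opprD addrACA.
by move=> a s; rewrite mulrCA !hc [r * (_ * _)]mulrCA mulrBr.
Qed.

Lemma diff_orderB m (D E : R0 -> R0) :
  diff_order m D -> diff_order m E -> diff_order m (fun s => D s - E s).
Proof.
elim: m D E => [|m IH] D E hD hE /=.
  by move=> r s; rewrite mulrBr opprD addrACA -opprD hE hD subrr.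
move=> r; have := IH _ _ (hD r) (hE r); congr diff_order; apply/funext => s.
by rewrite mulrBr !opprD !opprK addrACA [_ + r * E s]addrC.
Qed.

Lemma chart_diffB m (D E : R0 -> R0) :
  chart_diff m D -> chart_diff m E -> chart_diff m (fun s => D s - E s).
Proof.
move=> [hD hc ho] [hD' hc' ho']; split; last exact: diff_orderB.
  by move=> s t; rewrite hD hD' opprD addrACA.
by move=> a s; rewrite hc hc' mulrBr.
Qed.

(** Such a D is k[y]-linear and kills 1, hence kills k[y]. Any r satisfies y^b r in k[y] for some b,
    and y^b can be cancelled. *)
Lemma linear_commuting_eq0 m (D : R0 -> R0) : chart_diff m D ->
  (forall i s, D (gev 'X_i * s) = gev 'X_i * D s) -> D 1 = 0 -> forall r, D r = 0.
Proof.
move=> hD hcomm D1 r; have [hDD hDc _] := hD.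
have hX b s : D (gev 'X_[b] * s) = gev 'X_[b] * D s.
  elim/mnm_ind: b => [|i b IHb]; first by rewrite mpolyX0 gev1 !mul1r.
  by rewrite mpolyXD gevM -!mulrA hcomm IHb.
have hg g : D (gev g) = 0.
  elim/mpolyind: g => [|c b g _ _ IHg]; first by rewrite gev0 (diff_op0 hD).
  by rewrite gevD hDD IHg gevZ hDc -[gev 'X_[b]]mulr1 hX D1 !mulr0 addr0.
have [b [g e]] := chart_denom cd (chart_valP r).
have er : gev 'X_[b] * r = gev g by apply: val_inj; rewrite chart_valM !gevE.
have := hX b r; rewrite er hg => /(congr1 val); rewrite chart_valM gevE chart_val0.
move/esym/eqP; rewrite mulf_eq0 => /orP[/eqP X0|/eqP h]; last by apply: val_inj.
(* y^b is nonzero because its b-th derivative in the [dt l] is the nonzero constant b!. *)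
have := mnm_iter_cev tD tM tC tconst tcoord b 'X_[b]; rewrite X0.
have -> : mnm_iter dt b 0 = 0.
  elim/mnm_ind: (b) => [|i c IHb]; first by rewrite mnm_iter0.
  by rewrite (mnm_iterUD tC) IHb dt0.
rewrite mderivmX cevZ sub_mm mpolyX0 cev1 mulr1 => /esym/eqP; rewrite fmorph_eq0.
rewrite (negPf (natr_neq0 pchar0 _)) // prodn_gt0 // => i; by rewrite ffactnn fact_gt0.
Qed.

(** The brackets of D with the y_i have lower order and vanish on polynomials of degree one less,
    hence are zero by induction; so D is k[y]-linear. *)
Lemma diff_op_vanish m (D : R0 -> R0) : chart_diff m D ->
  (forall g, (msize g <= m.+1)%N -> D (gev g) = 0) -> forall r, D r = 0.
Proof.
elim: m D => [|m IH] D hD hv; apply: (linear_commuting_eq0 hD) => [i s|].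
- by apply/eqP; rewrite -subr_eq0; apply/eqP; case: hD => _ _; exact.
- by rewrite -gev1 hv // msize1.
- apply/eqP; rewrite -subr_eq0; apply/eqP.
  apply: (IH _ (diff_op_bracket (gev 'X_i) hD)) => g hg.
  rewrite -gevM !hv ?mulr0 ?subr0 //; first exact: leq_trans hg _.
  exact: msizeUM.
- by rewrite -gev1 hv // msize1.
Qed.

Lemma nop_dtZ A c y : nop dt A (const c * y) = const c * nop dt A y.
Proof.
rewrite /nop mulr_sumr; apply: eq_bigr => b _; rewrite mulrCA; congr (_ * _).
elim/mnm_ind: b => [|i b IHc]; first by rewrite !mnm_iter0.
by rewrite !(mnm_iterUD tC) IHc dtZ.
Qed.

Lemma nop_dt0 A : nop dt A 0 = 0.
Proof. by have := nop_dtZ A 0 0; rewrite rmorph0 !mul0r. Qed.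

(** A is homogeneous of degree j with coefficients D(y^b) / b!. On y^b with |b| = j only the term of
    index b survives, and for |b| < j both sides vanish. *)
Lemma chart_lift_step m j (D : R0 -> R0) : (j <= m)%N -> chart_diff m D ->
  (forall g, (msize g <= j)%N -> D (gev g) = 0) ->
  exists A, [/\ in_chart A, (msize A <= j.+1)%N &
    forall g, (msize g <= j.+1)%N -> val (D (gev g)) = nop dt A (cev g)].
Proof.
move=> jm hD hv; have [hDD hDc _] := hD.
pose fb (b : 'X_{1..n}) := (\prod_(i < n) b i ^_ b i)%N.
have fb0 b : (fb b)%:R != 0 :> k.
  by apply: natr_neq0 => //; apply: prodn_gt0 => i; rewrite ffactnn fact_gt0.
pose co (b : 'X_{1..n}) : K := if mdeg b == j then const (fb b)%:R^-1 * val (D (gev 'X_[b])) else 0.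
pose A : {mpoly K[n]} := \sum_(b : 'X_{1..n < j.+1}) co b *: 'X_[b].
have Ac b : A@_b = co b.
  rewrite /A raddf_sum /=; under eq_bigr do rewrite mcoeffZ mcoeffX.
  have [hb|hb] := ltnP (mdeg b) j.+1.
    rewrite (bigD1 (BMultinom hb)) //= eqxx mulr1 big1 ?addr0 // => c cb.
    case: eqP => [e|_]; last by rewrite mulr0.
    by case/eqP: cb; apply: val_inj.
  rewrite big1 => [|c _]; first by rewrite /co; case: eqP => // e; rewrite e ltnn in hb.
  case: eqP => [e|_]; last by rewrite mulr0.
  by have := bmdeg c; rewrite e ltnNge hb.
have mA : (msize A <= j.+1)%N.
  apply: msize_leP => b hb; rewrite Ac /co; case: eqP => // e.
  by rewrite e ltnn in hb.
exists A; split=> // [b|g hg].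
  rewrite Ac /co; case: ifP => _; last exact: Sgr0.
  by apply: SgrZ; exact: chart_valP.
have key b : (mdeg b <= j)%N -> val (D (gev 'X_[b])) = nop dt A (cev 'X_[b]).
  move=> hb; rewrite (nop_msum dt A _) (msumE _ mA).
  have hcev c : mnm_iter dt c (cev 'X_[b]) =
      const (\prod_(i < n) (b i)^_(c i))%:R * cev 'X_[b - c].
    by rewrite (mnm_iter_cev tD tM tC tconst tcoord) mderivmX cevZ.
  have zero (c : 'X_{1..n}) : mdeg c = j -> c != b -> (\prod_(i < n) (b i)^_(c i))%N = 0%N.
    move=> hc cb; suff [i hi] : exists i, (b i < c i)%N.
      by rewrite (bigD1 i) //= ffact_small.
    apply/existsP; apply: contraNT cb => /existsPn hle.
    have le : (c <= b)%MM by apply/mnm_lepP => i; rewrite leqNgt.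
    have e : mdeg (b - c) = 0%N.
      by move: hb; rewrite -{1}(submK le) mdegD hc; lia.
    by rewrite -(submK le); move/eqP: e; rewrite mdeg_eq0 => /eqP->; rewrite add0m.
  have [hbj|hbj] := eqVneq (mdeg b) j; last first.
    rewrite hv; last by rewrite msizeX ltn_neqAle hbj.
    rewrite big1 // => c _; rewrite Ac /co; case: eqP => hc; last by rewrite scale0r.
    rewrite hcev zero ?rmorph0 ?mul0r ?scaler0 //.
    by apply: contraNneq hbj => <-; apply/eqP.
  have hb' : (mdeg b < j.+1)%N by rewrite hbj.
  rewrite (bigD1 (BMultinom hb')) //= big1 ?addr0 => [|c cb].
    rewrite Ac /co hbj eqxx hcev sub_mm mpolyX0 cev1 mulr1 -/(fb b).
    rewrite -[_ *: _]/(_ * _) mulrAC -rmorphM mulVf // rmorph1 mul1r //.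
  rewrite Ac /co; case: eqP => hc; last by rewrite scale0r.
  rewrite hcev zero ?rmorph0 ?mul0r ?scaler0 //.
have {hg} : {in msupp g, forall b, (mdeg b <= j)%N}.
  by move=> b hb; rewrite -ltnS; apply: leq_trans (msize_mdeg_lt hb) hg.
rewrite [g in gev g]mpolyE [g in cev g]mpolyE.
elim: (msupp g) => [|b s IH] hs.
  by rewrite !big_nil gev0 cev0 (diff_op0 hD) nop_dt0.
rewrite !big_cons gevD cevD hDD chart_valD (nop_additive tD tC).
rewrite IH => [|c hc]; last by apply: hs; rewrite inE hc orbT.
congr (_ + _); rewrite gevZ cevZ hDc chart_valM nop_dtZ key //.
by rewrite hs // inE eqxx.
Qed.

(* A differential operator of order <= m on U_sigma comes from an operator of
   order <= m on k[x]_(x^sigmahat): match its values on the y^b with |b| <= m,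
   which determine it. *)
Lemma chart_phi_lift m (D : R0 -> R0) : chart_diff m D ->
  exists2 P : weyl k J, chart_phi P D & weyl_order m P.
Proof.
move=> hD; have [hDD hDc hDo] := hD.
(* E, induced by P, agrees with D on polynomials in y of degree below j; each round adds a
   correction for degree j. *)
have step j : (j <= m.+1)%N -> exists P : weyl k J, exists E : R0 -> R0,
    [/\ chart_phi P E, weyl_order m P, chart_diff m (fun r => D r - E r) &
    forall g, (msize g <= j)%N -> D (gev g) - E (gev g) = 0].
  elim: j => [|j IH] hj.
    exists 0, (fun => 0); split.
    - by split=> [|r]; [exact: weyl_gr0|].
    - exact: weyl_order0.
    - by rewrite (_ : (fun r => _) = D) //; apply/funext => r; rewrite subr0.
    by move=> g; rewrite leqn0 msize_poly_eq0 => /eqP->; rewrite subr0 gev0 (diff_op0 hD).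
  have [P [E [[gP hP] oP dE vE]]] := IH (ltnW hj).
  have [A [cA mA vA]] := @chart_lift_step m j (fun r => D r - E r) hj dE vE.
  pose Q := dtnop cd A.
  have gQ : weyl_gr (0 : class_group V) Q by exact: dtnop_gr.
  have oQ : weyl_order m Q.
    by apply: (@weyl_order_le _ _ pchar0 _ j) => //; exact: dtnop_order.
  have [E' [_ hE']] := chart_phi_ex gQ.
  exists (P + Q), (fun r => E r + E' r).
  have phi : chart_phi (P + Q) (fun r => E r + E' r).
    by split=> [|r]; [exact: weyl_grD|rewrite weylDE hP hE'].
  split=> //.
  - exact: weyl_orderD.
  - by apply: chart_diffB => //; exact: chart_phi_diff phi (weyl_orderD pchar0 oP oQ).
  move=> g hg; apply: val_inj; rewrite opprD addrA chart_valD chart_valN vA //.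
  by rewrite -hE' dtnopE // gevE subrr.
have [P [E [hP oP dE vE]]] := step _ (leqnn _); exists P => //.
have := diff_op_vanish dE vE => h; case: hP => gP hP; split=> // r.
by rewrite hP; congr val; apply/esym/eqP; rewrite -subr_eq0 h.
Qed.

End ChartDiffOps.

(** * Localization of graded modules *)

Section LocalizedModule.
Variables (k : fieldType) (n d : nat) (V : 'M[int]_(d, n)).
Hypothesis pchar0 : [pchar k] =i pred0.
Variables (F : lmodType (weyl_algebra k d)) (Fgr : class_group V -> set F).
Hypothesis thF : theta_graded Fgr.
Variable J : {set 'I_d}.
Notation K := {fraction {mpoly k[d]}}.
Notation "f %:F" := (@FracField.tofrac {mpoly k[d]} f).
Notation der := (@der k d).
Local Opaque Defs.der.
Notation const := (@const k d).
Notation lmon := (@lmon k d).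
Notation xdegl l := (xdeg V J *+ l).

Lemma Fgr0 c : Fgr c 0. Proof. by have [] := gr_zmod thF c. Qed.
Lemma FgrB c f g : Fgr c f -> Fgr c g -> Fgr c (f - g).
Proof. by have [_] := gr_zmod thF c; exact. Qed.
Lemma FgrD c f g : Fgr c f -> Fgr c g -> Fgr c (f + g).
Proof.
by move=> hf hg; rewrite -[g]opprK; apply: FgrB => //; rewrite -sub0r; apply: FgrB => //; exact: Fgr0.
Qed.

Lemma weyl_mulzE (J' : {set 'I_d}) (P : weyl k J') z y : (P *~ z) y = P y *~ z.
Proof.
have h r : (P *+ r) y = P y *+ r.
  by elim: r => [|r IH]; rewrite ?mulr0n // !mulrS weylDE IH.
by case: z => r; [exact: h|rewrite !NegzE !mulrNz weylNE -!pmulrn h].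
Qed.

(** Q is (x^J)^N P (x^J)^-l with N large enough to clear denominators, so a single Q serves all
    numerators f. *)
Lemma locZ_frac (P : weyl k J) l : exists N (Q : weyl_algebra k d),
  [/\ forall f : F, P *: frac_of J f l = frac_of J (Q *: f) N,
      forall m, weyl_order m P -> weyl_order m Q,
      forall c : class_group V, weyl_gr c P -> weyl_gr (c - xdegl l + xdegl N) Q &
      nf Q = (xprod k J ^+ N)%:F *: nf (P * wmul J (lmon (- (ind_row J *+ l))))].
Proof.
have hS : Sgr J (- xdegl l : class_group V) (lmon (- (ind_row J *+ l))).
  rewrite xdegE -raddfN; apply: lmon_Sgr => i iJ.
  by rewrite mxE ind_rowMn (negPf iJ) oppr0.
have hL := Sgr_Sloc hS.
have [N [Q [hQ QE oQ gQ]]] := weyl_clear V pchar0 (P * wmul J (lmon (- (ind_row J *+ l)))).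
exists N, Q; split=> // [f|m oP|c gP].
- apply: locZE => y; rewrite QE weylME wmulE // lmonN -xprod_lmon.
  by rewrite [y / _]mulrC.
- by apply: oQ; rewrite -[m]addn0; apply: weyl_orderM => //; exact: order_wmul.
by apply: gQ; apply: weyl_grM => //; exact: weyl_gr_wmul.
Qed.

Definition locgr (c : class_group V) : set (loc F J) :=
  [set u | exists (f : F) (l : nat), Fgr (c + xdegl l) f /\ u = frac_of J f l].

Lemma xpow_gr (c : class_group V) m f :
  Fgr c f -> Fgr (xdegl m + c) (xpow k J m *: f).
Proof.
by move=> hf; apply: (gr_action thF) => //; apply: weyl_gr_poly => //; exact: class_homog_xprod.
Qed.

Lemma locgr0 c : locgr c 0.
Proof. by exists 0, 0%N; split; [exact: Fgr0|]. Qed.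

Lemma locgrD c u v : locgr c u -> locgr c v -> locgr c (u + v).
Proof.
move=> [f [l [hf ->]]] [g [m [hg ->]]].
exists (xpow k J m *: f + xpow k J l *: g), (m + l)%N; split.
  apply: FgrD.
    by rewrite mulrnDr addrCA; exact: xpow_gr.
  by rewrite mulrnDr [xdegl m + _]addrC addrCA; exact: xpow_gr.
rewrite -frac_ofD frac_of_scale [(m + l)%N in X in _ = _ + X]addnC.
by rewrite frac_of_scale.
Qed.

Lemma locgrZ c c' (P : weyl k J) u : weyl_gr c P -> locgr c' u -> locgr (c + c') (P *: u).
Proof.
move=> gP [f [l [hf ->]]]; have [N [Q [hQ _ gQ _]]] := locZ_frac P l.
exists (Q *: f), N; split=> //.
have := gr_action thF (gQ _ gP) hf; congr (Fgr _ _).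
by rewrite addrAC addrACA addNr addr0 addrAC.
Qed.

Lemma intr_weylE (z : int) (y : K) : (z%:~R : weyl_algebra k d) y = z%:~R * y.
Proof. by rewrite weyl_mulzE weyl1E -mulrzl. Qed.

Section Theta.
Variable c : 'I_d -> int.

(** theta_u on any localization, written through the values c_j of u on the classes of the x_j; that
    c comes from some u is shown separately. *)
Definition thop (J' : {set 'I_d}) : weyl k J' :=
  \sum_(j < d) (weyl_poly J' 'X_j * weyl_pd k J' j) *~ c j.

Lemma thopE J' y : thop J' y = \sum_(j < d) ('X_j)%:F * der j y *~ c j.
Proof. by rewrite /thop weyl_sumE; apply: eq_bigr => j _; rewrite weyl_mulzE. Qed.

Lemma thopM J' x y : thop J' (x * y) = thop J' x * y + x * thop J' y.
Proof.
rewrite !thopE mulr_suml mulr_sumr -big_split; apply: eq_bigr => j _ /=.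
by rewrite derM mulrDr mulrzDl mulrzAl mulrzAr mulrA [x * (_ * der j y)]mulrCA.
Qed.

Lemma thop_lmon J' b : thop J' (lmon b) = (\sum_j c j * b 0 j)%:~R * lmon b.
Proof.
rewrite thopE rmorph_sum mulr_suml; apply: eq_bigr => j _ /=.
rewrite der_lmon mulrCA.
have -> : ('X_j)%:F = lmon (delta_mx 0 j).
  rewrite lmon_mnm; congr lmon; apply/rowP => i; rewrite !mxE mnm1E eqxx /=.
  by rewrite eq_sym; case: eqP.
by rewrite -lmonD addrC subrK -mulrzl mulrA rmorphM.
Qed.

Hypothesis hc : forall a, class_of V a = 0 -> \sum_j c j * a 0 j = 0.

(** A vector orthogonal to all principal divisors descends to an element of the dual of Cl(X). *)
Lemma theta_char : exists u : {additive class_group V -> int},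
  forall a, u (class_of V a) = \sum_j c j * a 0 j.
Proof.
pose u0 (x : class_group V) : int := \sum_j c j * (repr x) 0 j.
have u0E a : u0 (class_of V a) = \sum_j c j * a 0 j.
  have e : class_of V (repr (class_of V a)) = class_of V a.
    by rewrite {1}/class_of reprK.
  apply/eqP; rewrite -subr_eq0 -sumrB; apply/eqP.
  rewrite -[RHS](hc (a := repr (class_of V a) - a)) ?raddfB /= ?e ?subrr //.
  by apply: eq_bigr => j _; rewrite !mxE mulrBr.
have uadd : additive u0.
  move=> x y; rewrite -[x](reprK) -[y]reprK -!/(class_of V _) -raddfB !u0E -sumrB.
  by apply: eq_bigr => j _; rewrite !mxE mulrBr.
pose ua := GRing.isAdditive.Build (class_group V) int u0 uadd.
pose u : {additive class_group V -> int} := HB.pack u0 ua.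
by exists u.
Qed.

Lemma thop_Sgr0 y : Sgr J (0 : class_group V) y -> thop J y = 0.
Proof.
apply: (Sgr_ind (P := fun y => thop J y = 0)) => [|x x' hx hx'|a t _ ha].
- by rewrite thopE big1 // => j _; rewrite -(rmorph0 const) der_const mulr0 mul0rz.
- by rewrite (weyl_opD (weylP _)) hx hx' addr0.
rewrite thopM thop_lmon hc // mul0r mulr0 addr0 thopE big1 ?mul0r // => j _.
by rewrite der_const mulr0 mul0rz.
Qed.

(** By the Leibniz rule theta_u (f / (x^J)^l) = (theta_u f - u(l deg x^J) f) / (x^J)^l, and for a
    fraction of degree 0 the degree of f is l deg x^J. *)
Lemma thop_locgr0 u : locgr 0 u -> thop J *: u = 0.
Proof.
move=> [f [l [hf ->]]]; have [u0 hu] := theta_char.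
have hth : theta k u0 = thop finset.set0.
  by apply: eq_bigr => j _; rewrite /class_var hu (bigD1 j) //= mxE !eqxx mulr1 big1 ?addr0 // => i ij;
  rewrite mxE (negPf ij) andbF mulr0.
have -> : thop J *: frac_of J f l
    = frac_of J ((theta k u0 - (u0 (xdegl l))%:~R) *: f) l.
  apply: locZE => y; rewrite weylDE weylNE intr_weylE hth xdegE hu.
  set x := (xprod k J ^+ l)%:F.
  have xE : x = lmon (ind_row J *+ l) by rewrite /x xprod_lmon.
  have x0 : x != 0 by rewrite xE lmon_neq0.
  have hx : thop J x = (\sum_j c j * (ind_row J *+ l) 0 j)%:~R * x by rewrite xE thop_lmon.
  have -> : thop finset.set0 y = thop J y by rewrite !thopE.
  have hy : thop J y = thop J (y / x) * x + y / x * thop J x by rewrite -thopM divfK.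
  rewrite hy hx mulrCA divfK // addrK mulrC //.
have := gr_theta thF u0 hf; rewrite add0r => ->.
by rewrite -loc0E.
Qed.

End Theta.
End LocalizedModule.

(** * The kernel of phi_sigma acts as zero on sections *)

Section KernelOfPhi.
Variables (k : fieldType) (n d : nat) (V : 'M[int]_(d, n)) (sigma : {set 'I_d}).
Hypothesis pchar0 : [pchar k] =i pred0.
Variables (F : lmodType (weyl_algebra k d)) (Fgr : class_group V -> set F).
Hypothesis thF : theta_graded Fgr.
Variable cd : chart_data V sigma.
Notation J := (~: sigma)%SET.
Notation K := {fraction {mpoly k[d]}}.
Notation "f %:F" := (@FracField.tofrac {mpoly k[d]} f).
Notation der := (@der k d).
Local Opaque Defs.der.
Notation const := (@const k d).
Notation lmon := (@lmon k d).
Notation dt := (@dt k n d V sigma cd).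
Notation dtop := (@dtop k n d V sigma cd).
Notation dtnop := (@dtnop k n d V sigma cd).
Notation in_chart := (@in_chart k n d V sigma).
Notation W := (cdW cd).
Notation M := (cdM cd).
Notation N := (cdN cd).
Notation f := (cdf cd).
Notation al := (al cd).
Let tD := dtD pchar0 cd.
Let tM := dtM pchar0 cd.
Let tC := dt_comm pchar0 cd.

Let constM (a b : k) : const (a * b) = const a * const b.
Proof. exact: rmorphM. Qed.
Let constB (a b : k) : const (a - b) = const a - const b.
Proof. exact: rmorphB. Qed.
Let const_int (z : int) : const z%:~R = z%:~R.
Proof. exact: rmorph_int. Qed.

(** Vanishing on functions and on sections is tracked together: the first identifies the kernel of
    phi_sigma, the second is what has to be deduced. *)
Definition kills (P : weyl k J) : Prop :=
  (forall y, Sgr J (0 : class_group V) y -> P y = 0) /\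
  (forall u, locgr Fgr (J := J) 0 u -> P *: u = 0).

Lemma killsD P Q : kills P -> kills Q -> kills (P + Q).
Proof.
move=> [h1 h2] [h3 h4]; split=> [y hy|u hu].
  by rewrite weylDE h1 // h3 // addr0.
by rewrite scalerDl h2 // h4 // addr0.
Qed.

Lemma kills_mull Q P : kills P -> kills (Q * P).
Proof.
move=> [h1 h2]; split=> [y hy|u hu].
  rewrite weylME h1 //; apply: (addrI (Q 0)).
  by rewrite -(weyl_opD (weylP Q)) !addr0.
by rewrite -scalerA h2 // scaler0.
Qed.

Lemma kills_mulr P Q : kills P -> weyl_gr (0 : class_group V) Q -> kills (P * Q).
Proof.
move=> [h1 h2] gQ; split=> [y hy|u hu].
  by rewrite weylME h1 // -[0]addr0; apply: weyl_gr_Sgr.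
by rewrite -scalerA h2 // -[0]addr0; exact: locgrZ.
Qed.

Lemma kills0 : kills 0.
Proof. by split=> [y _|u _]; rewrite ?scale0r. Qed.

(* P lies in the subring generated by k[U_sigma] and the dt l, up to operators
   acting as zero in degree 0. *)
Definition mod_nf (P : weyl k J) := exists2 A, in_chart A & kills (P - dtnop A).

Lemma in_chart0 : in_chart 0.
Proof. by move=> b; rewrite mcoeff0; exact: Sgr0. Qed.

Lemma in_chartD A B : in_chart A -> in_chart B -> in_chart (A + B).
Proof. by move=> hA hB b; rewrite mcoeffD; exact: SgrD. Qed.

Lemma dtnopD A B : in_chart A -> in_chart B -> dtnop (A + B) = dtnop A + dtnop B.
Proof.
move=> hA hB; apply: weyl_ext => y.
by rewrite weylDE !dtnopE ?nopD //; exact: in_chartD.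
Qed.

Lemma dtnop0 : dtnop 0 = 0.
Proof. by apply: weyl_ext => y; rewrite dtnopE ?nop0 //; exact: in_chart0. Qed.

Lemma mod_nfD P Q : mod_nf P -> mod_nf Q -> mod_nf (P + Q).
Proof.
move=> [A hA kA] [B hB kB]; exists (A + B); first exact: in_chartD.
by rewrite dtnopD // opprD addrACA; exact: killsD.
Qed.

Lemma mod_nf_kills P Q : mod_nf P -> kills (Q - P) -> mod_nf Q.
Proof.
by move=> [A hA kA] h; exists A => //; rewrite -[Q](subrK P) -addrA; exact: killsD.
Qed.

Lemma mod_nf_sum (I : eqType) (s : seq I) (P : I -> weyl k J) :
  (forall i, i \in s -> mod_nf (P i)) -> mod_nf (\sum_(i <- s) P i).
Proof.
move=> h; rewrite big_seq; elim/big_ind: _ => //; last exact: mod_nfD.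
by exists 0; [exact: in_chart0|rewrite dtnop0 subrr; exact: kills0].
Qed.

Lemma in_chart_star A B : in_chart A -> in_chart B -> in_chart (star dt A B).
Proof.
move=> hA hB.
have h0 : coeffs_in (H := class_group V) (fun _ => Sgr J (0 : class_group V))
    (fun _ => 0) (0 + 0) (star dt A B).
  apply: (@coeffs_in_star n _ dt tD tC _ (fun _ => Sgr J (0 : class_group V))
    (fun _ => 0)) => //.
  - by move=> _; exact: Sgr0.
  - by move=> _ x y; exact: SgrD.
  - by move=> _ _ x y hx hy; rewrite -[0]addr0; exact: SgrM.
  - by move=> _ i x hx; rewrite -[0]addr0; apply: weyl_gr_Sgr => //; exact: dtop_gr.
by move=> b; have := h0 b.
Qed.

Lemma mod_nfM P Q : mod_nf P -> mod_nf Q -> weyl_gr (0 : class_group V) Q -> mod_nf (P * Q).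
Proof.
move=> [A hA kA] [B hB kB] gQ; exists (star dt A B); first exact: in_chart_star.
have -> : dtnop (star dt A B) = dtnop A * dtnop B.
  apply: weyl_ext => y; rewrite weylME !dtnopE //; last exact: in_chart_star.
  by rewrite (nop_star tD tM tC).
have -> : P * Q - dtnop A * dtnop B = (P - dtnop A) * Q + dtnop A * (Q - dtnop B).
  by rewrite mulrBl mulrBr addrA subrK.
by apply: killsD; [exact: kills_mulr|exact: kills_mull].
Qed.

Lemma mod_nf_wmul a : Sgr J (0 : class_group V) a -> mod_nf (wmul J a).
Proof.
move=> ha; have hA : in_chart a%:MP.
  by move=> b; rewrite mcoeffC; case: eqP => _; rewrite ?mulr1 ?mulr0 //; exact: Sgr0.
exists a%:MP => //; suff -> : dtnop a%:MP = wmul J a by rewrite subrr; exact: kills0.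
apply: weyl_ext => y; rewrite dtnopE // nopC wmulE //; exact: Sgr_Sloc ha.
Qed.

Lemma mod_nf_dtop l : mod_nf (dtop l).
Proof.
have hA : in_chart 'X_l.
  move=> b; rewrite mcoeffX; case: eqP => _; last exact: Sgr0.
  by rewrite -(rmorph1 const); exact: Sgr_const.
exists 'X_l => //; suff -> : dtnop 'X_l = dtop l by rewrite subrr; exact: kills0.
by apply: weyl_ext => y; rewrite dtnopE // nopX (mnm_iterU).
Qed.

Definition euler (i : 'I_d) : weyl k J := weyl_poly J 'X_i * weyl_pd k J i.

Lemma euler_gr i : weyl_gr (0 : class_group V) (euler i).
Proof.
rewrite -(subrr (class_var V i)); apply: weyl_grM => //; last exact: weyl_gr_pd.
apply: weyl_gr_poly => // b; rewrite msuppX inE => /eqP->; exact: class_mnmU.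
Qed.

Lemma X_lmon (i : 'I_d) : ('X_i)%:F = lmon (delta_mx 0 i).
Proof.
rewrite lmon_mnm; congr lmon; apply/rowP => j; rewrite !mxE mnm1E eqxx /=.
by rewrite eq_sym; case: eqP.
Qed.

(* x_i d_i - sum_l W_il y_l d_(y_l) is a rational combination of the theta_u. *)
Lemma mod_nf_euler i : mod_nf (euler i).
Proof.
have hN := natr_neq0 pchar0 (cdN_gt0 cd).
have hy l : Sgr J (0 : class_group V) (const (W i l)%:~R * lmon (al l)).
  by apply: SgrZ; exact: (yl_Sgr k cd).
pose E : weyl k J := \sum_l wmul J (const (W i l)%:~R * lmon (al l)) * dtop l.
have nfE : mod_nf E.
  by apply: mod_nf_sum => l _; apply: mod_nfM;
    [exact: mod_nf_wmul|exact: mod_nf_dtop|exact: dtop_gr].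
apply: (mod_nf_kills nfE).
(* c is row i of N - W M. It is orthogonal to the columns of W since M W = N, that is, to all
   principal divisors. *)
pose c (j : 'I_d) : int := N%:Z *+ (i == j) - \sum_l W i l * M l j.
have hc a : class_of V a = 0 -> \sum_j c j * a 0 j = 0.
  move=> /(cd_principal cd)[p ->].
  have -> : \sum_j c j * (W *m p)^T 0 j = N%:Z * (W *m p) i 0
      - \sum_l W i l * \sum_j M l j * (W *m p) j 0.
    rewrite /c; under eq_bigr do rewrite mulrBl [(W *m p)^T _ _]mxE.
    rewrite sumrB; congr (_ - _).
      rewrite (bigD1 i) //= eqxx mulr1n big1 ?addr0 // => j ji.
      by rewrite eq_sym (negPf ji) mulr0n mul0r.
    under eq_bigr do rewrite mulr_suml.
    rewrite exchange_big /=; apply: eq_bigr => l _; rewrite mulr_sumr.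
    by apply: eq_bigr => j _; rewrite mulrA.
  have -> : \sum_l W i l * \sum_j M l j * (W *m p) j 0 = (W *m (M *m (W *m p))) i 0.
    by rewrite [RHS]mxE; apply: eq_bigr => l _; rewrite [in RHS]mxE.
  by rewrite [M *m _]mulmxA (cdMW cd) mul_scalar_mx -scalemxAr [X in _ - X]mxE subrr.
have kth : kills (thop k c J).
  by split=> [y hy'|u hu]; [apply: (thop_Sgr0 hc)|apply: (thop_locgr0 thF hc)].
suff -> : euler i - E = wmul J (const N%:R^-1) * thop k c J by exact: kills_mull.
apply: weyl_ext => y.
rewrite weylME wmulE; [|done|by apply: Sgr_Sloc (Sgr_const V _ _)].
rewrite weylDE weylNE weyl_sumE /= thopE.
have -> : \sum_l (wmul J (const (W i l)%:~R * lmon (al l)) * dtop l) y =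
    \sum_j const (\sum_l (W i l)%:~R * cf k cd l j) * (('X_j)%:F * der j y).
  transitivity (\sum_l \sum_j const ((W i l)%:~R * cf k cd l j) * (('X_j)%:F * der j y)).
    apply: eq_bigr => l _; rewrite weylME wmulE //; last by apply: Sgr_Sloc (hy l).
    rewrite -/(dt l y) dtE // mulr_sumr; apply: eq_bigr => j _.
    have aux (L : comRingType) (c1 l1 c2 l2 D : L) :
        (c1 * l1) * ((c2 * l2) * D) = (c1 * c2) * ((l1 * l2) * D) by ring.
    by rewrite aux -constM -lmonD [al l + _]addrC subrK X_lmon.
  rewrite exchange_big /=; apply: eq_bigr => j _.
  by rewrite rmorph_sum mulr_suml.
have -> : ('X_i)%:F * der i y = \sum_j const (i == j)%:R * (('X_j)%:F * der j y).
  rewrite (bigD1 i) //= eqxx rmorph1 mul1r big1 ?addr0 // => j ji.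
  by rewrite eq_sym (negPf ji) rmorph0 mul0r.
rewrite -sumrB mulr_sumr; apply: eq_bigr => j _.
rewrite -mulrBl -constB -[_ *~ c j]mulrzl [RHS]mulrA -const_int -constM.
congr (const _ * _); apply: (mulfI hN); rewrite mulrA mulfV // mul1r.
rewrite /c rmorphB rmorphMn /= rmorph_sum /= mulrBr; congr (_ - _).
  by case: eqP => _; rewrite ?mulr1 ?mulr1n ?mulr0 ?mulr0n.
rewrite mulr_sumr; apply: eq_bigr => l _; rewrite rmorphM /cf mulrCA; congr (_ * _).
by rewrite mulrC divfK.
Qed.

(** For i in sigma the operator [dtop (f i)] involves d_i only, so x^m d_i is a function times it.
    For i outside sigma, x_i is invertible and x^m d_i = (x^m / x_i) x_i d_i. *)
Lemma mod_nf_unit_pd i m : class_of V m = class_var V i ->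
  (forall j, j \in sigma -> m 0 j = 0) -> mod_nf (wmul J (lmon m) * weyl_pd k J i).
Proof.
move=> hm ms; have hL (a : 'rV[int]_d) : (forall j, j \in sigma -> 0 <= a 0 j) -> Sloc J (lmon a).
  by move=> ha; apply: (Sgr_Sloc (V := V)); apply: lmon_Sgr; apply/nonneg_offP.
have hLm : Sloc J (lmon m) by apply: hL => j /ms->.
have [hi|hi] := boolP (i \in sigma).
  have hpos j : j \in sigma -> 0 <= (m - delta_mx 0 i + al (f i)) 0 j.
    move=> hj; rewrite mxE al_sigma // mxE ms // add0r mxE mxE eqxx /=.
    have [->|ji] := eqVneq j i; first by rewrite eqxx addNr.
    by rewrite oppr0 add0r; case: eqP.
  have hS : Sgr J (0 : class_group V) (lmon (m - delta_mx 0 i + al (f i))).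
    have -> : (0 : class_group V) = class_of V (m - delta_mx 0 i + al (f i)).
      by rewrite raddfD raddfB /= al_principal hm subrr addr0.
    by apply: lmon_Sgr; apply/nonneg_offP.
  suff -> : wmul J (lmon m) * weyl_pd k J i
      = wmul J (lmon (m - delta_mx 0 i + al (f i))) * dtop (f i).
    by apply: mod_nfM; [exact: mod_nf_wmul|exact: mod_nf_dtop|exact: dtop_gr].
  apply: weyl_ext => y; rewrite !weylME !wmulE //; last exact: Sgr_Sloc hS.
  rewrite -/(dt _ y) dtE // (bigD1 i) //= big1 ?addr0 => [|j ji].
    rewrite /cf (cdM_sigma cd) // eqxx mulr1n divff ?rmorph1 ?mul1r ?(natr_neq0 pchar0 (cdN_gt0 cd)) //.
    by rewrite [RHS]mulrA -lmonD addrACA subrK subrr addr0.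
  by rewrite /cf (cdM_sigma cd) // eq_sym (negPf ji) mulr0n mul0r rmorph0 !mul0r.
have hpos j : j \in sigma -> 0 <= (m - delta_mx 0 i) 0 j.
  move=> hj; rewrite mxE ms // add0r mxE mxE eqxx /=.
  by have [e|] := eqVneq j i; [rewrite -e hj in hi|rewrite oppr0].
have hS : Sgr J (0 : class_group V) (lmon (m - delta_mx 0 i)).
  have -> : (0 : class_group V) = class_of V (m - delta_mx 0 i).
    by rewrite raddfB /= hm subrr.
  by apply: lmon_Sgr; apply/nonneg_offP.
suff -> : wmul J (lmon m) * weyl_pd k J i = wmul J (lmon (m - delta_mx 0 i)) * euler i.
  by apply: mod_nfM; [exact: mod_nf_wmul|exact: mod_nf_euler|exact: euler_gr].
apply: weyl_ext => y; rewrite !weylME !wmulE //; last exact: Sgr_Sloc hS.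
by rewrite /= X_lmon [RHS]mulrA -lmonD subrK.
Qed.

Definition dermon (b : 'X_{1..d}) : weyl k J := opn J 'X_[b].

Lemma dermonE b y : dermon b y = mnm_iter der b y.
Proof. by rewrite opnE ?nopX //; exact: SplocX. Qed.

Lemma dermon_gr b : weyl_gr (- class_mnm V b) (dermon b).
Proof.
rewrite weyl_grE // opnK; [|done|exact: SplocX].
rewrite -[mpolyX _ _]scale1r; apply: SpgrZX.
by rewrite addNr -(rmorph1 const); exact: Sgr_const.
Qed.

Lemma dermon_order b : weyl_order (mdeg b) (dermon b).
Proof. by rewrite weyl_orderE // opnK ?msizeX //; exact: SplocX. Qed.

(** Induction on the order, one derivative at a time. A term of degree 0 need not have factors of
    degree 0, so a monomial that is a unit on U_sigma is inserted to restore this. *)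
Lemma mod_nf_exists m (P : weyl k J) :
  weyl_gr (0 : class_group V) P -> weyl_order m P -> mod_nf P.
Proof.
elim/ltn_ind: m P => m IH P gP oP.
have hP : Spgr J (0 : class_group V) (nf P) by apply/weyl_grE.
have hS b : Sgr J (class_mnm V b) (nf P)@_b by have := hP b; rewrite add0r.
have -> : P = \sum_(b <- msupp (nf P)) wmul J (nf P)@_b * dermon b.
  apply: weyl_ext => y; rewrite weyl_sumE nfE; apply: eq_bigr => b _.
  by rewrite weylME wmulE ?dermonE //; exact: nf_loc.
apply: mod_nf_sum => b hb.
have : (mdeg b <= m)%N.
  by move/weyl_orderE: oP => /(_ pchar0) h; rewrite -ltnS; apply: leq_trans (msize_mdeg_lt hb) h.
elim/mnm_ind: b {hb} (hS b) => [|i b _] hSb.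
  rewrite class_mnm0 in hSb => _.
  have -> : dermon 0%MM = 1 by apply: weyl_ext => y; rewrite dermonE mnm_iter0 weyl1E.
  by rewrite mulr1; exact: mod_nf_wmul.
rewrite mdegD mdeg1 add1n => lt; set a := (X in wmul J X).
have [mm [hmm ms]] := unit_mon cd (class_var V i).
have hL : Sgr J (class_var V i) (lmon mm).
  by rewrite -hmm; apply: lmon_Sgr; apply/nonneg_offP => j /ms->.
have hL' : Sgr J (- class_var V i) (lmon (- mm)).
  rewrite -hmm -raddfN; apply: lmon_Sgr; apply/nonneg_offP => j /ms.
  by rewrite mxE => ->; rewrite oppr0.
(* a d^b d_i = (a d^b u^-1) (u d_i), where u is a unit monomial of the class of x_i; both factors
   have degree 0. *)
have -> : wmul J a * dermon (U_(i) + b)%MM =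
    (wmul J a * dermon b * wmul J (lmon (- mm))) * (wmul J (lmon mm) * weyl_pd k J i).
  apply: weyl_ext => y; rewrite !weylME !dermonE; congr (wmul J a _).
  rewrite addmC mnm_iterD; last exact: derC.
  rewrite mnm_iterU (wmulE pchar0 _ (Sgr_Sloc hL)) (wmulE pchar0 _ (Sgr_Sloc hL')).
  by rewrite lmonN mulKf ?lmon_neq0.
apply: mod_nfM; last 1 first.
- rewrite -(subrr (class_var V i)); apply: weyl_grM => //; last exact: weyl_gr_pd.
  exact: weyl_gr_wmul.
- apply: (IH (mdeg b)) => //.
    have -> : 0 = class_mnm V (U_(i) + b)%MM - class_mnm V b - class_var V i.
      by rewrite class_mnmD class_mnmU addrK subrr.
    apply: weyl_grM => //; last exact: weyl_gr_wmul.
    by apply: weyl_grM => //; [exact: weyl_gr_wmul|exact: dermon_gr].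
  rewrite -[mdeg b]addn0; apply: weyl_orderM => //.
    rewrite -[mdeg b]add0n; apply: weyl_orderM => //; last exact: dermon_order.
    by apply: order_wmul => //; exact: Sgr_Sloc hSb.
  by apply: order_wmul => //; exact: Sgr_Sloc hL'.
exact: mod_nf_unit_pd.
Qed.

(** The normal form of P acts as zero on k[y], hence is zero; so P itself acts as zero on
    sections. *)
Lemma phi_kernel (P : weyl k J) : weyl_gr (0 : class_group V) P ->
  (forall y, Sgr J (0 : class_group V) y -> P y = 0) ->
  forall u, locgr Fgr (J := J) 0 u -> P *: u = 0.
Proof.
move=> gP P0 u hu; have [m oP] := order_ex pchar0 P.
have [A hA [k1 k2]] := mod_nf_exists gP oP.
suff A0 : A = 0 by have := k2 u hu; rewrite A0 dtnop0 subr0.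
apply: (in_chart_eq0 pchar0 (cd := cd) (w := msize A)) => // g _.
have hg := cev_Sgr (k := k) cd g.
have := k1 _ hg; rewrite weylDE weylNE P0 // add0r dtnopE // => /eqP.
by rewrite oppr_eq0 => /eqP.
Qed.

End KernelOfPhi.

(** * Change of localization and restriction of sections *)

Section FracCalculus.
Variables (k : fieldType) (n d : nat) (V : 'M[int]_(d, n)).
Hypothesis pchar0 : [pchar k] =i pred0.
Variables (F : lmodType (weyl_algebra k d)) (Fgr : class_group V -> set F).
Hypothesis thF : theta_graded Fgr.
Notation K := {fraction {mpoly k[d]}}.
Notation "f %:F" := (@FracField.tofrac {mpoly k[d]} f).
Notation lmon := (@lmon k d).

Section OneChart.
Variable J : {set 'I_d}.

Definition wext (J' : {set 'I_d}) (P : weyl k J') : weyl k J := opn J (nf P).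

Lemma Sloc_sub (J' : {set 'I_d}) (y : K) : J' \subset J -> Sloc J' y -> Sloc J y.
Proof.
move=> sub [f [m ->]]; exists (f * xprod k (J :\: J')%SET ^+ m), m.
have -> : xprod k J = xprod k J' * xprod k (J :\: J')%SET.
  rewrite /xprod (big_setID J') /=; congr (_ * _); apply: eq_bigl => i.
  by rewrite finset.in_setI; case hi : (i \in J'); rewrite ?andbT ?andbF ?(fintype.subsetP sub).
rewrite exprMn !tofracM -mulf_div divff ?mulr1 // -?tofracM.
by rewrite tofrac_eq0 expf_neq0 // xprod_neq0.
Qed.

Lemma Sploc_sub (J' : {set 'I_d}) (q : {mpoly K[d]}) : J' \subset J -> Sploc J' q -> Sploc J q.
Proof. by move=> sub h b; exact: Sloc_sub (h b). Qed.

Lemma wextE (J' : {set 'I_d}) (P : weyl k J') y : J' \subset J -> wext P y = P y.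
Proof.
by move=> sub; rewrite opnE ?[in RHS]nfE //; apply: Sploc_sub sub _; exact: nf_loc.
Qed.

Lemma nf_wext (J' : {set 'I_d}) (P : weyl k J') : J' \subset J -> nf (wext P) = nf P.
Proof. by move=> sub; rewrite opnK //; apply: Sploc_sub sub _; exact: nf_loc. Qed.

Lemma Sgr_sub (J' : {set 'I_d}) (c : class_group V) (y : K) :
  J' \subset J -> Sgr J' c y -> Sgr J c y.
Proof.
move=> sub; apply: (Sgr_ind (P := fun y => Sgr J c y)) => [|x x'|a t ha <-].
- exact: Sgr0.
- exact: SgrD.
apply: SgrZ; apply: lmon_Sgr => i hi; apply: ha.
by apply: contra hi; exact: (fintype.subsetP sub).
Qed.

Lemma wext_gr (J' : {set 'I_d}) (c : class_group V) (P : weyl k J') : J' \subset J ->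
  weyl_gr c P -> weyl_gr c (wext P).
Proof.
move=> sub; rewrite !weyl_grE // nf_wext // => h b.
exact: Sgr_sub sub (h b).
Qed.

Lemma wext_order (J' : {set 'I_d}) m (P : weyl k J') : J' \subset J ->
  weyl_order m P -> weyl_order m (wext P).
Proof. by move=> sub; rewrite !weyl_orderE // nf_wext. Qed.

Lemma wextZ_frac (P : weyl_algebra k d) (f : F) :
  wext P *: frac_of J f 0 = frac_of J (P *: f) 0.
Proof.
apply: locZE => y; rewrite wextE ?finset.sub0set // expr0 tofrac1 mul1r.
by rewrite divr1.
Qed.

(** (x^J)^-N, written as a Laurent monomial so that its degree can be read off. *)
Definition xinv N : K := lmon (- (ind_row J *+ N)).

Lemma xinvE N : xinv N = ((xprod k J ^+ N)%:F)^-1.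
Proof. by rewrite /xinv lmonN xprod_lmon. Qed.

Lemma xinv_Sgr N : Sgr J (- (xdeg V J *+ N)) (xinv N).
Proof.
rewrite xdegE -raddfN; apply: lmon_Sgr => i iJ.
by rewrite mxE ind_rowMn (negPf iJ) oppr0.
Qed.

Lemma xinv_Sloc N : Sloc J (xinv N). Proof. exact: Sgr_Sloc (xinv_Sgr N). Qed.

Lemma wmul_fracZ g m (f : F) l :
  wmul J (g%:F / (xprod k J ^+ m)%:F) *: frac_of J f l
    = frac_of J (weyl_poly _ g *: f) (l + m).
Proof.
apply: locZE => y; rewrite wmulE; [|done|by exists g, m].
have aux (L : fieldType) (a b c e : L) : a != 0 -> b != 0 -> a * b * (c / b * (e / a)) = c * e.
  by move=> a0 b0; field; rewrite a0.
by rewrite exprD tofracM aux ?xprodF_neq0.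
Qed.

Lemma wmulM (a b : K) : Sloc J a -> Sloc J b -> wmul J (a * b) = wmul J a * wmul J b.
Proof.
move=> ha hb; have [_ _ hM _] := Sloc_ring k J.
by apply: weyl_ext => y; rewrite weylME !wmulE ?mulrA //; exact: hM.
Qed.

Lemma wmul1 : wmul J (1 : K) = 1.
Proof. by apply: weyl_ext => y; rewrite wmulE ?weyl1E ?mul1r //; exact: Sloc1. Qed.

Lemma frac_xinv (f : F) N : frac_of J f N = wmul J (xinv N) *: frac_of J f 0.
Proof.
have -> : xinv N = (1%:F) / (xprod k J ^+ N)%:F by rewrite xinvE tofrac1 mul1r.
by rewrite wmul_fracZ (_ : weyl_poly _ 1 = 1) // scale1r.
Qed.

End OneChart.

(** (x^J)^-l is a function on the smaller open set, so the restriction is its product with f / 1;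
    this frees [loc_res] from the chosen representative. *)
Lemma loc_resE (J J' : {set 'I_d}) (f : F) l : J \subset J' ->
  loc_res J' (frac_of J f l) = wmul J' (xinv J l) *: frac_of J' f 0.
Proof.
move=> sub.
have xE : xprod k J' = xprod k J * xprod k (J' :\: J)%SET.
  rewrite /xprod (big_setID J) /=; congr (_ * _); apply: eq_bigl => i.
  by rewrite finset.in_setI; case hi : (i \in J); rewrite ?andbT ?andbF ?(fintype.subsetP sub).
have hres (g : F) m : frac_of J' (weyl_poly _ (xprod k (J' :\: J)%SET ^+ m) *: g) m
    = wmul J' (xinv J m) *: frac_of J' g 0.
  have -> : xinv J m = (xprod k (J' :\: J)%SET ^+ m)%:F / (xprod k J' ^+ m)%:F.
    rewrite xinvE xE exprMn tofracM invfM mulrCA divff ?mulr1 //.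
    by rewrite tofrac_eq0 expf_neq0 // xprod_neq0.
  by rewrite wmul_fracZ.
rewrite /loc_res hres; move: (frac_ofK (frac_of J f l)).
case: (repr (frac_of J f l)) => [g m] /= /frac_ofP[r e].
have h N : Sloc J' (xinv J N) by apply: (Sloc_sub sub); exact: xinv_Sloc.
have hx N : Sloc J' ((xprod k J ^+ N)%:F) by exact: Sloc_poly.
have wx N (g' : F) : wmul J' ((xprod k J ^+ N)%:F) *: frac_of J' g' 0 = frac_of J' (xpow k J N *: g') 0.
  have -> : (xprod k J ^+ N)%:F = (xprod k J ^+ N)%:F / (xprod k J' ^+ 0)%:F.
    by rewrite expr0 tofrac1 divr1.
  by rewrite wmul_fracZ.
have cancel a b : xinv J (a + b) * (xprod k J ^+ a)%:F = xinv J b.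
  rewrite !xinvE exprD tofracM invfM mulrAC mulVf ?mul1r //.
  exact: xprodF_neq0.
(* Both fractions are expanded to the exponent l + m + r, where the relation [e] between the
   representatives applies. *)
rewrite -(cancel (l + r)%N m) -[in RHS](cancel (m + r)%N l).
rewrite !wmulM // -!scalerA !wx e.
by congr (wmul J' (xinv J _) *: _); lia.
Qed.

Lemma loc_res_wmul (J J' : {set 'I_d}) (a : K) (u : loc F J) : J \subset J' -> Sloc J a ->
  loc_res J' (wmul J a *: u) = wmul J' a *: loc_res J' u.
Proof.
move=> sub [g [m ->]]; elim/frac_of_ind: u => f l.
rewrite wmul_fracZ !loc_resE //.
have h N : Sloc J' (xinv J N) by apply: (Sloc_sub sub); exact: xinv_Sloc.
have hg : Sloc J' (g%:F : K) by exact: Sloc_poly.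
have -> : frac_of J' (weyl_poly _ g *: f) 0 = wmul J' g%:F *: frac_of J' f 0.
  have -> : g%:F = g%:F / (xprod k J' ^+ 0)%:F by rewrite expr0 tofrac1 divr1.
  by rewrite wmul_fracZ.
have -> : g%:F / (xprod k J ^+ m)%:F = xinv J m * g%:F by rewrite xinvE mulrC.
rewrite !scalerA -!wmulM //; last first.
  by have [_ _ hM _] := Sloc_ring k J'; exact: hM.
congr (wmul _ _ *: _); rewrite !xinvE exprD tofracM invfM.
have aux (L : comRingType) (x y z : L) : x * y * z = y * z * x by ring.
exact: aux.
Qed.

End FracCalculus.

(** * From H^0(U_sigma, D) to operators of degree 0 *)

Section ChartAction.
Variables (k : fieldType) (n d : nat) (V : 'M[int]_(d, n)) (sigma : {set 'I_d}).
Hypothesis pchar0 : [pchar k] =i pred0.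
Variables (F : lmodType (weyl_algebra k d)) (Fgr : class_group V -> set F).
Hypothesis thF : theta_graded Fgr.
Variable cd : chart_data V sigma.
Notation J := (~: sigma)%SET.
Notation K := {fraction {mpoly k[d]}}.
Notation R0 := (chart_ring k V sigma).
Notation M0 := (locgr Fgr (J := J) 0).

Lemma chart_modE : chart_mod Fgr sigma = M0.
Proof.
apply/seteqP; split=> u [f [l [hf ->]]]; exists f, l; split=> //.
  by rewrite add0r.
by rewrite add0r in hf.
Qed.

(** Two preimages of D differ by an element of the kernel of phi_sigma, so the choice made by [xget]
    is immaterial on sections. *)
Lemma chart_actE (P : weyl k J) (D : R0 -> R0) u :
  chart_phi P D -> M0 u -> chart_act D u = P *: u.
Proof.
move=> PD hu; rewrite /chart_act; case: xgetP => [Q _ QD|/(_ P)//].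
apply/eqP; rewrite -subr_eq0 -scalerBl; apply/eqP.
case: PD QD => gP hP [gQ hQ].
apply: (phi_kernel pchar0 thF cd) hu; first exact: weyl_grB.
move=> y hy; rewrite weylDE weylNE -[y]/(val (mkchart hy)) hP hQ.
by rewrite subrr.
Qed.

Lemma chart_phi_inj (P : weyl k J) (D E : R0 -> R0) :
  chart_phi P D -> chart_phi P E -> D = E.
Proof. by move=> [_ h] [_ h']; apply/funext => r; apply: val_inj; rewrite -h -h'. Qed.

(** The filtered ring (A_(x^sigmahat))_0, kept as a family of subsets of the localized Weyl algebra
    instead of a type of its own. *)
Definition BF0 (m : nat) : set (weyl k J) :=
  [set P | weyl_gr (0 : class_group V) P /\ weyl_order m P].

Lemma BF0_filtered : filtered_ring BF0.
Proof.
split.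
- by move=> m; split; [exact: weyl_gr0|exact: weyl_order0].
- by move=> m P Q [? ?] [? ?]; split; [exact: weyl_grB|exact: weyl_orderB].
- by move=> m P [? ?]; split=> //; apply: (@weyl_order_le _ _ pchar0 _ m).
- by split; [exact: weyl_gr1|exact: order_poly].
- move=> m m' P Q [gP oP] [gQ oQ]; split; last exact: weyl_orderM.
  by rewrite -[0]addr0; exact: weyl_grM.
move=> m m' P Q [gP oP] [gQ oQ]; have := weyl_order_comm pchar0 oP oQ.
case: (m + m')%N => //= l h; split=> //; apply: weyl_grB => //.
  by rewrite -[0]addr0; exact: weyl_grM.
by rewrite -[0]addr0; exact: weyl_grM.
Qed.

Lemma chart_lift_BF0 m (D : R0 -> R0) : chart_diff m D ->
  exists2 P, BF0 m P & chart_phi P D.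
Proof.
by move=> hD; have [P PD oP] := chart_phi_lift pchar0 cd hD; exists P => //; split=> //; case: PD.
Qed.

Lemma BF0_phi m P : BF0 m P -> exists2 D : R0 -> R0, chart_diff m D & chart_phi P D.
Proof.
move=> [gP oP]; have [D PD] := chart_phi_ex pchar0 gP; exists D => //.
exact: chart_phi_diff PD oP.
Qed.

(** phi_sigma maps [BF0 m] onto the operators of order at most m, and an operator acts on sections
    as any of its lifts does. *)
Lemma good_chartP (G : nat -> set (loc F J)) :
  good_filtration (@chart_diff k n d V sigma) (@chart_act k n d V F sigma) (chart_mod Fgr sigma) G
  <-> good_filtration BF0 *:%R M0 G.
Proof.
rewrite chart_modE; split=> -[h1 h2 h3 h4 h5].
all: have GM l u : G l u -> M0 u by move=> hu; rewrite -h3; exists l.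
- split=> // [m l P u /BF0_phi[D hD PD] hu|].
    by rewrite -(chart_actE PD (GM _ _ hu)); exact: h4.
  have [r [e [g [hg h]]]] := h5; exists r, e, g; split=> // l u /h[b [hb hu]].
  have /choice[P hP] : forall i, exists P : weyl k J, (e i <= l)%N ->
      BF0 (l - e i)%N P /\ chart_phi P (b i).
    move=> i; case: (leqP (e i) l) => [le|lt]; last by exists 0.
    by have [P ? ?] := chart_lift_BF0 (hb i le); exists P.
  exists P; split=> [i /hP[]//|].
  move: hu; congr (fil_prev G l (u - _)); apply: eq_bigr => i /hP[_ Pi].
  exact: chart_actE Pi (GM _ _ (hg i)).
split=> // [m l D u /chart_lift_BF0[P hP PD] hu|].
  by rewrite (chart_actE PD (GM _ _ hu)); exact: h4.
have [r [e [g [hg h]]]] := h5; exists r, e, g; split=> // l u /h[P [hP hu]].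
have /choice[b hb] : forall i, exists b : R0 -> R0, (e i <= l)%N ->
    chart_diff (l - e i)%N b /\ chart_phi (P i) b.
  move=> i; case: (leqP (e i) l) => [le|lt]; last by exists (fun => 0).
  by have [D ? ?] := BF0_phi (hP i le); exists D.
exists b; split=> [i /hb[]//|].
move: hu; congr (fil_prev G l (u - _)); apply: eq_bigr => i /hb[_ Pi].
by rewrite (chart_actE Pi (GM _ _ (hg i))).
Qed.

Section CotPoint.
Variable chi : cot_chart k V sigma.

Definition phiD (P : weyl k J) : R0 -> R0 := xget (fun => 0) [set D | chart_phi P D].

Lemma phiDP P : weyl_gr (0 : class_group V) P -> chart_phi P (phiD P).
Proof.
by move=> /(chart_phi_ex pchar0)[D hD]; rewrite /phiD; case: xgetP => [//|/(_ D)].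
Qed.

Lemma phiDE P (D : R0 -> R0) : chart_phi P D -> phiD P = D.
Proof. by move=> h; apply: chart_phi_inj (h); apply: phiDP; case: h. Qed.

(** The pullback of the cotangent point chi along phi_sigma. *)
Definition chiW (m : nat) (P : weyl k J) : k := chi m (phiD P).

Lemma phiD_diff m P : BF0 m P -> chart_diff m (phiD P).
Proof. by move=> [gP oP]; apply: chart_phi_diff oP => //; exact: phiDP. Qed.

Lemma chiW_character : gr_character BF0 chiW.
Proof.
have hD m P Q : BF0 m P -> BF0 m Q -> chiW m (P + Q) = chiW m P + chiW m Q.
  move=> hP hQ; rewrite /chiW -(cot_valD chi (phiD_diff hP) (phiD_diff hQ)); congr (chi m _).
  case: hP hQ => /phiDP[gP eP] _ [/phiDP[gQ eQ] _].
  by apply: phiDE; split=> [|r]; [exact: weyl_grD|rewrite weylDE eP eQ].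
split=> //.
- case=> [|m] P /=; last by move=> /phiD_diff; exact: cot_val0.
  move=> ->; have h0 : BF0 0 0 by exact: (fr0 BF0_filtered).
  by have := hD 0%N 0 0 h0 h0; rewrite addr0 => /eqP; rewrite -subr_eq0 opprD addNKr oppr_eq0 => /eqP.
- move=> m m' P Q hP hQ.
  rewrite /chiW -(cot_valM chi (phiD_diff hP) (phiD_diff hQ)); congr (chi _ _).
  case: hP hQ => /phiDP[gP eP] _ [/phiDP[gQ eQ] _].
  by apply: phiDE; split=> [|r]; [rewrite -[0]addr0; exact: weyl_grM|rewrite weylME eQ eP].
rewrite /chiW -[RHS](cot_valC chi 1); congr (chi _ _); apply: phiDE.
split=> [|r]; first exact: weyl_gr1.
by rewrite weyl1E chart_valM /= mpolyC1 tofrac1 mul1r.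
Qed.

Lemma in_support_chartP (G : nat -> set (loc F J)) : good_filtration BF0 *:%R M0 G ->
  in_support (@chart_diff k n d V sigma) (@chart_act k n d V F sigma) G chi
  <-> supp_at BF0 G chiW.
Proof.
move=> good; rewrite -(supp_atP BF0_filtered good chiW_character).
have GM l u : G l u -> M0 u by move=> hu; rewrite -(fil_exhaustive good); exists l.
split=> -[c [x [hx h]]]; exists c, x; split=> // a s hs nz hann.
  apply: (h a (fun m => phiD (s m)) (fun m => phiD_diff (hs m)) nz) => l.
  have := hann l; congr (fil_prev G l _); apply: eq_bigr => m _; apply: eq_bigr => j _.
  by rewrite (chart_actE (phiDP (proj1 (hs m))) (GM _ _ (hx j))).
have /choice[P hP] : forall m, exists P, BF0 m P /\ chart_phi P (s m).
  by move=> m; have [P ? ?] := chart_lift_BF0 (hs m); exists P.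
apply: (h a P) => [m||l]; first by case: (hP m).
  move: nz; congr (_ != 0); apply: eq_bigr => m _.
  by rewrite /chiW (phiDE (proj2 (hP m))).
have := hann l; congr (fil_prev G l _); apply: eq_bigr => m _; apply: eq_bigr => j _.
exact: chart_actE (proj2 (hP m)) (GM _ _ (hx j)).
Qed.

End CotPoint.
End ChartAction.

Lemma homogeneous_generators (k : fieldType) (n d : nat) (V : 'M[int]_(d, n))
    (F : lmodType (weyl_algebra k d)) (Fgr : class_group V -> set F) :
  theta_graded Fgr -> finitely_generated F ->
  exists (r : nat) (g : 'I_r -> F) (cl : 'I_r -> class_group V),
    (forall i, Fgr (cl i) (g i)) /\
    forall f, exists a : 'I_r -> weyl_algebra k d, f = \sum_(i < r) a i *: g i.
Proof.
move=> thF [r0 [g0 hg0]].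
have /choice[sh hsh] : forall i, exists sh : seq (class_group V) * (class_group V -> F),
    (forall c, Fgr c (sh.2 c)) /\ g0 i = \sum_(c <- sh.1) sh.2 c.
  by move=> i; have [s [h [? ?]]] := gr_span thF (g0 i); exists (s, h).
pose L : seq (class_group V * F) :=
  flatten [seq [seq (c, (sh i).2 c) | c <- (sh i).1] | i <- enum 'I_r0].
have hL p : p \in L -> Fgr p.1 p.2.
  by move=> /flatten_mapP[i _ /mapP[c _ ->]] /=; case: (hsh i).
exists (size L), (fun i => (nth (0, 0) L i).2), (fun i => (nth (0, 0) L i).1); split.
  by move=> i; apply: hL; exact: mem_nth.
set span := fun f => exists a : 'I_(size L) -> weyl_algebra k d,
   f = \sum_(i < size L) a i *: (nth (0, 0) L i).2.
have spanD f f' : span f -> span f' -> span (f + f').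
  move=> [a ->] [b ->]; exists (fun i => a i + b i).
  by rewrite -big_split; apply: eq_bigr => i _; rewrite scalerDl.
have spanZ a f : span f -> span (a *: f).
  move=> [b ->]; exists (fun i => a * b i).
  by rewrite scaler_sumr; apply: eq_bigr => i _; rewrite scalerA.
have span0 : span 0.
  by exists (fun => 0); rewrite big1 // => i _; rewrite scale0r.
have spanL p : p \in L -> span p.2.
  move=> hp; have lt : (index p L < size L)%N by rewrite index_mem.
  exists (fun i => if i == Ordinal lt then 1 else 0).
  rewrite (bigD1 (Ordinal lt)) //= eqxx scale1r nth_index // big1 ?addr0 // => i /negPf->.
  by rewrite scale0r.
move=> f; have [c ->] := hg0 f; rewrite -/(span _).
elim/big_ind: _ => // i _; apply: spanZ; have [_ ->] := hsh i.
rewrite big_seq; elim/big_ind: _ => // c' hc'.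
apply: (spanL (c', (sh i).2 c')); apply/flatten_mapP; exists i; first by rewrite mem_enum.
by apply/mapP; exists c'.
Qed.

(** * Filtrations generated by homogeneous generators *)

Section GradedFiltration.
Variables (k : fieldType) (n d : nat) (V : 'M[int]_(d, n)).
Hypothesis pchar0 : [pchar k] =i pred0.
Variables (F : lmodType (weyl_algebra k d)) (Fgr : class_group V -> set F).
Hypothesis thF : theta_graded Fgr.
Variables (r : nat) (g : 'I_r -> F) (cl : 'I_r -> class_group V).
Hypothesis hgr : forall i, Fgr (cl i) (g i).
Hypothesis hgen : forall f, exists a : 'I_r -> weyl_algebra k d, f = \sum_(i < r) a i *: g i.

Definition Fil0 (l : nat) : set F :=
  [set f | exists2 a : 'I_r -> weyl_algebra k d, (forall i, weyl_order l (a i)) &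
           f = \sum_(i < r) a i *: g i].

Lemma Fil0_gen i : Fil0 0 (g i).
Proof.
exists (fun j => if j == i then 1 else 0) => [j|].
  by case: ifP => _; [exact: order_poly|exact: weyl_order0].
by rewrite (bigD1 i) //= eqxx scale1r big1 ?addr0 // => j /negPf->; rewrite scale0r.
Qed.

Lemma Fil0_good : good_A_filtration Fil0.
Proof.
split.
- move=> l; split.
    exists (fun => 0) => [i|]; first exact: weyl_order0.
    by rewrite big1 // => i _; rewrite scale0r.
  move=> u v [a ha ->] [b hb ->]; exists (fun i => a i - b i).
    by move=> i; exact: weyl_orderB.
  by rewrite -sumrB; apply: eq_bigr => i _; rewrite scalerBl.
- move=> l u [a ha ->]; exists a => // i; exact: weyl_order_le (ha i).
- apply/seteqP; split=> // f _; have [a ->] := hgen f.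
  have /choice[m hm] : forall i, exists m, weyl_order m (a i).
    by move=> i; exact: order_ex.
  exists (\sum_i m i)%N => //; exists a => // i.
  by apply: weyl_order_le (hm i) => //; rewrite (bigD1 i) //= leq_addr.
- move=> m l b u hb [a ha ->]; exists (fun i => b * a i).
    by move=> i; exact: weyl_orderM.
  by rewrite scaler_sumr; apply: eq_bigr => i _; rewrite scalerA.
exists r, (fun => 0%N), g; split; first exact: Fil0_gen.
move=> l u [a ha ->]; exists a; split=> [i _|].
  by rewrite subn0.
rewrite (_ : _ - _ = 0).
  case: l {ha} => [|l] //=; exists (fun => 0) => [i|]; first exact: weyl_order0.
  by rewrite big1 // => i _; rewrite scale0r.
by apply/eqP; rewrite subr_eq0; apply/eqP; apply: eq_bigl.
Qed.

(** The degree-c part of the filtration, with coefficients homogeneous of the degree that c and the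
    generator impose. *)
Definition FilH (l : nat) (c : class_group V) : set F :=
  [set f | exists2 a : 'I_r -> weyl_algebra k d,
     (forall i, weyl_order l (a i) /\ weyl_gr (c - cl i) (a i)) &
     f = \sum_(i < r) a i *: g i].

Lemma FilH_Fil0 l c f : FilH l c f -> Fil0 l f.
Proof. by move=> [a ha ->]; exists a => // i; case: (ha i). Qed.

Lemma FilH_Fgr l c f : FilH l c f -> Fgr c f.
Proof.
move=> [a ha ->]; elim/big_ind: _ => [|u v|i _]; [exact: Fgr0|exact: FgrD|].
by rewrite -(subrK (cl i) c); apply: (gr_action thF) => //; case: (ha i).
Qed.

Lemma FilH0 l c : FilH l c 0.
Proof.
exists (fun => 0) => [i|]; first by split; [exact: weyl_order0|exact: weyl_gr0].
by rewrite big1 // => i _; rewrite scale0r.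
Qed.

Lemma FilHD l c u v : FilH l c u -> FilH l c v -> FilH l c (u + v).
Proof.
move=> [a ha ->] [b hb ->]; exists (fun i => a i + b i).
  by move=> i; case: (ha i) (hb i) => ? ? [? ?]; split; [exact: weyl_orderD|exact: weyl_grD].
by rewrite -big_split; apply: eq_bigr => i _; rewrite scalerDl.
Qed.

Lemma FilH_gen l i P : weyl_order l P -> forall c, weyl_gr c P -> FilH l (c + cl i) (P *: g i).
Proof.
move=> oP c gP; exists (fun j => if j == i then P else 0) => [j|].
  case: eqP => [->|_]; first by rewrite addrK.
  by split; [exact: weyl_order0|exact: weyl_gr0].
by rewrite (bigD1 i) //= eqxx big1 ?addr0 // => j /negPf->; rewrite scale0r.
Qed.

Lemma Fil0_dec l f : Fil0 l f -> dec (FilH l) f.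
Proof.
move=> [a ha ->]; rewrite big_seq; elim/big_ind: _ => [|u v|i _].
- by apply: dec0; exact: FilH0.
- by apply: decD; [exact: FilH0|exact: FilHD].
have [s [h [us hh ->]]] := weyl_dec V pchar0 (ha i).
rewrite scaler_suml; apply: dec_sum; [exact: FilH0|exact: FilHD|] => c _.
by apply: (dec1 (@FilH0 l) (c := c + cl i)); case: (hh c) => ? ?; exact: FilH_gen.
Qed.

(** Uniqueness of homogeneous components: both decompositions are extended by zero to the union of
    their degrees, and [gr_direct] is applied to the difference. *)
Lemma dec_comp (Q : class_group V -> set F) (s : seq (class_group V))
    (h : class_group V -> F) : (forall c, Q c 0) ->
  (forall c f, Q c f -> Fgr c f) -> dec Q (\sum_(c <- s) h c) ->
  uniq s -> (forall c, Fgr c (h c)) -> forall c, c \in s -> Q c (h c).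
Proof.
move=> Q0 QF [s' [q [us' hq e]]] us hh c hc.
pose t := undup (s ++ s').
pose h' c := if c \in s then h c else 0.
pose q' c := if c \in s' then q c else 0.
have aux (s1 : seq (class_group V)) (p : class_group V -> F) : uniq s1 -> {subset s1 <= s ++ s'} ->
    \sum_(c <- s1) p c = \sum_(c <- t) (if c \in s1 then p c else 0).
  move=> ut sub; rewrite -big_mkcond -big_filter; apply: perm_big.
  apply: uniq_perm => //; first by rewrite filter_uniq ?undup_uniq.
  move=> c'; rewrite mem_filter mem_undup andb_idr //; exact: sub.
have z : \sum_(c <- t) (h' c - q' c) = 0.
  rewrite sumrB -!aux // ?e ?subrr // => c' hc'; by rewrite mem_cat hc' ?orbT.
have := gr_direct thF (undup_uniq _) _ z (c := c).
have hF c' : Fgr c' (h' c' - q' c').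
  apply: FgrB => //; rewrite /h' /q'; case: ifP => _ //; try exact: Fgr0.
  exact: QF.
move=> /(_ hF); rewrite mem_undup mem_cat hc => /(_ isT) /eqP.
rewrite subr_eq0 /h' /q' hc => /eqP->; case: ifP => _; [exact: hq|exact: Q0].
Qed.

Lemma Fil0_FilH l c f : Fil0 l f -> Fgr c f -> FilH l c f.
Proof.
move=> hf hc; have := @dec_comp (FilH l) [:: c] (fun c' => if c' == c then f else 0).
move=> /(_ (@FilH0 l) (@FilH_Fgr l)); rewrite big_seq1 eqxx => /(_ (Fil0_dec hf) isT).
move=> h; have /h : forall c', Fgr c' (if c' == c then f else 0).
  by move=> c'; case: eqP => [->|_] //; exact: Fgr0.
by move=> /(_ c); rewrite inE eqxx => /(_ isT).
Qed.

Definition prevH (L : nat) (c : class_group V) : set F :=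
  if L is l.+1 then FilH l c else [set 0].

Lemma prevH0 L c : prevH L c 0.
Proof. by case: L => // l; exact: FilH0. Qed.

Lemma prevH_Fgr L c f : prevH L c f -> Fgr c f.
Proof. by case: L => [->|l]; [exact: Fgr0|exact: FilH_Fgr]. Qed.

Lemma prev_dec L f : fil_prev Fil0 L f -> dec (prevH L) f.
Proof.
case: L => [->|l]; last exact: Fil0_dec.
by apply: dec0; exact: (prevH0 0).
Qed.

Lemma prevH_prev L c f : prevH L c f -> fil_prev Fil0 L f.
Proof. by case: L => // l; exact: FilH_Fil0. Qed.

(** The annihilator of a graded module is graded. On a homogeneous q of degree c', the products p_c
    q are the components of P q, in the distinct degrees c + c', so each inherits the drop. *)
Lemma drops_dec m (P : weyl_algebra k d) : weyl_order m P -> drops Fil0 m P ->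
  exists (s : seq (class_group V)) (p : class_group V -> weyl_algebra k d),
    [/\ forall c, weyl_gr c (p c) /\ weyl_order m (p c),
        forall c, c \in s -> drops Fil0 m (p c) & P = \sum_(c <- s) p c].
Proof.
move=> oP dP; have [s [p [us hp e]]] := weyl_dec V pchar0 oP.
exists s, p; split=> // c hc l u hu.
have good := Fil0_good.
have [s' [q [us' hq eu]]] := Fil0_dec hu.
rewrite eu scaler_sumr; elim/big_ind: _ => [|x y|c' _].
- exact: (prev0 good).
- exact: (prevD good).
have hu' := hq c'; apply: (@prevH_prev _ (c + c')).
have := @dec_comp (prevH (m + l)) [seq c + c' | c <- s] (fun x => p (x - c') *: q c').
move=> /(_ (@prevH0 _) (@prevH_Fgr _)) /=.
have eP : \sum_(x <- [seq c + c' | c <- s]) p (x - c') *: q c' = P *: q c'.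
  rewrite big_map e scaler_suml; apply: eq_bigr => x _; by rewrite addrK.
rewrite eP => /(_ (prev_dec (dP l _ (FilH_Fil0 hu')))).
have um : uniq [seq c + c' | c <- s] by rewrite map_inj_uniq //; exact: addIr.
have hF x : Fgr x (p (x - c') *: q c').
  rewrite -{1}(subrK c' x); apply: (gr_action thF); first by case: (hp (x - c')).
  exact: FilH_Fgr hu'.
move=> /(_ um hF (c + c')); rewrite addrK; apply; exact: map_f.
Qed.

End GradedFiltration.

(** * The induced filtrations on the localizations and on their degree-0 parts *)

Section ChartFiltration.
Variables (k : fieldType) (n d : nat) (V : 'M[int]_(d, n)).
Hypothesis pchar0 : [pchar k] =i pred0.
Variables (F : lmodType (weyl_algebra k d)) (Fgr : class_group V -> set F).
Hypothesis thF : theta_graded Fgr.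
Variables (r : nat) (g : 'I_r -> F) (cl : 'I_r -> class_group V).
Hypothesis hgr : forall i, Fgr (cl i) (g i).
Hypothesis hgen : forall f, exists a : 'I_r -> weyl_algebra k d, f = \sum_(i < r) a i *: g i.
Notation K := {fraction {mpoly k[d]}}.
Notation "f %:F" := (@FracField.tofrac {mpoly k[d]} f).
Notation lmon := (@lmon k d).
Notation Fil0 := (Fil0 g).
Let good0 : good_A_filtration Fil0 := Fil0_good pchar0 hgen.

Section Chart.
Variable J : {set 'I_d}.

Definition lf (l : nat) : set (loc F J) :=
  [set u | exists f N, Fil0 l f /\ u = frac_of J f N].

Lemma xpow_Fil0 N l f : Fil0 l f -> Fil0 l (xpow k J N *: f).
Proof.
by move=> hf; rewrite -[l]add0n; apply: (fil_act good0) => //; exact: order_poly.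
Qed.

Lemma lfD l u v : lf l u -> lf l v -> lf l (u + v).
Proof.
move=> [f [N [hf ->]]] [f' [N' [hf' ->]]].
exists (xpow k J N' *: f + xpow k J N *: f'), (N' + N)%N; split.
  by apply: (filD good0); exact: xpow_Fil0.
by rewrite -frac_ofD frac_of_scale [(N' + N)%N in X in _ = _ + X]addnC frac_of_scale.
Qed.

Lemma lf_act m l P u : weyl_order m P -> lf l u -> lf (m + l) (P *: u).
Proof.
move=> oP [f [N [hf ->]]]; have [N' [Q [hQ oQ _ _]]] := locZ_frac V pchar0 F P N.
exists (Q *: f), N'; split=> //; exact: (fil_act good0 (oQ _ oP)).
Qed.

Lemma lf_gen i : lf 0 (frac_of J (g i) 0).
Proof. by exists (g i), 0%N; split=> //; exact: Fil0_gen. Qed.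

Lemma frac0D (f f' : F) : frac_of J (f + f') 0 = frac_of J f 0 + frac_of J f' 0.
Proof. by rewrite frac_ofD. Qed.

Lemma frac0_sum (I : Type) (s : seq I) (f : I -> F) :
  frac_of J (\sum_(i <- s) f i) 0 = \sum_(i <- s) frac_of J (f i) 0.
Proof. by elim: s => [|i s IH]; rewrite ?big_nil // !big_cons frac0D IH. Qed.

Lemma frac_expand (a : 'I_r -> weyl_algebra k d) N :
  frac_of J (\sum_(i < r) a i *: g i) N
    = \sum_(i < r) (wmul J (xinv k J N) * wext J (a i)) *: frac_of J (g i) 0.
Proof.
rewrite (frac_xinv pchar0) frac0_sum scaler_sumr; apply: eq_bigr => i _.
by rewrite -scalerA (wextZ_frac pchar0).
Qed.

Lemma lf_good : good_filtration (@weyl_order k d J) *:%R setT lf.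
Proof.
have lfN l u : lf l u -> lf l (- u).
  move=> [f [N [hf ->]]]; exists (- f), N; split; first exact: (filN good0).
  exact: locNE.
have lf0 l : lf l 0 by exists 0, 0%N; split; [exact: (fil0 good0)|].
split.
- by move=> l; split=> // u v hu hv; apply: lfD => //; exact: lfN.
- by move=> l u [f [N [hf ->]]]; exists f, N; split=> //; exact: (fil_mono good0).
- apply/seteqP; split=> // u _; elim/frac_of_ind: u => f N.
  have : setT f by []. rewrite -(fil_exhaustive good0) => -[l _ hf].
  by exists l => //; exists f, N.
- by move=> m l P u; exact: lf_act.
exists r, (fun => 0%N), (fun i => frac_of J (g i) 0); split; first exact: lf_gen.
move=> l u [f [N [[a ha ->] ->]]].
exists (fun i => wmul J (xinv k J N) * wext J (a i)); split.
  move=> i _; rewrite subn0 -[l]add0n; apply: weyl_orderM => //.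
    by apply: order_wmul => //; exact: (xinv_Sloc k V).
  by apply: wext_order => //; exact: finset.sub0set.
rewrite frac_expand (_ : _ - _ = 0); first by case: l {ha} => //= l.
by apply/eqP; rewrite subr_eq0; apply/eqP; apply: eq_bigl.
Qed.

Notation M0 := (locgr Fgr (J := J) 0).

Definition G0 (l : nat) : set (loc F J) := lf l `&` M0.

(** One representative of u has small order, another is homogeneous. They agree after multiplication
    by powers of x^J, which preserve both properties. *)
Lemma G0_homog l u : G0 l u -> exists f N, FilH g cl l (xdeg V J *+ N) f /\ u = frac_of J f N.
Proof.
move=> [[f [N [hf ->]]] [f' [N' [hf' /frac_ofP[s e]]]]].
exists (xpow k J (N' + s) *: f), (N' + s + N)%N; split; last by rewrite frac_of_scale.
apply: (Fil0_FilH pchar0 thF hgr); first exact: xpow_Fil0.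
rewrite e; have := xpow_gr pchar0 thF J (N + s) hf'; congr (Fgr _ _).
by rewrite add0r -mulrnDr; congr (_ *+ _); lia.
Qed.

Lemma M0N u : M0 u -> M0 (- u).
Proof.
move=> [f [N [hf ->]]]; exists (- f), N; split; last exact: locNE.
by rewrite -sub0r; apply: FgrB => //; exact: Fgr0.
Qed.

Lemma prev_G0 L u : fil_prev lf L u -> M0 u -> fil_prev G0 L u.
Proof. by case: L => // L ? ?; split. Qed.

Lemma G0_prev L u : fil_prev G0 L u -> fil_prev lf L u.
Proof. by case: L => // L []. Qed.

Lemma spev_set0 (z : 'rV[k]_d * 'rV[k]_d) q : (xprod k J).@[z.1 0] != 0 -> Sploc finset.set0 q ->
  spev z finset.set0 q = spev z J q.
Proof.
move=> xz0 /(Sploc_clear)[N [q' e]].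
have {e} -> : q = Sp_frac q'.
  by move: e; rewrite /xprod big_set0 expr1n tofrac1 scale1r.
rewrite !spev_poly //; apply/negP; rewrite /xprod big_set0 rmorph1; exact/negP/oner_neq0.
Qed.

Lemma chz_wext (z : 'rV[k]_d * 'rV[k]_d) m (Q : weyl_algebra k d) : (xprod k J).@[z.1 0] != 0 ->
  chz z m (wext J Q) = chz z m Q.
Proof.
move=> xz0; have hs : Sploc finset.set0 (wsymb m Q) by exact: wsymb_Sploc.
rewrite /chz (spev_set0 xz0 hs); congr (spev z J _).
by rewrite /wsymb nf_wext; [|exact: pchar0|exact: finset.sub0set].
Qed.

Lemma chz_unit (z : 'rV[k]_d * 'rV[k]_d) (a : K) : (xprod k J).@[z.1 0] != 0 -> a != 0 ->
  Sloc J a -> Sloc J a^-1 -> chz z 0 (wmul J a) != 0.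
Proof.
move=> xz0 a0 ha hv; apply/eqP => e; have := chz1 xz0 pchar0.
rewrite -(wmul1 pchar0 J) -(mulfV a0) wmulM // -[0%N]/(0 + 0)%N.
rewrite (chzM xz0 pchar0 (order_wmul pchar0 ha) (order_wmul pchar0 hv)) e mul0r.
by move=> /esym/eqP; rewrite oner_eq0.
Qed.

End Chart.

Section SmoothChart.
Variable sigma : {set 'I_d}.
Variable cd : chart_data V sigma.
Notation J := (~: sigma)%SET.
Notation M0 := (locgr Fgr (J := J) 0).

Lemma unit_mon_lmon (c : class_group V) : exists m : 'rV[int]_d,
  [/\ forall i, i \in sigma -> m 0 i = 0, Sgr J c (lmon m) & Sgr J (- c) (lmon (- m))].
Proof.
have [m [hm ms]] := unit_mon cd c; exists m; split=> //.
  by rewrite -hm; apply: lmon_Sgr; apply/nonneg_offP => j /ms->.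
rewrite -hm -raddfN; apply: lmon_Sgr; apply/nonneg_offP => j /ms.
by rewrite mxE => ->; rewrite oppr0.
Qed.

Lemma wmul_lmonK m : Sloc J (lmon m) -> Sloc J (lmon (- m)) ->
  wmul J (lmon m) * wmul J (lmon (- m)) = 1.
Proof.
by move=> h h'; rewrite -wmulM // -lmonD subrr lmon0 wmul1.
Qed.

(** Unit monomials x^(m_i) of the classes of the g_i move the generators to degree 0: the x^(-m_i)
    g_i generate, the coefficients absorbing x^(m_i). *)
Lemma G0_good : good_filtration (@BF0 k n d V sigma) *:%R M0 (@G0 J).
Proof.
have good := lf_good J.
split.
- move=> l; split; first by split; [exact: (fil0 good)|exact: locgr0].
  move=> u v [hu gu] [hv gv]; split; first exact: (filB good).
  by apply: locgrD => //; exact: M0N.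
- by move=> l u [hu gu]; split=> //; exact: (fil_mono good).
- apply/seteqP; split=> [u [l _ []] //|u gu].
  have : setT u by []. rewrite -(fil_exhaustive good) => -[l _ hu].
  by exists l.
- move=> m l P u [gP oP] [hu gu]; split; first exact: (fil_act good).
  by rewrite -[0]addr0; exact: locgrZ.
have /choice[mm hmm] := fun i => unit_mon_lmon (cl i).
exists r, (fun => 0%N), (fun i => wmul J (lmon (- mm i)) *: frac_of J (g i) 0); split.
  move=> i; have [_ h1 h2] := hmm i; split.
    apply: (@lf_act J 0 0); last exact: lf_gen.
    by apply: order_wmul => //; exact: Sgr_Sloc h2.
  rewrite -(addNr (cl i)); apply: locgrZ => //; first exact: weyl_gr_wmul.
  by exists (g i), 0%N; rewrite mulr0n addr0.
move=> l u /G0_homog[f [N [[a ha ->] ->]]].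
exists (fun i => wmul J (xinv k J N) * wext J (a i) * wmul J (lmon (mm i))); split.
  move=> i _; have [_ h1 h2] := hmm i; have [oa ga] := ha i; split.
    have -> : 0 = - (xdeg V J *+ N) + (xdeg V J *+ N - cl i) + cl i.
      by rewrite addrA addNr add0r addNr.
    apply: weyl_grM => //; last exact: weyl_gr_wmul.
    apply: weyl_grM => //; first by apply: weyl_gr_wmul => //; exact: xinv_Sgr.
    by apply: wext_gr => //; exact: finset.sub0set.
  rewrite subn0 -[l]addn0; apply: weyl_orderM => //; last first.
    by apply: order_wmul => //; exact: Sgr_Sloc h1.
  rewrite -[l]add0n; apply: weyl_orderM => //; last first.
    by apply: wext_order => //; exact: finset.sub0set.
  by apply: order_wmul => //; exact: (xinv_Sloc k V).
rewrite frac_expand (_ : _ - _ = 0).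
  by case: l {ha} => //= l; split; [exact: (fil0 good)|exact: locgr0].
apply/eqP; rewrite subr_eq0; apply/eqP; apply: eq_big => // i _.
have [_ h1 h2] := hmm i.
rewrite scalerA -[_ * wmul J (lmon (mm i)) * _]mulrA wmul_lmonK ?mulr1 //; [exact: Sgr_Sloc h1|exact: Sgr_Sloc h2].
Qed.

Lemma drops_Fil0 m (P : weyl_algebra k d) : weyl_order m P ->
  (forall i, fil_prev Fil0 m (P *: g i)) -> drops Fil0 m P.
Proof.
move=> oP h l u [a ha ->]; rewrite scaler_sumr.
elim/big_ind: _ => [|x y|i _]; [exact: (prev0 good0)|exact: (prevD good0)|].
rewrite -[(m + l)%N]addn0.
apply: (drops_comm (weyl_filtered _ pchar0) good0 oP (ha i)).
  exact: Fil0_gen.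
by rewrite addn0.
Qed.

(* If P lowers the filtration on the chart, then x^(JN) P lowers the filtration
   on F for N large. *)
Lemma drops_chart_to_A m (P : weyl k J) : BF0 V m P -> drops (@G0 J) m P ->
  exists N (Q : weyl_algebra k d), [/\ weyl_order m Q, drops Fil0 m Q &
    wext J Q = wmul J (xprod k J ^+ N)%:F * P].
Proof.
move=> [gP oP] dP; have good := lf_good J.
have [N0 [Q0 [nQ0 Q0E oQ0 _]]] := weyl_clear V pchar0 P.
have hx N : Sloc J ((xprod k J ^+ N)%:F : K) by exact: Sloc_poly.
have eQ0 : wext J Q0 = wmul J (xprod k J ^+ N0)%:F * P.
  by apply: weyl_ext => y; rewrite weylME wextE ?wmulE // finset.sub0set.
have /choice[Ni hNi] : forall i, exists N, fil_prev Fil0 m (xpow k J N *: (Q0 *: g i)).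
  move=> i; have [mm [_ h1 h2]] := unit_mon_lmon (cl i).
  have l1 := Sgr_Sloc h1; have l2 := Sgr_Sloc h2.
  pose g' := wmul J (lmon (- mm)) *: frac_of J (g i) 0.
  have Gg' : @G0 J 0 g'.
    split.
      apply: (@lf_act J 0 0); last exact: lf_gen.
      exact: order_wmul.
    rewrite -(addNr (cl i)); apply: locgrZ => //; first exact: weyl_gr_wmul.
    by exists (g i), 0%N; rewrite mulr0n addr0.
  have : fil_prev (@lf J) m (P *: frac_of J (g i) 0).
    have -> : frac_of J (g i) 0 = wmul J (lmon mm) *: g'.
      by rewrite /g' scalerA wmul_lmonK // scale1r.
    (* The hypothesis on P concerns degree 0 only and is applied to g'; multiplication by the unit
       x^mm carries the drop over to g_i. *)
    have := drops_comm (weyl_filtered _ pchar0) good oP (order_wmul pchar0 l1) (proj1 Gg').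
    by rewrite !addn0; apply; apply: G0_prev; rewrite -[m]addn0; exact: dP.
  move=> hp; have [h [N' [hh e]]] : exists h N', fil_prev Fil0 m h /\
      P *: frac_of J (g i) 0 = frac_of J h N'.
    case: (m) hp => [->|m' [h [N' [hh e]]]]; last by exists h, N'.
    by exists 0, 0%N.
  have : frac_of J (Q0 *: g i) 0 = frac_of J (xpow k J N0 *: h) N'.
    rewrite -(wextZ_frac pchar0) eQ0 -scalerA e.
    have -> : (xprod k J ^+ N0)%:F = (xprod k J ^+ N0)%:F / (xprod k J ^+ 0)%:F.
      by rewrite expr0 tofrac1 divr1.
    by rewrite wmul_fracZ // addn0.
  move=> /frac_ofP[s es]; exists (N' + s)%N; rewrite es scalerA.
  rewrite -[m]add0n; apply: (fil_act_prev good0) => //.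
  by rewrite -xpowD; exact: order_poly.
pose N := (\sum_i Ni i)%N.
exists (N + N0)%N, (xpow k J N * Q0); split.
- by rewrite -[m]add0n; apply: weyl_orderM => //; [exact: order_poly|exact: oQ0].
- apply: drops_Fil0; first by rewrite -[m]add0n; apply: weyl_orderM => //; [exact: order_poly|exact: oQ0].
  move=> i; rewrite /N (bigD1 i) //= addnC xpowD -!scalerA.
  rewrite -[m]add0n; apply: (fil_act_prev good0) => //; exact: order_poly.
apply: weyl_ext => y; rewrite weylME wextE ?finset.sub0set // weylME wmulE // Q0E.
by rewrite [LHS]mulrA exprD tofracM.
Qed.

Variable z : 'rV[k]_d * 'rV[k]_d.
Hypothesis xz0 : (xprod k J).@[z.1 0] != 0.

Lemma supp_A_to_chart : supp_at (@weyl_order k d finset.set0) Fil0 (@chz k d z finset.set0) ->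
  supp_at (@BF0 k n d V sigma) (@G0 J) (@chz k d z J).
Proof.
move=> h m P hP dP; have [N [Q [oQ dQ e]]] := drops_chart_to_A hP dP.
have hq : chz z m (wext J Q) = 0 by rewrite (chz_wext m Q xz0); exact: h.
move: hq; rewrite e -[m in chz _ m _]add0n.
have hx : Sloc J ((xprod k J ^+ N)%:F : K) by exact: Sloc_poly.
have hxi : Sloc J (((xprod k J ^+ N)%:F)^-1 : K) by rewrite -xinvE; exact: (xinv_Sloc k V).
rewrite (chzM xz0 pchar0); [|exact: order_wmul|by case: hP].
move=> /eqP; rewrite mulf_eq0 => /orP[|/eqP//].
by rewrite (negPf (chz_unit xz0 (xprodF_neq0 k J N) hx hxi)).
Qed.

Lemma supp_chart_to_A : supp_at (@BF0 k n d V sigma) (@G0 J) (@chz k d z J) ->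
  supp_at (@weyl_order k d finset.set0) Fil0 (@chz k d z finset.set0).
Proof.
move=> h m Q oQ dQ; have good := lf_good J.
(* Only a homogeneous operator can be moved to degree 0 by a single monomial, so Q is first
   split. *)
have [s [p [hp dp ->]]] := drops_dec pchar0 thF hgr hgen oQ dQ.
suff hz c : c \in s -> chz z m (p c) = 0.
  have x00 : (xprod k finset.set0).@[z.1 0] != 0.
    by rewrite /xprod big_set0 rmorph1 oner_neq0.
  elim: s {dp} hz => [|c s IH] hz.
    rewrite big_nil; apply: (chz_prev x00 pchar0).
    by case: (m) => //= m'; exact: weyl_order0.
  rewrite big_cons (chzD x00 pchar0) hz ?inE ?eqxx // add0r IH // => c' hc'.
  by apply: hz; rewrite inE hc' orbT.
move=> hc; rewrite -(chz_wext m (p c) xz0); have [gp op] := hp c.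
have [mm [_ h1 h2]] := unit_mon_lmon (- c); rewrite opprK in h2.
have l1 := Sgr_Sloc h1; have l2 := Sgr_Sloc h2.
have sub0 := finset.sub0set J.
have oe : weyl_order m (wext J (p c)) by exact: wext_order.
pose P := wmul J (lmon mm) * wext J (p c).
have oP : weyl_order m P by rewrite -[m]add0n; apply: weyl_orderM => //; exact: order_wmul.
have gP : weyl_gr (0 : class_group V) P.
  rewrite -(addNr c); apply: weyl_grM => //; first exact: weyl_gr_wmul.
  exact: wext_gr.
have : chz z m P = 0.
  apply: h => // l u [hu gu]; apply: prev_G0; last by rewrite -[0]addr0; exact: locgrZ.
  move: hu => [f [N [hf ->]]]; rewrite /P -scalerA -[(m + l)%N]add0n.
  apply: (fil_act_prev good); first exact: order_wmul.
  have hx : Sloc J (xinv k J N) by exact: (xinv_Sloc k V).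
  rewrite (frac_xinv pchar0).
  have := drops_comm (weyl_filtered _ pchar0) good oe (order_wmul pchar0 hx) (l := l) (u := frac_of J f 0).
  rewrite addn0; apply.
    by exists f, 0%N.
  rewrite (wextZ_frac pchar0); have := dp c hc l f hf.
  case: (m + l)%N => [/= ->|L hL] //=.
  by exists (p c *: f), 0%N.
rewrite /P -[m in chz _ m _]add0n (chzM xz0 pchar0) //; last exact: order_wmul.
move=> /eqP; rewrite mulf_eq0 => /orP[|/eqP//].
rewrite (negPf (chz_unit xz0 (lmon_neq0 _ _) l1 _)) //.
by rewrite -lmonN.
Qed.

End SmoothChart.
End ChartFiltration.

(** * Characteristic varieties *)

Section CharacteristicVariety.
Variables (k : fieldType) (d : nat).
Hypothesis pchar0 : [pchar k] =i pred0.
Variable F : lmodType (weyl_algebra k d).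

Lemma x00 (z : 'rV[k]_d * 'rV[k]_d) : (xprod k (@finset.set0 'I_d)).@[z.1 0] != 0.
Proof. by rewrite /xprod big_set0 rmorph1 oner_neq0. Qed.

Lemma chz_Sp_frac (z : 'rV[k]_d * 'rV[k]_d) m (P : weyl_algebra k d) q :
  nf P = Sp_frac q -> chz z m P = Sp_eval z (pihomog mdeg m q).
Proof. by move=> e; rewrite /chz /wsymb e -Sp_frac_pihomog spev_poly // x00. Qed.

(** Ann(gr F) is homogeneous for the order, so vanishing at z of its radical can be tested on single
    symbols; a power of q vanishes at z only if q does. *)
Lemma Ch_condP (z : 'rV[k]_d * 'rV[k]_d) (Fil : nat -> set F) : good_A_filtration Fil ->
  (forall q, (exists N : nat, gr_ann Fil (q ^+ N)) -> Sp_eval z q = 0) <->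
  supp_at (@weyl_order k d finset.set0) Fil (@chz k d z finset.set0).
Proof.
move=> good; split=> h.
  move=> m P oP dP; have [q eq] := nf_weyl0 P.
  rewrite (chz_Sp_frac _ _ eq); apply: h; exists 1%N; rewrite expr1 => P' hP' c x hx l.
  apply: (big_ind (fil_prev Fil l)) => [|u v|i _]; [exact: (prev0 good)|exact: (prevD good)|].
  apply: (big_ind (fil_prev Fil l)) => [|u v|j /eqP<-]; [exact: (prev0 good)|exact: (prevD good)|].
  have /(has_symbolE pchar0)[oi si] := hP' i.
  rewrite Sp_frac_pihomog -eq in si.
  (* Lifts are arbitrary, so P' i is known only modulo lower order: it is compared with P if i = m
     and with 0 otherwise. *)
  suff [Q hQ dQ] : exists2 Q, fil_prev (@weyl_order k d finset.set0) i (P' i - Q) & drops Fil i Q.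
    rewrite -(subrK Q (P' i)) scalerDl; apply: (prevD good); last exact: dQ.
    exact: (prev_act good).
  have hsmall (Q : weyl_algebra k d) : weyl_order i Q -> wsymb i (P' i) = wsymb i Q ->
      fil_prev (@weyl_order k d finset.set0) i (P' i - Q).
    move=> oQ e; rewrite prev_orderE //.
    have oPQ := weyl_orderB pchar0 oi oQ; rewrite weyl_orderE // in oPQ.
    have := msize_subr_pihomog oPQ.
    by rewrite -/(wsymb i (P' i - Q)) wsymbB // e subrr subr0.
  have [e|ne] := eqVneq (nat_of_ord i) m.
    exists P; last by rewrite e.
    apply: hsmall; first by rewrite e.
    by rewrite /wsymb -si e pihomog_id.
  exists 0; last by move=> l' u _; rewrite scale0r; exact: (prev0 good).
  apply: hsmall; first exact: weyl_order0.
  by rewrite /wsymb -si nf0 // raddf0; apply: pihomog_ne0 (pihomogP _ _ _); rewrite eq_sym.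
move=> q [N hann]; pose t := q ^+ N.
suff : Sp_eval z t = 0 by rewrite /t Sp_evalX => /eqP; rewrite expf_eq0 => /andP[_ /eqP].
rewrite (pihomog_partitionE (leqnn (msize t))).
rewrite (big_morph (Sp_eval z) (Sp_evalD z) (Sp_eval0 z)) big1 // => m _.
pose P i : weyl_algebra k d := opn finset.set0 (pihomog mdeg i (Sp_frac t)).
have nfP i : nf (P i) = Sp_frac (pihomog mdeg i t).
  by rewrite opnK -?Sp_frac_pihomog //; exact: Sp_frac_Sploc.
have oP i : weyl_order i (P i).
  by rewrite weyl_orderE // nfP Sp_frac_pihomog; exact: msize_pihomog.
have := chz_Sp_frac z m (nfP m); rewrite pihomog_id => <-; apply: h => // l u hu.
have := hann P; rewrite -/t => hP.
have : forall i, has_symbol i (P i) (pihomog mdeg i (Sp_frac t)).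
  move=> i; apply/has_symbolE => //; split=> //.
  by rewrite /wsymb nfP Sp_frac_pihomog pihomog_id.
(* With a test element concentrated in degree l, the component of degree m + l of the product is P_m
   u alone. *)
move=> /hP /(_ l.+1 (fun j => if j == l then u else 0)).
have hx j : Fil j (if j == l then u else 0).
  by case: eqP => [->|_] //; exact: (fil0 good).
move=> /(_ hx (m + l)%N); congr (fil_prev Fil _ _).
rewrite (bigD1 m) //= [X in _ + X]big1 ?addr0; last first.
  move=> i im; rewrite big1 // => j /eqP hj; case: eqP => [ej|_]; last by rewrite scaler0.
  case/eqP: im; apply: val_inj => /=; apply: (@addIn l).
  by rewrite -hj ej.
rewrite (bigD1 ord_max) //= eqxx big1 ?addr0 // => j /andP[_ jm].
by rewrite ifN ?scaler0.
Qed.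

Lemma Ch_supp (z : 'rV[k]_d * 'rV[k]_d) (Fil : nat -> set F) : good_A_filtration Fil ->
  Ch F z <-> supp_at (@weyl_order k d finset.set0) Fil (@chz k d z finset.set0).
Proof.
move=> good; split=> [[Fil' good' h]|h]; last by exists Fil => //; exact/Ch_condP.
apply: (supp_at_indep (weyl_filtered _ pchar0) good good').
  by apply: chz_character => //; exact: x00.
exact/Ch_condP.
Qed.

End CharacteristicVariety.

(** * Invariance under the torus T *)

Section Torus.
Variables (k : fieldType) (n d : nat) (V : 'M[int]_(d, n)).
Hypothesis pchar0 : [pchar k] =i pred0.
Variable t : class_group V -> k.
Hypothesis ht : torus t.

Lemma torus0 : t 0 = 1.
Proof.
have [h0 hD] := ht; have := hD 0 0; rewrite addr0 => h.
by apply: (mulIf (h0 0)); rewrite -h mul1r.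
Qed.

Lemma torusN c : t (- c) = (t c)^-1.
Proof.
have [h0 hD] := ht; apply: (mulIf (h0 c)); rewrite -hD addNr torus0 mulVf //.
Qed.

Lemma torusMz c (m : int) : t (c *~ m) = t c ^ m.
Proof.
have [h0 hD] := ht.
have hn (l : nat) : t (c *+ l) = t c ^+ l.
  by elim: l => [|l IH]; rewrite ?mulr0n ?torus0 // mulrS hD IH exprS.
by case: m => l; [exact: hn|rewrite NegzE mulrNz torusN -pmulrn hn -exprnN].
Qed.

Lemma torus_class a : t (class_of V a) = \prod_i t (class_var V i) ^ (a 0 i).
Proof.
have [h0 hD] := ht.
have -> : a = \sum_i (delta_mx 0 i : 'rV[int]_d) *~ a 0 i.
  rewrite [LHS]row_sum_delta; apply: eq_bigr => i _; apply/rowP => j.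
  by rewrite mx_mulz !mxE mulrC.
have -> : class_of V (\sum_i (delta_mx 0 i : 'rV[int]_d) *~ a 0 i) = \sum_i class_var V i *~ a 0 i.
  by rewrite raddf_sum; apply: eq_bigr => i _; rewrite /= raddfMz.
have -> : t (\sum_i class_var V i *~ a 0 i) = \prod_i t (class_var V i) ^ a 0 i.
  elim/big_ind2: _ => [|x1 x2 y1 y2 <- <-|i _]; [exact: torus0|exact: hD|exact: torusMz].
apply: eq_bigr => i _; congr (_ ^ _); rewrite summxE (bigD1 i) //= big1 ?addr0 => [|j ji].
  by rewrite mx_mulz mxE !eqxx mul1r.
by rewrite mx_mulz mxE eqxx eq_sym (negPf ji) mul0r.
Qed.

(** The torus scales x^a xi^b by t of the class of a minus that of b, which is c for every monomial
    of q. *)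
Lemma spev_torus (z : 'rV[k]_d * 'rV[k]_d) (c : class_group V) (q : {mpoly {fraction {mpoly k[d]}}[d]}) :
  Spgr finset.set0 c q ->
  spev (torus_act t z) finset.set0 q = t c * spev z finset.set0 q.
Proof.
move=> hq; have [h0 hD] := ht.
have [s0 sD sM _] := Sloc_ring k (@finset.set0 'I_d).
have key b y : Sgr (@finset.set0 'I_d) (c + class_mnm V b) y ->
    Sloc (@finset.set0 'I_d) y /\
    spev (torus_act t z) finset.set0 (y *: 'X_[b]) = t c * spev z finset.set0 (y *: 'X_[b]).
  apply: (Sgr_ind (P := fun y => Sloc (@finset.set0 'I_d) y /\
    spev (torus_act t z) finset.set0 (y *: 'X_[b]) = t c * spev z finset.set0 (y *: 'X_[b]))).
  - by rewrite scale0r !spev0 ?x00 // mulr0.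
  - move=> x x' [hx ex] [hx' ex']; split; first exact: sD.
    have hX u : Sloc (@finset.set0 'I_d) u -> Sploc finset.set0 (u *: 'X_[b] : {mpoly {fraction {mpoly k[d]}}[d]}).
      by move=> hu; apply: SplocZ => //; exact: SplocX.
    rewrite scalerDl (spevD (x00 _) (hX _ hx) (hX _ hx')) (spevD (x00 _) (hX _ hx) (hX _ hx')).
    by rewrite ex ex' mulrDr.
  move=> a s ha hc; split.
    by apply: (Sgr_Sloc (V := V)); apply: SgrZ; apply: lmon_Sgr.
  rewrite (spev_lmon (x00 _)) // (spev_lmon (x00 _)) // /lev.
  have ea : \prod_(i < d) (torus_act t z).1 0 i ^ a 0 i
      = t (class_of V a) * \prod_(i < d) z.1 0 i ^ a 0 i.
    rewrite torus_class -big_split; apply: eq_bigr => i _ /=.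
    by rewrite mxE expfzMl.
  have eb : \prod_i (torus_act t z).2 0 i ^+ b i
      = (t (class_mnm V b))^-1 * \prod_i z.2 0 i ^+ b i.
    rewrite class_mnmE torus_class -prodfV -big_split; apply: eq_bigr => i _ /=.
    by rewrite mxE exprMn exprVn mxE.
  rewrite ea eb hc hD.
  have aux (L : fieldType) (u v w x y0 : L) : v != 0 ->
    w * (u * v * x) * (v^-1 * y0) = u * (w * x * y0) by move=> v0; field.
  exact: aux (h0 _).
have e : q = \sum_(b <- msupp q) q@_b *: 'X_[b] by exact: mpolyE.
have hs b : Sploc finset.set0 (q@_b *: 'X_[b] : {mpoly {fraction {mpoly k[d]}}[d]}).
  by apply: SplocZ; [case: (key b _ (hq b))|exact: SplocX].
rewrite e (spev_sum (x00 _)) // (spev_sum (x00 _)) // mulr_sumr.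
by apply: eq_bigr => b _; case: (key b _ (hq b)).
Qed.

Variables (F : lmodType (weyl_algebra k d)) (Fgr : class_group V -> set F).
Hypothesis thF : theta_graded Fgr.
Variables (r : nat) (g : 'I_r -> F) (cl : 'I_r -> class_group V).
Hypothesis hgr : forall i, Fgr (cl i) (g i).
Hypothesis hgen : forall f, exists a : 'I_r -> weyl_algebra k d, f = \sum_(i < r) a i *: g i.

Lemma supp_torus (z : 'rV[k]_d * 'rV[k]_d) :
  supp_at (@weyl_order k d finset.set0) (Fil0 g) (@chz k d z finset.set0) ->
  supp_at (@weyl_order k d finset.set0) (Fil0 g) (@chz k d (torus_act t z) finset.set0).
Proof.
move=> h m P oP dP.
have [s [p [hp dp ->]]] := drops_dec pchar0 thF hgr hgen oP dP.
elim: s dp => [|c s IH] dp.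
  rewrite big_nil; apply: (chz_prev (x00 _) pchar0).
  by case: (m) => //= m'; exact: weyl_order0.
rewrite big_cons (chzD (x00 _) pchar0) IH ?addr0 => [|c' hc']; last first.
  by apply: dp; rewrite inE hc' orbT.
have [gp op] := hp c.
have -> : chz (torus_act t z) m (p c) = t c * chz z m (p c).
  by apply: spev_torus; apply: Spgr_pihomog; apply/weyl_grE.
by rewrite h ?mulr0 //; apply: dp; rewrite inE eqxx.
Qed.

End Torus.

(** * The induced good filtration of the sheaf *)

Section GoodSheafFiltration.
Variables (k : fieldType) (R : realType) (n d : nat) (V : 'M[int]_(d, n)).
Variable Delta : {set {set 'I_d}}.
Hypothesis pchar0 : [pchar k] =i pred0.
Hypothesis sf : smooth_fan R V Delta.
Variables (F : lmodType (weyl_algebra k d)) (Fgr : class_group V -> set F).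
Hypothesis thF : theta_graded Fgr.
Variables (r : nat) (g : 'I_r -> F) (cl : 'I_r -> class_group V).
Hypothesis hgr : forall i, Fgr (cl i) (g i).
Hypothesis hgen : forall f, exists a : 'I_r -> weyl_algebra k d, f = \sum_(i < r) a i *: g i.
Notation K := {fraction {mpoly k[d]}}.
Let good0 : good_A_filtration (Fil0 g) := Fil0_good pchar0 hgen.

Lemma chart_act_mul sigma (cd : chart_data V sigma) (a : chart_ring k V sigma) u :
  @locgr k n d V F Fgr (~: sigma)%SET 0 u ->
  chart_act (F := F) (fun s => a * s) u = wmul (~: sigma)%SET (val a) *: u.
Proof.
move=> hu; have ha := chart_valP a.
apply: (chart_actE pchar0 thF cd) hu; split; first exact: weyl_gr_wmul.
by move=> s; rewrite chart_valM wmulE //; exact: Sgr_Sloc ha.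
Qed.

(** The content is that sections over U_tau come from U_sigma with the same filtration index; one
    summand suffices. *)
Lemma good_D : good_D_filtration Delta Fgr (fun sigma => @G0 k n d V F Fgr r g (~: sigma)%SET).
Proof.
split=> [sigma hs|sigma tau hs ht sub l v].
  have [cd] := chart_data_exists sf hs.
  by apply/(good_chartP pchar0 thF cd); exact: (G0_good pchar0 thF hgr hgen cd).
have [cds] := chart_data_exists sf hs; have [cdt] := chart_data_exists sf ht.
have subJ : (~: sigma)%SET \subset (~: tau)%SET by rewrite finset.setCS.
have sx N : Sgr (~: tau)%SET (- (xdeg V (~: sigma)%SET *+ N)) (xinv k (~: sigma)%SET N).
  by apply: (Sgr_sub subJ); exact: xinv_Sgr.
have res_gr u : @locgr k n d V F Fgr (~: sigma)%SET 0 u ->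
    @locgr k n d V F Fgr (~: tau)%SET 0 (loc_res (~: tau)%SET u).
  move=> [f [N [hf ->]]]; rewrite (loc_resE V pchar0) //.
  rewrite -(addNr (xdeg V (~: sigma)%SET *+ N)); apply: locgrZ => //.
    exact: weyl_gr_wmul.
  by exists f, 0%N; rewrite mulr0n addr0; rewrite add0r in hf.
split.
  move=> hv; have [f [N [hf ->]]] := G0_homog pchar0 thF hgr hgen hv.
  (* With x^mm of the degree of f and invertible on U_sigma, f / (x^tauhat)^N is the function x^mm /
     (x^tauhat)^N on U_tau times the restriction of the section f / x^mm over U_sigma. *)
  have [mm [_ h1 h2]] := unit_mon_lmon k cds (xdeg V (~: tau)%SET *+ N).
  pose u := wmul (~: sigma)%SET (lmon k (- mm)) *: frac_of (~: sigma)%SET f 0.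
  have h1' : Sgr (~: tau)%SET (xdeg V (~: tau)%SET *+ N) (lmon k mm) by exact: (Sgr_sub subJ).
  have h2' : Sgr (~: tau)%SET (- (xdeg V (~: tau)%SET *+ N)) (lmon k (- mm)) by exact: (Sgr_sub subJ).
  have hu : @G0 k n d V F Fgr r g (~: sigma)%SET l u.
    split.
      rewrite /u -[l]add0n; apply: (lf_act V pchar0 hgen).
        by apply: order_wmul => //; exact: Sgr_Sloc h2.
      by exists f, 0%N; split=> //; exact: FilH_Fil0 hf.
    rewrite -(addNr (xdeg V (~: tau)%SET *+ N)); apply: locgrZ => //.
      exact: weyl_gr_wmul.
    by exists f, 0%N; rewrite mulr0n addr0; split=> //; exact: (FilH_Fgr thF hgr) hf.
  have ha : Sgr (~: tau)%SET (0 : class_group V) (xinv k (~: tau)%SET N * lmon k mm).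
    by rewrite -(addNr (xdeg V (~: tau)%SET *+ N)); apply: SgrM => //; exact: xinv_Sgr.
  exists 1%N, (fun => mkchart ha), (fun => u); split=> //.
  rewrite big_ord1 (chart_act_mul cdt); last by apply: res_gr; case: hu.
  rewrite /u (loc_res_wmul V pchar0) //; last exact: Sgr_Sloc h2.
  have xinv0 : xinv k (~: sigma)%SET 0 = 1 by rewrite /xinv mulr0n oppr0 lmon0.
  rewrite (loc_resE V pchar0) // xinv0 wmul1 // scale1r scalerA.
  rewrite -wmulM //; [|exact: Sgr_Sloc ha|exact: Sgr_Sloc h2'].
  by rewrite /= -mulrA -lmonD subrr lmon0 mulr1 -frac_xinv.
have good := G0_good pchar0 thF hgr hgen cdt.
move=> [r' [a [u [hu ->]]]]; elim/big_ind: _ => [|x y|i _].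
- exact: (fil0 good).
- exact: (filD good).
have [[f [N [hf eu]]] gu] := hu i.
rewrite (chart_act_mul cdt); last exact: res_gr.
have haS := chart_valP (a i).
rewrite -[l]add0n; apply: (fil_act good).
  by split; [exact: weyl_gr_wmul|apply: order_wmul => //; exact: Sgr_Sloc haS].
split; last exact: res_gr.
rewrite eu (loc_resE V pchar0) // -[l]add0n; apply: (lf_act V pchar0 hgen).
  by apply: order_wmul => //; exact: Sgr_Sloc (sx N).
by exists f, 0%N.
Qed.

End GoodSheafFiltration.

(** * Points of the quotient and of the cotangent bundle *)

Section QuotFromCot.
Variables (k : fieldType) (n d : nat) (V : 'M[int]_(d, n)) (sigma : {set 'I_d}).
Hypothesis pchar0 : [pchar k] =i pred0.
Notation J := (~: sigma)%SET.
Notation K := {fraction {mpoly k[d]}}.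
Notation const := (@const k d).
Notation R0 := (chart_ring k V sigma).
Implicit Types s q : {mpoly K[d]}.

Lemma BF0_opn m s : Spgr J (0 : class_group V) s -> (msize s <= m.+1)%N -> BF0 V m (opn J s).
Proof.
move=> hs ms; have e : nf (opn J s) = s by rewrite opnK //; exact: Spgr_Sploc hs.
by split; [apply/weyl_grE; rewrite ?e|apply/weyl_orderE; rewrite ?e].
Qed.

Variable chi : cot_chart k V sigma.
Let gch := chiW_character pchar0 chi.

(** chi as a function of symbols; operators with the same symbol of degree m differ by lower order,
    where chi in degree m vanishes. *)
Definition eta (m : nat) s : k := chiW chi m (opn J s).

Lemma chiW_eq m P Q : BF0 V m P -> BF0 V m Q -> fil_prev (@weyl_order k d J) m (P - Q) ->
  chiW chi m P = chiW chi m Q.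
Proof.
move=> hP hQ hPQ; have hb := frB (BF0_filtered V sigma pchar0) hP hQ.
rewrite -[P](subrK Q) (gcD gch hb hQ) (gc_prev gch) ?add0r //.
by case: (m) hPQ hb => // m' h1 [h2 _]; split.
Qed.

Lemma eta_symb m P : BF0 V m P -> eta m (wsymb m P) = chiW chi m P.
Proof.
move=> hP; have [gP oP] := hP.
have hs : Spgr J (0 : class_group V) (wsymb m P).
  by apply: Spgr_pihomog; apply/weyl_grE.
have hQ : BF0 V m (opn J (wsymb m P)) by apply: BF0_opn => //; exact: msize_pihomog.
apply: chiW_eq => //; rewrite (prev_orderE pchar0) (nfB pchar0) (opnK pchar0); last exact: Spgr_Sploc hs.
rewrite -opprB mmeasureN; apply: msize_subr_pihomog.
by apply/weyl_orderE.
Qed.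

Lemma eta0 m : eta m 0 = 0.
Proof.
rewrite /eta (_ : opn J 0 = 0); first by apply: (gc_prev gch); case: m => // m;
  exact: (fr0 (BF0_filtered V sigma pchar0)).
by apply: nf_inj; rewrite opnK ?nf0 //; exact: Sploc0.
Qed.

Lemma etaD m s s' : Spgr J (0 : class_group V) s -> Spgr J (0 : class_group V) s' ->
  (msize s <= m.+1)%N -> (msize s' <= m.+1)%N -> eta m (s + s') = eta m s + eta m s'.
Proof.
move=> hs hs' ms ms'; rewrite /eta -(gcD gch (BF0_opn hs ms) (BF0_opn hs' ms')).
congr (chiW _ _ _); apply: nf_inj; rewrite nfD // !opnK //; try exact: Spgr_Sploc hs;
  try exact: Spgr_Sploc hs'.
by apply: Spgr_Sploc (SpgrD hs hs').
Qed.

Lemma etaM m m' s s' : Spgr J (0 : class_group V) s -> Spgr J (0 : class_group V) s' ->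
  eta (m + m') (pihomog mdeg m s * pihomog mdeg m' s')
    = eta m (pihomog mdeg m s) * eta m' (pihomog mdeg m' s').
Proof.
move=> hs hs'; have h1 := Spgr_pihomog m hs; have h2 := Spgr_pihomog m' hs'.
have b1 := BF0_opn h1 (msize_pihomog m s); have b2 := BF0_opn h2 (msize_pihomog m' s').
have b12 := frM (BF0_filtered V sigma pchar0) b1 b2.
rewrite {2 3}/eta -(gcM gch b1 b2) -(eta_symb b12).
rewrite (wsymbM pchar0 (proj2 b1) (proj2 b2)) /wsymb.
by rewrite (opnK pchar0 (Spgr_Sploc h1)) (opnK pchar0 (Spgr_Sploc h2)) !pihomog_id.
Qed.

Definition Yval q : k := \sum_(m < msize q) eta m (pihomog mdeg m q).

Lemma YvalE q w : (msize q <= w)%N -> Yval q = \sum_(m < w) eta m (pihomog mdeg m q).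
Proof.
move=> le; rewrite /Yval (big_ord_widen w (fun m => eta m (pihomog mdeg m q)) le).
rewrite big_mkcond; apply: eq_bigr => m _; case: ltnP => // ge.
by rewrite pihomog_small ?eta0.
Qed.

Notation Sp0' := (Spgr J (0 : class_group V)).

Lemma YvalD q q' : Sp0' q -> Sp0' q' -> Yval (q + q') = Yval q + Yval q'.
Proof.
move=> hq hq'; pose w := (msize q + msize q')%N.
have h1 : (msize q <= w)%N by exact: leq_addr.
have h2 : (msize q' <= w)%N by exact: leq_addl.
rewrite (YvalE h1) (YvalE h2) (YvalE (msizeD_lt h1 h2)) -big_split; apply: eq_bigr => m _.
by rewrite pihomogD etaD //; try exact: Spgr_pihomog; exact: msize_pihomog.
Qed.

Lemma Yval0 : Yval 0 = 0.
Proof. by rewrite (YvalE (w := 0)) ?mmeasure0 // big_ord0. Qed.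

Lemma Yval_hom m s : Yval (pihomog mdeg m s) = eta m (pihomog mdeg m s).
Proof.
rewrite (YvalE (msize_pihomog m s)) big_ord_recr /= pihomog_id big1 ?add0r // => i _.
rewrite (pihomog_ne0 _ (pihomogP _ _ _)) ?eta0 //.
by rewrite eq_sym ltn_eqF.
Qed.

Lemma Yval_sum (I : Type) (t : seq I) (G : I -> {mpoly K[d]}) :
  (forall i, Sp0' (G i)) -> Yval (\sum_(i <- t) G i) = \sum_(i <- t) Yval (G i).
Proof.
move=> h; elim: t => [|i t IH]; first by rewrite !big_nil Yval0.
rewrite !big_cons YvalD ?IH //; elim: t {IH} => [|j t IH].
  by rewrite big_nil; exact: Spgr0.
by rewrite big_cons; exact: SpgrD.
Qed.

Lemma YvalM q q' : Sp0' q -> Sp0' q' -> Yval (q * q') = Yval q * Yval q'.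
Proof.
move=> hq hq'.
rewrite {1}(pihomog_partitionE (mf := mdeg) (leqnn (msize q))) {1}(pihomog_partitionE (mf := mdeg) (leqnn (msize q'))).
rewrite mulr_suml Yval_sum => [|i]; last first.
  rewrite mulr_sumr; elim/big_ind: _ => [|x y|j _]; [exact: Spgr0|exact: SpgrD|].
  by rewrite -[0]addr0; apply: SpgrM; exact: Spgr_pihomog.
rewrite [Yval q]/Yval mulr_suml; apply: eq_bigr => i _.
rewrite mulr_sumr Yval_sum => [|j]; last first.
  by rewrite -[0]addr0; apply: SpgrM; exact: Spgr_pihomog.
rewrite [Yval q']/Yval mulr_sumr; apply: eq_bigr => j _.
rewrite -etaM //.
have e : pihomog mdeg i q * pihomog mdeg j q' = pihomog mdeg (i + j) (pihomog mdeg i q * pihomog mdeg j q').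
  by rewrite (pihomogM (msize_pihomog i q) (msize_pihomog j q')) !pihomog_id.
by rewrite e Yval_hom.
Qed.

Lemma chiW_const a : chiW chi 0 (wmul J (const a)) = a.
Proof.
rewrite -[RHS](cot_valC chi a) /chiW; congr (chi _ _); apply: (phiDE pchar0).
have ha := Sgr_const V J a.
split=> [|r]; first exact: weyl_gr_wmul.
by rewrite wmulE //; exact: Sgr_Sloc ha.
Qed.

Lemma YvalC (a : k) : Yval ((@FracField.tofrac {mpoly k[d]} a%:MP)%:MP) = a.
Proof.
have ha := Sgr_const V J a; have hl := Sgr_Sloc ha.
rewrite -/(const a) (YvalE (w := 1)) ?big_ord1; last by rewrite msizeC; case: (_ != 0).
have e : wsymb 0 (wmul J (const a)) = pihomog mdeg 0 (const a)%:MP by rewrite /wsymb nf_wmul.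
rewrite -[LHS]/(eta 0 (pihomog mdeg 0 (const a)%:MP)) -e eta_symb ?chiW_const //.
by split; [exact: weyl_gr_wmul|exact: order_wmul].
Qed.

Definition ychi : quot_chart k V sigma := QuotChart YvalD YvalM YvalC.

Lemma ychi_symbol m (P : weyl k J) (D : R0 -> R0) s : chart_phi P D -> has_symbol m P s ->
  ychi s = chi m D.
Proof.
move=> PD /has_symbolE-/(_ pchar0)[oP ->]; rewrite -/(wsymb m P) /= Yval_hom eta_symb.
  by rewrite /chiW (phiDE pchar0 PD).
by split=> //; case: PD.
Qed.

Lemma has_symbol_opn m q : Sp0' q ->
  has_symbol m (opn J (pihomog mdeg m q)) (pihomog mdeg m q).
Proof.
move=> hq; have h := Spgr_pihomog m hq; apply/has_symbolE => //.
have [_ o] := BF0_opn h (msize_pihomog m q); split=> //.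
by rewrite opnK ?pihomog_id //; exact: Spgr_Sploc h.
Qed.

(** Each homogeneous component of an element of [Sp0'] is the symbol of an operator of degree 0, so
    the values on symbols determine y. *)
Lemma ychi_unique (y : quot_chart k V sigma) :
  (forall m (P : weyl k J) (D : R0 -> R0) s, chart_phi P D -> has_symbol m P s -> y s = chi m D) ->
  forall q, Sp0' q -> y q = ychi q.
Proof.
move=> hy q hq.
have hm m : y (pihomog mdeg m q) = ychi (pihomog mdeg m q).
  have h := Spgr_pihomog m hq; have [gP _] := BF0_opn h (msize_pihomog m q).
  have [D PD] := chart_phi_ex pchar0 gP.
  by rewrite (hy _ _ _ _ PD (has_symbol_opn m hq)) (ychi_symbol PD (has_symbol_opn m hq)).
have y0 : y 0 = 0.
  have := quot_valD y (@Spgr0 k n d V J 0) (@Spgr0 k n d V J 0); rewrite addr0 => /eqP.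
  by rewrite -subr_eq0 opprD addNKr oppr_eq0 => /eqP.
rewrite (pihomog_partitionE (mf := mdeg) (leqnn (msize q))).
have : forall m : 'I_(msize q), Sp0' (pihomog mdeg m q) by move=> m; exact: Spgr_pihomog.
move: (index_enum _) => t ht; elim: t => [|m t IH]; first by rewrite big_nil y0 /= Yval0.
have hs : Sp0' (\sum_(j <- t) pihomog mdeg j q).
  by elim/big_ind: _ => [|x x'|j _]; [exact: Spgr0|exact: SpgrD|exact: ht].
rewrite big_cons (quot_valD y (ht m) hs) IH hm.
by rewrite (quot_valD ychi (ht m) hs).
Qed.

End QuotFromCot.

(** The lifts of one symbol on the two charts are the same operator on k(x), so the operators they
    induce extend one another. *)
Lemma ychi_step (k : fieldType) (n d : nat) (V : 'M[int]_(d, n)) (sigma tau : {set 'I_d})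
    (pchar0 : [pchar k] =i pred0) (chi : cot_chart k V sigma) (chi' : cot_chart k V tau) :
  tau \subset sigma ->
  (forall m D D', chart_diff m D -> chart_diff m D' -> diff_extends D D' -> chi' m D' = chi m D) ->
  forall q, Sp0 V sigma q -> ychi pchar0 chi' q = ychi pchar0 chi q.
Proof.
move=> sub h q hq; rewrite /= /Yval; apply: eq_bigr => m _; rewrite /eta /chiW.
have subJ : (~: sigma)%SET \subset (~: tau)%SET by rewrite finset.setCS.
have hs := Spgr_pihomog m hq.
have hs' : Spgr (~: tau)%SET (0 : class_group V) (pihomog mdeg m q).
  by move=> b; exact: Sgr_sub subJ (hs b).
have B := BF0_opn pchar0 hs (msize_pihomog m q).
have B' := BF0_opn pchar0 hs' (msize_pihomog m q).
apply: h; [exact: phiD_diff|exact: phiD_diff|].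
move=> r r' e; have [gB _] := B; have [gB' _] := B'.
have [_ <-] := phiDP pchar0 gB; have [_ <-] := phiDP pchar0 gB'.
rewrite e !opnE //; [exact: Spgr_Sploc hs'|exact: Spgr_Sploc hs].
Qed.

(* A point z over which the kernel of (A_(x^sigmahat))_0 -> D(U_sigma) has
   vanishing symbols defines a point of T^*X. *)
Section CotFromPoint.
Variables (k : fieldType) (n d : nat) (V : 'M[int]_(d, n)) (sigma : {set 'I_d}).
Hypothesis pchar0 : [pchar k] =i pred0.
Variable cd : chart_data V sigma.
Notation J := (~: sigma)%SET.
Notation R0 := (chart_ring k V sigma).
Variable z : 'rV[k]_d * 'rV[k]_d.
Hypothesis xz0 : (xprod k J).@[z.1 0] != 0.
Hypothesis hK : forall m (P : weyl k J), BF0 V m P ->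
  chart_phi P (fun _ : R0 => 0) -> chz z m P = 0.

Definition cotval (m : nat) (D : R0 -> R0) : k :=
  xget 0 [set v | exists P : weyl k J, [/\ BF0 V m P, chart_phi P D & v = chz z m P]].

Lemma cotvalE m (P : weyl k J) (D : R0 -> R0) : BF0 V m P -> chart_phi P D -> cotval m D = chz z m P.
Proof.
move=> hP PD; rewrite /cotval; case: xgetP => [v _ [Q [hQ QD ->]]|/(_ (chz z m P))[]]; last by exists P.
apply/eqP; rewrite -subr_eq0 -chzB //; apply/eqP; apply: hK.
  exact: (frB (BF0_filtered V sigma pchar0)).
case: PD QD hP hQ => gP eP [gQ eQ] _ _; split=> [|r]; first exact: weyl_grB.
by rewrite weylDE weylNE eP eQ subrr.
Qed.

Lemma cotvalD m (D D' : R0 -> R0) : chart_diff m D -> chart_diff m D' ->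
  cotval m (fun r => D r + D' r) = cotval m D + cotval m D'.
Proof.
move=> /(chart_lift_BF0 pchar0 cd)[P hP PD] /(chart_lift_BF0 pchar0 cd)[Q hQ QD].
rewrite (cotvalE hP PD) (cotvalE hQ QD) -chzD //; apply: cotvalE.
  by case: hP hQ => ? ? [? ?]; split; [exact: weyl_grD|exact: weyl_orderD].
by case: PD QD => ? e [? e']; split=> [|r]; [exact: weyl_grD|rewrite weylDE e e'].
Qed.

Lemma cotval0 m (D : R0 -> R0) : chart_diff m D -> cotval m.+1 D = 0.
Proof.
move=> /(chart_lift_BF0 pchar0 cd)[P hP PD]; have [gP oP] := hP.
rewrite (@cotvalE m.+1 P D) //; first by apply: (chz_prev xz0 pchar0).
by split=> //; apply: (@weyl_order_le _ _ pchar0 _ m).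
Qed.

Lemma cotvalM m m' (D D' : R0 -> R0) : chart_diff m D -> chart_diff m' D' ->
  cotval (m + m')%N (fun r => D (D' r)) = cotval m D * cotval m' D'.
Proof.
move=> /(chart_lift_BF0 pchar0 cd)[P hP PD] /(chart_lift_BF0 pchar0 cd)[Q hQ QD].
rewrite (cotvalE hP PD) (cotvalE hQ QD) -chzM //; [|by case: hP|by case: hQ].
apply: cotvalE; first exact: (frM (BF0_filtered V sigma pchar0)).
by case: PD QD => ? e [? e']; split=> [|r]; [rewrite -[0]addr0; exact: weyl_grM|rewrite weylME e' e].
Qed.

Lemma cotvalC a : cotval 0 (fun r => chart_const V sigma a * r) = a.
Proof.
have ha := Sgr_const V J a; have hl := Sgr_Sloc ha.
rewrite (@cotvalE 0 (wmul J (const d a))); first exact: chz_const.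
  by split; [exact: weyl_gr_wmul|exact: order_wmul].
by split=> [|r]; [exact: weyl_gr_wmul|rewrite wmulE].
Qed.

Definition cot_of_point : cot_chart k V sigma := CotChart cotvalD cotval0 cotvalM cotvalC.

Lemma cot_of_pointE m (P : weyl k J) : BF0 V m P -> chiW cot_of_point m P = chz z m P.
Proof. by move=> hP; apply: cotvalE => //; apply: phiDP => //; case: hP. Qed.

End CotFromPoint.

Section PointFromQuot.
Variables (k : closedFieldType) (n d : nat) (V : 'M[int]_(d, n)) (sigma : {set 'I_d}).
Hypothesis pchar0 : [pchar k] =i pred0.
Variable cd : chart_data V sigma.
Notation J := (~: sigma)%SET.
Notation K := {fraction {mpoly k[d]}}.
Notation const := (@const k d).
Notation lmon := (@lmon k d).
Notation al := (al cd).
Notation W := (cdW cd).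
Notation M := (cdM cd).
Notation N := (cdN cd).
Notation f := (cdf cd).
Variable y : quot_chart k V sigma.
Notation Sp0' := (Spgr J (0 : class_group V)).

Lemma closed_root (a : k) m : (0 < m)%N -> exists t, t ^+ m = a.
Proof.
move=> m0; have [t ht] := @solve_monicpoly k m (fun i => if i is 0%N then a else 0) m0.
exists t; rewrite ht; case: m m0 {ht} => // m _.
by rewrite big_ord_recl expr0 mulr1 big1 ?addr0 // => i _; rewrite mul0r.
Qed.

Definition chart_exp (a : 'rV[int]_d) : Prop := class_of V a = 0 /\ nonneg_off J a.

(** The exponents of the monomials of k[U_sigma] form the monoid generated by the [al l] and by the
    [- al l] with l outside f(sigma). On the latter, values are forced because they are inverses. *)
Lemma chart_exp_ind (L : fieldType) (Phi Psi : 'rV[int]_d -> L) :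
  Phi 0 = 1 -> Psi 0 = 1 ->
  (forall a b, chart_exp a -> chart_exp b -> Phi (a + b) = Phi a * Phi b) ->
  (forall a b, chart_exp a -> chart_exp b -> Psi (a + b) = Psi a * Psi b) ->
  (forall l, Phi (al l) = Psi (al l)) -> forall a, chart_exp a -> Phi a = Psi a.
Proof.
move=> Phi0 Psi0 PhiD PsiD e a [/(cd_principal cd)[p ap] na].
have aE : a = \sum_l al l *~ p l 0.
  rewrite ap; apply/rowP => j; rewrite !mxE summxE; apply: eq_bigr => l _.
  by rewrite mx_mulz mxE.
have exp_al l (z : int) : (0 <= z) \/ (forall i, i \in sigma -> f i != l) -> chart_exp (al l *~ z).
  move=> hz; split; first by rewrite raddfMz /= al_principal mul0rz.
  apply/nonneg_offP => i hi; rewrite mx_mulz al_sigma //.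
  case: hz => [z0|/(_ i hi)/negPf->]; last by rewrite mul0r.
  by case: eqP => _; rewrite ?mul1r ?mul0r.
(* For l = f i the coefficient of [al l] is the exponent of x_i in x^a, which is nonnegative. *)
have pos l : (0 <= p l 0) \/ (forall i, i \in sigma -> f i != l).
  have [h|h] := boolP [forall (i | i \in sigma), f i != l].
    by right=> i hi; exact: (forall_inP h).
  left; move: h; rewrite negb_forall => /existsP[i]; rewrite negb_imply negbK => /andP[hi /eqP fi].
  have := proj1 (nonneg_offP sigma a) na i hi; rewrite ap !mxE (bigD1 l) //= big1 ?addr0 => [|l' l'l].
    by rewrite (cdW_sigma cd) // fi eqxx mul1r.
  by rewrite (cdW_sigma cd) // fi eq_sym (negPf l'l) mul0r.
have nat_case l (m : nat) : Phi (al l *~ m) = Psi (al l *~ m).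
  elim: m => [|m IH]; first by rewrite mulr0z Phi0 Psi0.
  have h : chart_exp (al l *~ m) by apply: exp_al; left.
  have h1 : chart_exp (al l) by rewrite -[al l]mulr1z; apply: exp_al; left.
  by rewrite intS mulrzDr mulr1z PhiD // PsiD // IH e.
have one l : Phi (al l *~ p l 0) = Psi (al l *~ p l 0).
  case: (p l 0) (pos l) => m hm; first exact: nat_case.
  have {}hm : forall i, i \in sigma -> f i != l by case: hm.
  have h1 : chart_exp (al l *~ m.+1) by apply: exp_al; left.
  have h2 : chart_exp (al l *~ Negz m) by apply: exp_al; right.
  have s0 : al l *~ m.+1 + al l *~ Negz m = 0 by rewrite -mulrzDr NegzE subrr mulr0z.
  have e1 := PhiD _ _ h1 h2; have e2 := PsiD _ _ h1 h2.
  rewrite s0 Phi0 nat_case in e1; rewrite s0 Psi0 in e2.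
  have nz : Psi (al l *~ m.+1) != 0.
    by apply/eqP => z0; move: e2; rewrite z0 mul0r => /eqP; rewrite oner_eq0.
  by apply: (mulfI nz); rewrite -e1 -e2.
rewrite aE; elim: (index_enum _) => [|l s IH]; first by rewrite big_nil Phi0 Psi0.
have hl : chart_exp (al l *~ p l 0) by exact: exp_al.
have hs : chart_exp (\sum_(j <- s) al j *~ p j 0).
  elim: s {IH} => [|j s [h1 h2]].
    by rewrite big_nil; split; [exact: raddf0|move=> i _; rewrite mxE].
  have [h3 h4] := exp_al j _ (pos j); rewrite big_cons; split.
    by rewrite raddfD /= h1 h3 addr0.
  by move=> i hi; rewrite mxE addr_ge0 ?h2 ?h4.
by rewrite big_cons PhiD // PsiD // IH one.
Qed.

Lemma Spgr_lmon (c : class_group V) a b : class_of V a = c + class_mnm V b -> nonneg_off J a ->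
  Spgr J c (lmon a *: 'X_[b]).
Proof. by move=> e ha; apply: SpgrZX; rewrite -e; apply: lmon_Sgr. Qed.

Let Phi (a : 'rV[int]_d) : k := y (lmon a *: 'X_[0%MM]).

Lemma y1 : y 1 = 1.
Proof.
have h := quot_valC y 1; have c1 : const 1 = 1 by exact: rmorph1.
by rewrite -/(const 1) c1 mpolyC1 in h.
Qed.

Lemma chart_exp_Sp0 a : chart_exp a -> Sp0' (lmon a *: 'X_[0%MM]).
Proof. by move=> [h1 h2]; apply: Spgr_lmon => //; rewrite h1 class_mnm0 addr0. Qed.

Lemma Phi0 : Phi 0 = 1.
Proof. by rewrite /Phi lmon0 scale1r mpolyX0 y1. Qed.

Lemma PhiD a b : chart_exp a -> chart_exp b -> Phi (a + b) = Phi a * Phi b.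
Proof.
move=> ha hb; rewrite /Phi -(quot_valM y (chart_exp_Sp0 ha) (chart_exp_Sp0 hb)).
by congr (y _); rewrite -scalerAl -scalerAr scalerA -lmonD mpolyX0 mulr1.
Qed.

Lemma al_exp l : chart_exp (al l).
Proof. by split; [exact: al_principal|exact: al_nonneg]. Qed.

(* z_j = prod_l t_l^(M l j) with t_l^N the value of y_l gives z the prescribed
   values at the y_l that are units, since M W = N. *)
Lemma point_of_quot : exists z : 'rV[k]_d * 'rV[k]_d, (xprod k J).@[z.1 0] != 0 /\
  forall q, Sp0' q -> y q = spev z J q.
Proof.
pose isf l := [exists (i | i \in sigma), f i == l].
have fP l : ~~ isf l -> forall i, i \in sigma -> f i != l.
  by rewrite negb_exists => /forallP h i hi; have := h i; rewrite negb_and hi.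
have Yunit l : ~~ isf l -> Phi (al l) != 0.
  move=> hl; have hN : chart_exp (- al l).
    split; first by rewrite raddfN /= al_principal oppr0.
    by apply/nonneg_offP => i hi; rewrite mxE al_sigma // (negPf (fP l hl i hi)) oppr0.
  apply/eqP => e; have := PhiD (al_exp l) hN.
  by rewrite subrr Phi0 e mul0r => /eqP; rewrite oner_eq0.
(* For l in f(sigma) the value of y_l may be zero; t_l is set to 1 there, and the value is matched
   through z_i below. *)
have /choice[t ht] : forall l, exists t : k, t != 0 /\ (~~ isf l -> t ^+ N = Phi (al l)).
  move=> l; have [hl|hl] := boolP (isf l); first by exists 1; rewrite oner_neq0.
  have [t e] := closed_root (Phi (al l)) (cdN_gt0 cd); exists t; split=> //.
  by apply: contraNneq (Yunit l hl) => t0; rewrite -e t0 expr0n eqn0Ngt (cdN_gt0 cd).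
pose u (j : 'I_d) : k := \prod_l t l ^ (M l j).
have u0 j : u j != 0.
  by apply/prodf_neq0 => l _; rewrite expfz_neq0 //; case: (ht l).
pose lu (a : 'rV[int]_d) : k := \prod_(j in J) u j ^ (a 0 j).
have lu0 a : lu a != 0 by apply/prodf_neq0 => j _; rewrite expfz_neq0.
(* y_(f j) is x_j times a monomial in the unit coordinates, so its prescribed value is solved for
   x_j without roots. *)
pose z1 : 'rV[k]_d := \row_j (if j \in sigma then Phi (al (f j)) / lu (al (f j)) else u j).
have z1J j : j \in J -> z1 0 j = u j.
  by rewrite finset.in_setC mxE => /negPf->.
have /choice[mm hmm] := fun i => unit_mon cd (class_var V i).
pose lz (a : 'rV[int]_d) : k := \prod_(i < d) z1 0 i ^ (a 0 i).
have lzD a b : nonneg_off J a -> nonneg_off J b -> lz (a + b) = lz a * lz b.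
  move=> ha hb; rewrite /lz -big_split; apply: eq_bigr => i _.
  rewrite [(a + b) 0 i]mxE.
  have [hi|hi] := boolP (i \in J); first by rewrite expfzDr // z1J.
  have := ha i hi; have := hb i hi.
  case: (a 0 i) => // a'; case: (b 0 i) => // b' _ _.
  by rewrite -[Posz a' + Posz b']/(Posz (a' + b')) -!exprnP exprD.
have lz_unit (a : 'rV[int]_d) : (forall i, i \in sigma -> a 0 i = 0) -> lz a != 0.
  move=> ha; apply/prodf_neq0 => i _; have [hi|hi] := boolP (i \in sigma).
    by rewrite ha // expr0z oner_neq0.
  by rewrite expfz_neq0 // z1J // finset.in_setC.
(* x^(mm i) xi_i has degree 0 and x^(mm i) is a unit, so y prescribes the i-th cotangent
   coordinate. *)
pose z2 : 'rV[k]_d := \row_i (y (lmon (mm i) *: 'X_i) / lz (mm i)).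
exists (z1, z2); have xz0 : (xprod k J).@[z1 0] != 0.
  by rewrite (xprod_evalE (z1, z2)); apply/forall_inP => i hi; rewrite z1J.
split=> //.
have lz_al l : lz (al l) = Phi (al l).
  have [/existsP[i /andP[hi /eqP fi]]|hl] := boolP (isf l).
    rewrite /lz (bigID (mem sigma)) /= (bigD1 i) //= big1 => [|j /andP[hj ji]]; last first.
      rewrite al_sigma //; case: eqP => [e|_]; last by rewrite expr0z.
      by rewrite (cdf_inj (cd := cd) hj hi) ?eqxx ?fi // in ji.
    rewrite mulr1 al_sigma // fi eqxx -exprnP expr1 mxE hi fi.
    rewrite [X in _ * X](_ : _ = lu (al l)) ?divfK //.
    rewrite /lu; apply: eq_big => [j|j hj]; first by rewrite finset.in_setC.
    by rewrite mxE (negPf hj).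
  have [_ /(_ hl) <-] := ht l.
  transitivity (\prod_j u j ^ (W j l)).
    apply: eq_bigr => j _; have [hj|hj] := boolP (j \in sigma); last first.
      by rewrite z1J ?finset.in_setC // mxE.
    by rewrite al_sigma // (negPf (fP l hl j hj)) (cdW_sigma cd) // (negPf (fP l hl j hj)) !expr0z.
  have expzM (x : k) (s : seq 'I_d) (F : 'I_d -> int) : x != 0 ->
      \prod_(j <- s) x ^ (F j) = x ^ (\sum_(j <- s) F j).
    move=> x0; elim: s => [|j s IH]; first by rewrite !big_nil expr0z.
    by rewrite !big_cons IH expfzDr.
  have expz_prod (I : Type) (s : seq I) (F : I -> k) (m : int) :
      (\prod_(i <- s) F i) ^ m = \prod_(i <- s) F i ^ m.
    elim: s => [|i s IH]; first by rewrite !big_nil exp1rz.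
    by rewrite !big_cons expfzMl IH.
  (* The exponents are the entries of M W = N, leaving t_l^N, the value of y_l. *)
  transitivity (\prod_l' t l' ^ (\sum_j M l' j * W j l)).
    under eq_bigr do rewrite /u expz_prod.
    rewrite exchange_big /=; apply: eq_bigr => l' _.
    rewrite -expzM; last by case: (ht l').
    by apply: eq_bigr => j _; rewrite exprz_exp.
  have hMW l' : \sum_j M l' j * W j l = (N%:Z) *+ (l' == l).
    by have := congr1 (fun X : 'M_n => X l' l) (cdMW cd); rewrite !mxE.
  rewrite (bigD1 l) //= hMW eqxx mulr1n big1 ?mulr1 // => l' l'l.
  by rewrite hMW (negPf l'l) mulr0n expr0z.
have Phi_lz a : chart_exp a -> Phi a = lz a.
  move=> ha; apply: chart_exp_ind ha => //.
  - exact: Phi0.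
  - by rewrite /lz big1 // => i _; rewrite [X in _ ^ X]mxE expr0z.
  - exact: PhiD.
  - by move=> a' b [_ h1] [_ h2]; exact: lzD.
(* Factors x^(mm i) xi_i of degree 0 are split off one by one until only a function on U_sigma
   remains. *)
have mono b a : class_of V a = class_mnm V b -> nonneg_off J a ->
    y (lmon a *: 'X_[b]) = lz a * \prod_i z2 0 i ^+ b i.
  elim/mnm_ind: b a => [|i b IH] a hc ha.
    rewrite [X in _ * X]big1 ?mulr1 => [|i _]; last by rewrite mnm0E expr0.
    by apply: Phi_lz; split=> //; rewrite hc class_mnm0.
  have [hm1 hm2] := hmm i.
  have hm : nonneg_off J (mm i) by apply/nonneg_offP => j /hm2->.
  have ham : nonneg_off J (a - mm i).
    by apply/nonneg_offP => j hj; rewrite mxE [X in _ + X]mxE hm2 // subr0; exact: (proj1 (nonneg_offP sigma a) ha).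
  have hcm : class_of V (a - mm i) = class_mnm V b.
    by rewrite raddfB /= hc hm1 class_mnmD class_mnmU addrAC subrr add0r.
  have S1 : Sp0' (lmon (mm i) *: 'X_i).
    by apply: Spgr_lmon => //; rewrite add0r class_mnmU.
  have S2 : Sp0' (lmon (a - mm i) *: 'X_[b]).
    by apply: Spgr_lmon => //; rewrite add0r.
  have -> : lmon a *: 'X_[(U_(i) + b)%MM] = (lmon (mm i) *: 'X_i) * (lmon (a - mm i) *: 'X_[b]) :> {mpoly K[d]}.
    by rewrite -scalerAl -scalerAr scalerA -lmonD addrC subrK mpolyXD.
  rewrite (quot_valM y S1 S2) IH //.
  have -> : lz a = lz (mm i) * lz (a - mm i) by rewrite -lzD // addrC subrK.
  have -> : y (lmon (mm i) *: 'X_i) = z2 0 i * lz (mm i).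
    by rewrite mxE divfK // lz_unit.
  have -> : \prod_j z2 0 j ^+ (U_(i) + b)%MM j = z2 0 i * \prod_j z2 0 j ^+ b j.
    rewrite (bigD1 i) //= [in RHS](bigD1 i) //= mulrA -exprS mnmDE mnm1E eqxx add1n.
    by congr (_ * _); apply: eq_bigr => j ji; rewrite mnmDE mnm1E eq_sym (negPf ji) add0n.
  have aux (L : comRingType) (x1 x2 x3 x4 : L) : x1 * x2 * (x3 * x4) = x2 * x3 * (x1 * x4) by ring.
  exact: aux.
have y0 : y 0 = 0.
  have := quot_valD y (@Spgr0 k n d V J 0) (@Spgr0 k n d V J 0); rewrite addr0 => /eqP.
  by rewrite -subr_eq0 opprD addNKr oppr_eq0 => /eqP.
have term b x : Sgr J (class_mnm V b) x -> Sgr J (class_mnm V b) x /\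
    y (x *: 'X_[b]) = spev (z1, z2) J (x *: 'X_[b]).
  apply: (Sgr_ind (P := fun x => Sgr J (class_mnm V b) x /\
    y (x *: 'X_[b]) = spev (z1, z2) J (x *: 'X_[b]))).
  - by rewrite scale0r y0 spev0 //; split=> //; exact: Sgr0.
  - move=> x1 x2 [h1 e1] [h2 e2]; split; first exact: SgrD.
    have S1 : Sp0' (x1 *: 'X_[b]) by apply: SpgrZX; rewrite add0r.
    have S2 : Sp0' (x2 *: 'X_[b]) by apply: SpgrZX; rewrite add0r.
    by rewrite scalerDl (quot_valD y S1 S2) spevD ?e1 ?e2 //; [exact: Spgr_Sploc S1|exact: Spgr_Sploc S2].
  move=> a s ha hc; have hS : Sgr J (class_mnm V b) (const s * lmon a).
    by apply: SgrZ; rewrite -hc; apply: lmon_Sgr.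
  split=> //; rewrite spev_lmon // -scalerA -mul_mpolyC.
  have Sc : Sp0' (const s)%:MP by apply: SpgrC; exact: Sgr_const.
  have Sm : Sp0' (lmon a *: 'X_[b]) by apply: Spgr_lmon => //; rewrite add0r.
  by rewrite (quot_valM y Sc Sm) quot_valC mono // mulrA.
move=> q hq; rewrite [q]mpolyE.
have hqb b : Sgr J (class_mnm V b) q@_b by have := hq b; rewrite add0r.
have St b : Sp0' (q@_b *: 'X_[b]) by apply: SpgrZX; rewrite add0r.
elim: (msupp q) => [|b s IH]; first by rewrite !big_nil y0 spev0.
have Ss : Sp0' (\sum_(j <- s) q@_j *: 'X_[j]).
  by elim/big_ind: _ => [|x x'|j _]; [exact: Spgr0|exact: SpgrD|exact: St].
rewrite !big_cons (quot_valD y (St b) Ss) spevD //; [|exact: Spgr_Sploc (St b)|exact: Spgr_Sploc Ss].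
by rewrite IH; congr (_ + _); case: (term b _ (hqb b)).
Qed.

End PointFromQuot.

(** * Compatibility with gluing and the comparison of the two varieties *)

Section Gluing.
Variables (k : fieldType) (n d : nat) (V : 'M[int]_(d, n)) (Delta : {set {set 'I_d}}).
Hypothesis pchar0 : [pchar k] =i pred0.

Lemma glue_ptP (I : Type) (P : I -> Type) (step : forall i j, P i -> P j -> Prop)
    (i j : I) (p : P i) (q : P j) :
  glue_pt step p = glue_pt step q <->
  clos_refl_sym_trans _ (@glue_step I P step) (existT P i p) (existT P j q).
Proof.
split=> [/eqmodP/asboolP //|h].
by apply/eqmodP/asboolP.
Qed.

Lemma glue_ychi (i j : fan_cone Delta) (chi : cot_chart k V (val i)) (chi' : cot_chart k V (val j)) :
  glue_pt (@cot_step k n d V Delta) chi = glue_pt (@cot_step k n d V Delta) chi' ->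
  glue_pt (@quot_step k n d V Delta) (ychi pchar0 chi)
    = glue_pt (@quot_step k n d V Delta) (ychi pchar0 chi').
Proof.
move=> /glue_ptP h; apply/glue_ptP.
pose P1 (i : fan_cone Delta) := cot_chart k V (val i).
pose P2 (i : fan_cone Delta) := quot_chart k V (val i).
pose H (a : glue_sum P1) : glue_sum P2 := existT P2 (projT1 a) (ychi pchar0 (projT2 a)).
suff : forall a b : glue_sum P1,
    clos_refl_sym_trans _ (glue_step (@cot_step k n d V Delta)) a b ->
    clos_refl_sym_trans _ (glue_step (@quot_step k n d V Delta)) (H a) (H b).
  by move=> /(_ _ _ h).
move=> a b; elim=> [x x' [sub e]|x|x x' _ IH|x x' x'' _ IH1 _ IH2].
- apply: rst_step; split; first exact: sub.
  by move=> q hq; exact: (ychi_step pchar0 sub e hq).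
- exact: rst_refl.
- exact: rst_sym.
- exact: rst_trans IH1 IH2.
Qed.

End Gluing.

Theorem theorem5p7 (k : closedFieldType) (R : realType) (n d : nat)
    (V : 'M[int]_(d, n)) (Delta : {set {set 'I_d}})
    (F : lmodType (weyl_algebra k d)) (Fgr : class_group V -> set F) :
  [pchar k] =i pred0 ->
  smooth_fan R V Delta ->
  theta_graded Fgr ->
  finitely_generated F ->
  torus_invariant V (Ch F) /\
  [set p : quot_space k V Delta |
     exists2 z, (Ch F `\` irrelevant_locus Delta) z & quot_map z p] =
  [set p | exists2 c : cotangent k V Delta, Ch_sheaf Fgr c & cot_embed c p].
Proof.
move=> pchar0 sf thF fg.
have [r [g [cl [hgr hgen]]]] := homogeneous_generators thF fg.
have good0 := Fil0_good pchar0 hgen.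
split=> [t z ht /(Ch_supp pchar0 _ good0) hz|].
  by apply/(Ch_supp pchar0 _ good0); exact: (supp_torus pchar0 ht thF hgr hgen).
apply/seteqP; split=> p.
  move=> [z [/(Ch_supp pchar0 _ good0) hz _] [i [y [xz0 hy ->]]]].
  have [cd] := chart_data_exists sf (valP i).
  have suppG := supp_A_to_chart pchar0 thF hgr hgen cd xz0 hz.
  have goodG := G0_good pchar0 thF hgr hgen cd.
  (* Operators in the kernel of phi act as zero on sections, so they drop the filtration and their
     symbols vanish on the support; thus z lies over T^*X. *)
  have hK m (P : weyl k (~: val i)%SET) : BF0 V m P ->
      chart_phi P (fun _ : chart_ring k V (val i) => 0) -> chz z m P = 0.
    move=> hP [_ eP]; apply: suppG => // l u [_ hu].
    rewrite (phi_kernel pchar0 thF cd) //; [exact: (prev0 goodG)|by case: hP|].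
    by move=> w hw; have := eP (mkchart hw).
  pose chi := cot_of_point pchar0 cd xz0 hK.
  exists (glue_pt (@cot_step k n d V Delta) chi).
    exists (fun sigma => @G0 k n d V F Fgr r g (~: sigma)%SET).
      exact: (good_D pchar0 sf thF hgr hgen).
    exists i, chi; split=> //; apply/(in_support_chartP pchar0 thF cd chi goodG).
    by move=> m P hP dP; rewrite cot_of_pointE //; exact: suppG.
  exists i, chi, y; split=> // m P D s PD /(has_symbolE pchar0)[oP es].
  have hP : BF0 V m P by split=> //; case: PD.
  have hs : Spgr (~: val i)%SET (0 : class_group V) s.
    by rewrite es; apply: Spgr_pihomog; apply/(weyl_grE pchar0); case: hP.
  rewrite [RHS](cotvalE pchar0 xz0 hK hP PD) /chz /wsymb -es.
  have [N [q e]] := Sploc_clear (Spgr_Sploc hs).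
  rewrite (spevE xz0 (esym e)); apply: hy => //.
  by rewrite -e scalerA mulVf ?scale1r // xprodF_neq0.
(* The support condition and the embedding may represent c on different charts i and i'. The point z
   is built on chart i, and the two are identified at the end. *)
move=> [c [G [Gaff _] [i [chi [ec hsupp]]]] [i' [chi' [y' [ec' -> hy']]]]].
have [cd] := chart_data_exists sf (valP i).
have goodG := G0_good pchar0 thF hgr hgen cd.
have goodGi := proj1 (good_chartP pchar0 thF cd _) (Gaff _ (valP i)).
(* The given filtration G is arbitrary; it is exchanged for the one induced from F. *)
have supp0 : supp_at (@BF0 k n d V (val i)) (@G0 k n d V F Fgr r g (~: val i)%SET) (chiW chi).
  apply: (supp_at_indep (BF0_filtered V (val i) pchar0) goodG goodGi).
    exact: chiW_character.
  exact/(in_support_chartP pchar0 thF cd chi goodGi).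
have [z [xz0 hz]] := point_of_quot cd (ychi pchar0 chi).
exists z.
  split; last by move=> /(_ _ (valP i)) /eqP; rewrite (negPf xz0).
  apply/(Ch_supp pchar0 _ good0); apply: (supp_chart_to_A pchar0 thF hgr hgen cd xz0).
  move=> m P hP dP; have [gP oP] := hP.
  have hs : Spgr (~: val i)%SET (0 : class_group V) (wsymb m P).
    by apply: Spgr_pihomog; apply/(weyl_grE pchar0).
  rewrite /chz -hz // (ychi_symbol pchar0 chi (phiDP pchar0 gP) (m := m)); first exact: supp0.
  exact/(has_symbolE pchar0).
exists i, (ychi pchar0 chi); split=> //.
  move=> q m s es hs; rewrite hz //; apply: (spevE xz0).
  by rewrite es scalerA mulfV ?scale1r // xprodF_neq0.
(* On chart i' the point y' is only known on symbols, hence agrees with [ychi] of chi' on [Sp0];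
   passing from i' to i then uses that both represent c. *)
transitivity (glue_pt (@quot_step k n d V Delta) (ychi pchar0 chi')).
  apply/glue_ptP; apply: rst_step; split=> // q hq.
  by apply/esym/(ychi_unique pchar0 hy').
by apply: glue_ychi; rewrite -ec -ec'.
Qed.
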